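(* Let $\mathbb{K}$ be an algebraically closed field of characteristic zero and let $X$ be a normal affine algebraic surface over $\mathbb{K}$ admitting a commutative monoid structure of rank $r$. Then $X$ is toric, and any multiplication on $X$ (of a commutative monoid structure of rank $r$) is coherent with a multiplication on $\overline{X}$, where $\pi\colon\overline{X}\to X$ is the Cox construction. Up to isomorphism of monoid structures on $X$ and $\overline{X}$, the product on $\overline{X}$ is given by the following formulas in Cox coordinates $x_1,x_2$. 1) If $r=2$, then $\overline{X}=\mathbb{A}^2$, or $\overline{X}=X=\mathbb{A}^1\times\mathbb{K}^\times$, or $\overline{X}=X=(\mathbb{K}^\times)^2$, and $$(x_1,x_2)\cdot(y_1,y_2)=(x_1y_1,x_2y_2).$$ 2) If $r=1$ and $\overline{X}=\mathbb{A}^2$, then $$(x_1,x_2)\cdot(y_1,y_2)=(x_1y_2^{\langle p_2,e\rangle}+x_2^{\langle p_2,e\rangle}y_1,\;x_2y_2),\quad e\in\mathfrak{R}_1,$$ or $$(x_1,x_2)\cdot(y_1,y_2)=(x_1y_1,\;x_2y_1^{\langle p_1,e\rangle}+x_1^{\langle p_1,e\rangle}y_2),\quad e\in\mathfrak{R}_2,$$ where $p_1,p_2$ are the primitive vectors on the rays of the fan of $X$ and $\mathfrak{R}_1,\mathfrak{R}_2$ are the sets of Demazure roots of $X$ corresponding to these rays. 3) If $r=1$ and $\overline{X}=X=\mathbb{A}^1\times\mathbb{K}^\times$, then $$(x_1,x_2)\cdot(y_1,y_2)=(x_1y_2^{e}+x_2^{e}y_1,\;x_2y_2),\quad e\in\mathbb{Z}.$$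 4) If $r=0$, then $\overline{X}=X=\mathbb{A}^2$ and $$(x_1,x_2)\cdot(y_1,y_2)=(x_1+y_1,\;x_2+y_2).$$
   Context: Monoids. An algebraic monoid is an irreducible algebraic variety with an associative multiplication that is a morphism of varieties and has a unit. Isomorphisms of monoids are isomorphisms of varieties preserving products and units. The set $G(X)$ of invertible elements is a connected algebraic group, open in $X$. If $X$ is affine and commutative, $G(X)\cong\mathbb{G}_m^r\times\mathbb{G}_a^s$, where $\mathbb{G}_m=(\mathbb{K}^\times,\times)$, $\mathbb{G}_a=(\mathbb{K},+)$, and $r$ is the rank of the monoid. Toric notation. A normal irreducible surface $X$ is toric if a torus $T\cong(\mathbb{K}^\times)^2$ acts effectively on it with an open orbit. Let $M$ be the character lattice of $T$ and $N$ the dual lattice, with pairing $\langle\cdot,\cdot\rangle$. For affine toric $X$, $\mathbb{K}[X]=\bigoplus_{u\in S_X}\mathbb{K}\chi^u$ with $S_X=M\cap\omega$, where $\omega\subseteq M_{\mathbb{Q}}$ is a rational polyhedral cone; $\sigma\subseteq N_{\mathbb{Q}}$ is the dual cone, the fan of $X$ consists of the faces of $\sigma$, $\rho_1,\dots,\rho_m$ (here $0\le m\le2$) are the rays of $\sigma$, and $p_i\in N$ is the primitive lattice vector on $\rho_i$. The Demazure roots corresponding to $\rho_i$ are the elements of $\mathfrak{R}_i=\{e\in M\mid\langle p_i,e\rangle=-1,\ \langle p_j,e\rangle\ge0\text{ for all }j\ne i\}$. Cox construction. Let $\widetilde m=2-m$ be the codimension of $\mathrm{span}(\sigma)$ in $N_{\mathbb{Q}}$.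 Fix a splitting $N=N_0\oplus\mathbb{Z}^{\widetilde m}$ with $N_0=\mathrm{span}(\sigma)\cap N$, and the dual splitting $M=M_0\oplus\mathbb{Z}^{\widetilde m}$; write $u=u_0+\tilde u$ with $u_0\in M_0$, $\tilde u=(\tilde u_{m+1},\dots,\tilde u_{2})\in\mathbb{Z}^{\widetilde m}$. Put $\overline{X}=\mathbb{A}^m\times(\mathbb{K}^\times)^{\widetilde m}$ with (Cox) coordinates $x_1,x_2$, the first $m$ being coordinates on $\mathbb{A}^m$ and the others on $(\mathbb{K}^\times)^{\widetilde m}$. The Cox construction is the morphism $\pi\colon\overline{X}\to X$ whose comorphism $\mathbb{K}[X]\hookrightarrow\mathbb{K}[\overline{X}]$ is $$\chi^u\mapsto\prod_{j\le m}x_j^{\langle p_j,u\rangle}\prod_{m<j\le2}x_j^{\tilde u_j},\qquad u\in S_X.$$ It is the categorical quotient of $\overline{X}$ by the quasitorus $H_X=\mathrm{Hom}(\mathrm{Cl}(X),\mathbb{K}^\times)$. Coherence. A monoid multiplication $\mu\colon X\times X\to X$ is coherent with a monoid multiplication $\bar\mu\colon\overline{X}\times\overline{X}\to\overline{X}$ if $\pi\circ\bar\mu=\mu\circ(\pi\times\pi)$. *)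

(* Defs.v *)
From HB Require Import structures.
From mathcomp Require Import all_boot all_order all_algebra.
From mathcomp Require Export mpoly.

Set Implicit Arguments.
Unset Strict Implicit.
Unset Printing Implicit Defensive.

Import Order.TTheory GRing.Theory Num.Theory.
Local Open Scope ring_scope.

(** Points of the affine space K^n are row vectors, and varieties are locally
    closed subsets of some K^n.  Maps between varieties are total functions on
    the ambient spaces; only their values on the variety are meaningful, and
    every condition below is restricted to points of the variety. *)

Section Varieties.
Variable K : closedFieldType.

Definition zero_locus n (S : {mpoly K[n]} -> Prop) (x : 'rV[K]_n) : Prop :=
  forall f, S f -> f.@[x 0] = 0.

Definition zariski_closed n (V : 'rV[K]_n -> Prop) : Prop :=
  exists S : {mpoly K[n]} -> Prop, forall x, V x <-> zero_locus S x.

Definition open_in n (V U : 'rV[K]_n -> Prop) : Prop :=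
  exists S : {mpoly K[n]} -> Prop, forall x, U x <-> V x /\ ~ zero_locus S x.

Definition locally_closed n (V : 'rV[K]_n -> Prop) : Prop :=
  exists C : 'rV[K]_n -> Prop, zariski_closed C /\ open_in C V.

Definition irreducible n (V : 'rV[K]_n -> Prop) : Prop :=
  (exists x, V x) /\
  forall C1 C2 : 'rV[K]_n -> Prop, zariski_closed C1 -> zariski_closed C2 ->
    (forall x, V x -> C1 x \/ C2 x) ->
    (forall x, V x -> C1 x) \/ (forall x, V x -> C2 x).

(** Regular functions are locally quotients of polynomials. *)
Definition regular n (V : 'rV[K]_n -> Prop) (f : 'rV[K]_n -> K) : Prop :=
  forall x, V x -> exists a b : {mpoly K[n]}, b.@[x 0] != 0 /\
    forall y, V y -> b.@[y 0] != 0 -> f y = a.@[y 0] / b.@[y 0].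

Definition morphism n k (V : 'rV[K]_n -> Prop) (W : 'rV[K]_k -> Prop)
    (F : 'rV[K]_n -> 'rV[K]_k) : Prop :=
  (forall x, V x -> W (F x)) /\ forall j, regular V (fun x => F x 0 j).

Definition isomorphism n k (V : 'rV[K]_n -> Prop) (W : 'rV[K]_k -> Prop)
    (F : 'rV[K]_n -> 'rV[K]_k) : Prop :=
  morphism V W F /\
  exists G : 'rV[K]_k -> 'rV[K]_n, [/\ morphism W V G,
    forall x, V x -> G (F x) = x & forall y, W y -> F (G y) = y].

Definition product n k (V : 'rV[K]_n -> Prop) (W : 'rV[K]_k -> Prop)
    (z : 'rV[K]_(n + k)) : Prop := V (lsubmx z) /\ W (rsubmx z).

Definition morphism2 n k l (V : 'rV[K]_n -> Prop) (W : 'rV[K]_k -> Prop)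
    (Z : 'rV[K]_l -> Prop) (F : 'rV[K]_n -> 'rV[K]_k -> 'rV[K]_l) : Prop :=
  morphism (product V W) Z (fun z => F (lsubmx z) (rsubmx z)).

(** The fractions a i / b i, as elements of the function field of the
    irreducible variety V, are algebraically independent over K. *)
Definition alg_independent n (V : 'rV[K]_n -> Prop) d
    (a b : 'I_d -> {mpoly K[n]}) : Prop :=
  (forall i, exists x, V x /\ (b i).@[x 0] != 0) /\
  forall P : {mpoly K[d]},
    (forall x, V x -> (forall i, (b i).@[x 0] != 0) ->
       P.@[fun i => (a i).@[x 0] / (b i).@[x 0]] = 0) ->
    P = 0.

(** The transcendence degree of the function field of V is d. *)
Definition has_dimension n (V : 'rV[K]_n -> Prop) (d : nat) : Prop :=
  (exists a b : 'I_d -> {mpoly K[n]}, alg_independent V a b) /\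
  ~ (exists a b : 'I_d.+1 -> {mpoly K[n]}, alg_independent V a b).

(** For V closed and irreducible: K[V], i.e., the ring of restrictions of
    polynomials, is integrally closed in its fraction field. *)
Definition normal_affine n (V : 'rV[K]_n -> Prop) : Prop :=
  forall (a b : {mpoly K[n]}) (Q : {poly {mpoly K[n]}}),
    (exists x, V x /\ b.@[x 0] != 0) -> Q \is monic ->
    (forall x, V x -> b.@[x 0] != 0 ->
       (map_poly (meval (x 0)) Q).[a.@[x 0] / b.@[x 0]] = 0) ->
    exists g : {mpoly K[n]}, forall x, V x -> b.@[x 0] != 0 ->
      a.@[x 0] / b.@[x 0] = g.@[x 0].

Definition normal_affine_surface n (V : 'rV[K]_n -> Prop) : Prop :=
  [/\ zariski_closed V, irreducible V, has_dimension V 2 & normal_affine V].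

End Varieties.

Section Monoids.
Variable K : closedFieldType.

Definition is_unit n (V : 'rV[K]_n -> Prop) (mu : 'rV[K]_n -> 'rV[K]_n -> 'rV[K]_n)
    (e : 'rV[K]_n) : Prop :=
  V e /\ forall x, V x -> mu e x = x /\ mu x e = x.

Definition algebraic_monoid n (V : 'rV[K]_n -> Prop)
    (mu : 'rV[K]_n -> 'rV[K]_n -> 'rV[K]_n) : Prop :=
  [/\ locally_closed V /\ irreducible V,
      morphism2 V V V mu,
      forall x y z, V x -> V y -> V z -> mu (mu x y) z = mu x (mu y z)
    & exists e, is_unit V mu e].

Definition commutative_monoid n (V : 'rV[K]_n -> Prop)
    (mu : 'rV[K]_n -> 'rV[K]_n -> 'rV[K]_n) : Prop :=
  algebraic_monoid V mu /\ forall x y, V x -> V y -> mu x y = mu y x.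

Definition invertible n (V : 'rV[K]_n -> Prop)
    (mu : 'rV[K]_n -> 'rV[K]_n -> 'rV[K]_n) (x : 'rV[K]_n) : Prop :=
  V x /\ exists y, [/\ V y, is_unit V mu (mu x y) & is_unit V mu (mu y x)].

Definition monoid_isomorphism n k (V : 'rV[K]_n -> Prop)
    (mu : 'rV[K]_n -> 'rV[K]_n -> 'rV[K]_n) (W : 'rV[K]_k -> Prop)
    (nu : 'rV[K]_k -> 'rV[K]_k -> 'rV[K]_k) (F : 'rV[K]_n -> 'rV[K]_k) : Prop :=
  [/\ isomorphism V W F,
      forall x y, V x -> V y -> F (mu x y) = nu (F x) (F y)
    & forall e, is_unit V mu e -> is_unit W nu (F e)].

Definition GmGa r s (z : 'rV[K]_(r + s)) : Prop :=
  forall i : 'I_r, lsubmx z 0 i != 0.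

Definition GmGa_mul r s (z w : 'rV[K]_(r + s)) : 'rV[K]_(r + s) :=
  row_mx (\row_i (lsubmx z 0 i * lsubmx w 0 i)) (rsubmx z + rsubmx w).

Definition has_rank n (V : 'rV[K]_n -> Prop)
    (mu : 'rV[K]_n -> 'rV[K]_n -> 'rV[K]_n) (r : nat) : Prop :=
  exists (s : nat) (F : 'rV[K]_(r + s) -> 'rV[K]_n),
    monoid_isomorphism (@GmGa r s) (@GmGa_mul r s) (invertible V mu) mu F.

Definition commutative_monoid_of_rank n (V : 'rV[K]_n -> Prop)
    (mu : 'rV[K]_n -> 'rV[K]_n -> 'rV[K]_n) (r : nat) : Prop :=
  commutative_monoid V mu /\ has_rank V mu r.

End Monoids.

Section Cones.

Definition pairing (R : pzRingType) (p u : 'rV[R]_2) : R :=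
  \sum_i p 0 i * u 0 i.

Definition to_rat (u : 'rV[int]_2) : 'rV[rat]_2 := map_mx intr u.

Definition cone_hull (S : 'rV[rat]_2 -> Prop) (w : 'rV[rat]_2) : Prop :=
  exists (k : nat) (a : 'I_k -> rat) (s : 'I_k -> 'rV[rat]_2),
    [/\ forall i, 0 <= a i, forall i, S (s i) & w = \sum_i a i *: s i].

Definition linear_span (S : 'rV[rat]_2 -> Prop) (w : 'rV[rat]_2) : Prop :=
  exists (k : nat) (a : 'I_k -> rat) (s : 'I_k -> 'rV[rat]_2),
    (forall i, S (s i)) /\ w = \sum_i a i *: s i.

Definition dual_cone (C : 'rV[rat]_2 -> Prop) (v : 'rV[rat]_2) : Prop :=
  forall u, C u -> 0 <= pairing v u.

Definition is_face (C F : 'rV[rat]_2 -> Prop) : Prop :=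
  exists u, dual_cone C u /\ forall v, F v <-> C v /\ pairing v u = 0.

(** p is the primitive lattice vector on a ray (one-dimensional face) of C. *)
Definition ray_generator (C : 'rV[rat]_2 -> Prop) (p : 'rV[int]_2) : Prop :=
  coprimez (p 0 0) (p 0 1) /\
  is_face C (fun v => exists2 a : rat, 0 <= a & v = a *: to_rat p).

End Cones.

(** The torus is T = (K\0)^2, so that M = Z^2 (u is the character
    t |-> t_1^u_1 t_2^u_2) and N = Z^2 with the standard pairing. *)
Section Toric.
Variable K : closedFieldType.

Definition torus (t : 'rV[K]_2) : Prop := forall i, t 0 i != 0.

Definition torus_mul (s t : 'rV[K]_2) : 'rV[K]_2 := \row_i (s 0 i * t 0 i).

Definition torus_one : 'rV[K]_2 := const_mx 1.

Definition character (u : 'rV[int]_2) (t : 'rV[K]_2) : K :=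
  \prod_i t 0 i ^ u 0 i.

Definition torus_action n (X : 'rV[K]_n -> Prop)
    (act : 'rV[K]_2 -> 'rV[K]_n -> 'rV[K]_n) : Prop :=
  [/\ morphism2 torus X X act,
      forall x, X x -> act torus_one x = x
    & forall s t x, torus s -> torus t -> X x ->
        act (torus_mul s t) x = act s (act t x)].

Definition effective n (X : 'rV[K]_n -> Prop)
    (act : 'rV[K]_2 -> 'rV[K]_n -> 'rV[K]_n) : Prop :=
  forall t, torus t -> (forall x, X x -> act t x = x) -> t = torus_one.

(** An effective action of T on X, with a base point x0 of its open orbit. *)
Definition toric_structure n (X : 'rV[K]_n -> Prop)
    (act : 'rV[K]_2 -> 'rV[K]_n -> 'rV[K]_n) (x0 : 'rV[K]_n) : Prop :=
  [/\ torus_action X act, effective X act, X x0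
    & open_in X (fun x => exists2 t, torus t & x = act t x0)].

Definition toric n (X : 'rV[K]_n -> Prop) : Prop :=
  exists act x0, toric_structure X act x0.

(** f is the regular function chi^u on X; the base point identifies T with the
    open orbit, by t |-> t x0. *)
Definition character_function n (X : 'rV[K]_n -> Prop)
    (act : 'rV[K]_2 -> 'rV[K]_n -> 'rV[K]_n) (x0 : 'rV[K]_n)
    (u : 'rV[int]_2) (f : 'rV[K]_n -> K) : Prop :=
  regular X f /\ forall t, torus t -> f (act t x0) = character u t.

Definition weight_monoid n (X : 'rV[K]_n -> Prop)
    (act : 'rV[K]_2 -> 'rV[K]_n -> 'rV[K]_n) (x0 : 'rV[K]_n)
    (u : 'rV[int]_2) : Prop :=
  exists f, character_function X act x0 u f.

(** The cone omega in M_Q and its dual sigma in N_Q. *)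
Definition weight_cone n (X : 'rV[K]_n -> Prop)
    (act : 'rV[K]_2 -> 'rV[K]_n -> 'rV[K]_n) (x0 : 'rV[K]_n) :
    'rV[rat]_2 -> Prop :=
  cone_hull (fun w => exists2 u, weight_monoid X act x0 u & w = to_rat u).

Definition fan_cone n (X : 'rV[K]_n -> Prop)
    (act : 'rV[K]_2 -> 'rV[K]_n -> 'rV[K]_n) (x0 : 'rV[K]_n) :
    'rV[rat]_2 -> Prop :=
  dual_cone (weight_cone X act x0).

(** Indices are 0 and 1 instead of 1 and 2.  For j < m, the vectors q j are the
    primitive vectors on the m rays of sigma, without repetition.  For j >= m,
    they are a basis of the complement Z^(2-m) of N_0 = span(sigma) /\ N in N;
    the coordinates of u~ in the dual splitting of M are then
    u~_j = <q j, u>. *)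
Definition cox_vectors (sigma : 'rV[rat]_2 -> Prop) (m : nat)
    (q : 'I_2 -> 'rV[int]_2) : Prop :=
  let N0 (v : 'rV[int]_2) := linear_span sigma (to_rat v) in
  [/\ (m <= 2)%N,
      {in [pred j : 'I_2 | (j < m)%N] &, injective q},
      forall p, ray_generator sigma p <-> exists2 j : 'I_2, (j < m)%N & p = q j,
      forall v, exists (v0 : 'rV[int]_2) (c : 'I_2 -> int),
        N0 v0 /\ v = v0 + \sum_(j < 2 | (m <= j)%N) c j *: q j
    & forall (v0 : 'rV[int]_2) (c : 'I_2 -> int), N0 v0 ->
        v0 + \sum_(j < 2 | (m <= j)%N) c j *: q j = 0 ->
        v0 = 0 /\ forall j : 'I_2, (m <= j)%N -> c j = 0].

(** A^m x (K\0)^(2-m) *)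
Definition cox_space (m : nat) (x : 'rV[K]_2) : Prop :=
  forall j : 'I_2, (m <= j)%N -> x 0 j != 0.

(** K[X] is spanned by the chi^u, so that the last condition determines the
    comorphism of pi. *)
Definition cox_construction n (X : 'rV[K]_n -> Prop)
    (act : 'rV[K]_2 -> 'rV[K]_n -> 'rV[K]_n) (x0 : 'rV[K]_n)
    (m : nat) (q : 'I_2 -> 'rV[int]_2) (pi : 'rV[K]_2 -> 'rV[K]_n) : Prop :=
  [/\ cox_vectors (fan_cone X act x0) m q,
      morphism (cox_space m) X pi
    & forall u f, character_function X act x0 u f ->
        forall x, cox_space m x -> f (pi x) = \prod_(j < 2) x 0 j ^ pairing (q j) u].

Definition demazure_root (m : nat) (q : 'I_2 -> 'rV[int]_2) (i : 'I_2)
    (e : 'rV[int]_2) : Prop :=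
  [/\ (i < m)%N, pairing (q i) e = -1
    & forall j : 'I_2, (j < m)%N -> j != i -> 0 <= pairing (q j) e].

Definition coherent n (m : nat) (pi : 'rV[K]_2 -> 'rV[K]_n)
    (mu : 'rV[K]_n -> 'rV[K]_n -> 'rV[K]_n)
    (mubar : 'rV[K]_2 -> 'rV[K]_2 -> 'rV[K]_2) : Prop :=
  forall x y, cox_space m x -> cox_space m y -> pi (mubar x y) = mu (pi x) (pi y).

Definition vec2 (a b : K) : 'rV[K]_2 := \row_(j < 2) (if j == 0 then a else b).

(** The formulas for the product in Cox coordinates; d is an exponent in Z,
    nonnegative unless the base is invertible. *)
Definition mulGmGm (x y : 'rV[K]_2) : 'rV[K]_2 :=
  vec2 (x 0 0 * y 0 0) (x 0 1 * y 0 1).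

Definition mulGaGm (d : int) (x y : 'rV[K]_2) : 'rV[K]_2 :=
  vec2 (x 0 0 * y 0 1 ^ d + x 0 1 ^ d * y 0 0) (x 0 1 * y 0 1).

Definition mulGmGa (d : int) (x y : 'rV[K]_2) : 'rV[K]_2 :=
  vec2 (x 0 0 * y 0 0) (x 0 1 * y 0 0 ^ d + x 0 0 ^ d * y 0 1).

Definition mulGaGa (x y : 'rV[K]_2) : 'rV[K]_2 :=
  vec2 (x 0 0 + y 0 0) (x 0 1 + y 0 1).

Definition given_by (m : nat) (nu F : 'rV[K]_2 -> 'rV[K]_2 -> 'rV[K]_2) : Prop :=
  forall x y, cox_space m x -> cox_space m y -> nu x y = F x y.

(** The list of products on the Cox space in rank r.  The equality of the Cox
    space with X means that pi is an isomorphism. *)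
Definition normal_form n (X : 'rV[K]_n -> Prop) (r m : nat)
    (q : 'I_2 -> 'rV[int]_2) (pi : 'rV[K]_2 -> 'rV[K]_n)
    (nu : 'rV[K]_2 -> 'rV[K]_2 -> 'rV[K]_2) : Prop :=
  let piso := isomorphism (cox_space m) X pi in
  [\/ [/\ r = 2%N, [\/ m = 2%N, m = 1%N /\ piso | m = 0%N /\ piso]
        & given_by m nu mulGmGm],
      [/\ r = 1%N, m = 2%N
        & (exists2 e, demazure_root m q 0 e
             & given_by m nu (mulGaGm (pairing (q 1) e))) \/
          (exists2 e, demazure_root m q 1 e
             & given_by m nu (mulGmGa (pairing (q 0) e)))],
      [/\ r = 1%N, m = 1%N, piso & exists e : int, given_by m nu (mulGaGm e)]
    | [/\ r = 0%N, m = 2%N, piso & given_by m nu mulGaGa]].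

End Toric.

(* Main.v *)
Require Import Defs.
From HB Require Import structures.
From mathcomp Require Import all_boot all_order all_algebra.
From mathcomp Require Import ring lra zify.
From mathcomp Require cyclic separable cyclotomic.
From Stdlib Require Import Classical.
From Stdlib Require FunctionalExtensionality PropExtensionality.

(** Let [G] be the group of units of a commutative monoid [X] of rank [r].  It is
    a principal open subset of [X] ([units_principal]), hence of dimension 2
    ([rank_sum]), and so it is [G_m^r x G_a^(2 - r)].  Its coordinates restrict to
    those of a torus, and the translations by [G] separate the monomials that occur
    in a function on [X]: scalings separate the powers of a multiplicative
    coordinate, and translations, which give derivatives, those of an additive one.
    So the functions on [X] are spanned by characters of that torus
    ([unit_parametrization_chart]).  This is the definition of a [toric_chart], and
    a toric chart defines a torus action ([toric_of_chart]); conversely a torus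
    action has its orbit map as a chart.

    By normality the weights of a chart form a finitely generated saturated monoid,
    that is, the lattice points of a cone with at most two facets ([facets_exist]).
    The inner normals of the facets are the primitive vectors on the rays of the fan
    ([cox_vectors_of_facets]), and replacing characters by monomials in the
    expansions of the coordinate functions gives the Cox construction
    ([cox_map_exists]).  What it provides is called a [cox_presentation] of [X]:
    functions on [X] are the combinations of the monomials of nonnegative weight.

    Applied to the chart given by [G], this yields one presentation [pi'] in which
    the product is explicit ([monoid_presentation]), because the map to [X] is a
    homomorphism of tori in the coordinates of [G].  In rank one the weights are
    stable under lowering the exponent of the additive coordinate; therefore that
    coordinate is the normal of one facet, and the exponent in the product is the
    value of a Demazure root of this facet on the other one.

    The given Cox construction is another presentation [pi], for an unrelated torus.
    It remains to compare the two ([compare_presentations]).  With fewer than two rays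
    both are isomorphisms ([unimodular_isomorphism]).  With two rays, [pi'] lifts to
    an automorphism [Phi] of the plane with [pi (Phi x) = pi' x]
    ([lift_presentation], [plane_lift]); its coordinates are roots of functions on
    [X], found by unique factorization ([power_of_factor]).  Transporting the product
    along [Phi] gives the coherent product on the Cox space.  Moreover [Phi]
    conjugates the finite groups of diagonal automorphisms over [X], and the linear
    part of [Phi] at the origin shows that these groups coincide, up to exchange of
    the coordinates ([diagonal_conjugates], [weight_lattice_compare]).  Hence the
    identity, or this exchange, descends to an isomorphism of [X]
    ([descend_map]), which brings the product to its normal form. *)

Set Implicit Arguments.
Unset Strict Implicit.
Unset Printing Implicit Defensive.

Import Order.TTheory GRing.Theory Num.Theory.
Local Open Scope ring_scope.

(** * Polynomial functions *)

Section PolynomialFunctions.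
Variable K : closedFieldType.

Definition pfun n (f : 'rV[K]_n -> K) : Prop :=
  exists p : {mpoly K[n]}, forall x, f x = p.@[x 0].

Lemma pfun_eq n (f g : 'rV[K]_n -> K) : (forall x, f x = g x) -> pfun g -> pfun f.
Proof. by move=> fg [p hp]; exists p => x; rewrite fg hp. Qed.

Lemma pfun_poly n (p : {mpoly K[n]}) : pfun (fun x => p.@[x 0]).
Proof. by exists p. Qed.

Lemma pfun_const n c : pfun (fun _ : 'rV[K]_n => c).
Proof. by exists c%:MP => x; rewrite mevalC. Qed.

Lemma pfun_coord n i : pfun (fun x : 'rV[K]_n => x 0 i).
Proof. by exists 'X_i => x; rewrite mevalXU. Qed.

Lemma pfunD n (f g : 'rV[K]_n -> K) : pfun f -> pfun g -> pfun (fun x => f x + g x).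
Proof. by move=> [p hp] [q hq]; exists (p + q) => x; rewrite hp hq mevalD. Qed.

Lemma pfunM n (f g : 'rV[K]_n -> K) : pfun f -> pfun g -> pfun (fun x => f x * g x).
Proof. by move=> [p hp] [q hq]; exists (p * q) => x; rewrite hp hq mevalM. Qed.

Lemma pfunN n (f : 'rV[K]_n -> K) : pfun f -> pfun (fun x => - f x).
Proof. by move=> [p hp]; exists (- p) => x; rewrite hp mevalN. Qed.

Lemma pfunB n (f g : 'rV[K]_n -> K) : pfun f -> pfun g -> pfun (fun x => f x - g x).
Proof. by move=> hf hg; apply: pfunD => //; apply: pfunN. Qed.

Lemma pfunXn n (f : 'rV[K]_n -> K) k : pfun f -> pfun (fun x => f x ^+ k).
Proof. by move=> [p hp]; exists (p ^+ k) => x; rewrite hp rmorphXn. Qed.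

Lemma pfun_sum n I (r : seq I) (P : pred I) (f : I -> 'rV[K]_n -> K) :
  (forall i, pfun (f i)) -> pfun (fun x => \sum_(i <- r | P i) f i x).
Proof.
move=> hf; elim: r => [|i r IH].
  by apply: (pfun_eq _ (pfun_const n 0)) => x; rewrite big_nil.
case Pi: (P i); last by apply: (pfun_eq _ IH) => x; rewrite big_cons Pi.
by apply: (pfun_eq _ (pfunD (hf i) IH)) => x; rewrite big_cons Pi.
Qed.

Lemma pfun_prod n I (r : seq I) (P : pred I) (f : I -> 'rV[K]_n -> K) :
  (forall i, pfun (f i)) -> pfun (fun x => \prod_(i <- r | P i) f i x).
Proof.
move=> hf; elim: r => [|i r IH].
  by apply: (pfun_eq _ (pfun_const n 1)) => x; rewrite big_nil.
case Pi: (P i); last by apply: (pfun_eq _ IH) => x; rewrite big_cons Pi.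
by apply: (pfun_eq _ (pfunM (hf i) IH)) => x; rewrite big_cons Pi.
Qed.

Lemma pfun_comp n k (p : {mpoly K[k]}) (g : 'I_k -> 'rV[K]_n -> K) :
  (forall j, pfun (g j)) -> pfun (fun x => p.@[fun j => g j x]).
Proof.
move=> hg; apply: (@pfun_eq _ _ (fun x =>
  \sum_(m <- msupp p) p@_m * \prod_i g i x ^+ m i)).
  by move=> x; rewrite mevalE.
apply: pfun_sum => m; apply: pfunM; first exact: pfun_const.
by apply: pfun_prod => i; apply: pfunXn.
Qed.

Lemma pfun_comp_row n k (p : {mpoly K[k]}) (g : 'rV[K]_n -> 'rV[K]_k) :
  (forall j, pfun (fun x => g x 0 j)) -> pfun (fun x => p.@[g x 0]).
Proof. exact: (@pfun_comp n k p (fun j x => g x 0 j)). Qed.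

Definition pev n (P : {poly {mpoly K[n]}}) (x : 'rV[K]_n) (t : K) : K :=
  (map_poly (meval (x 0)) P).[t].

Lemma pevD n (P Q : {poly {mpoly K[n]}}) x t :
  pev (P + Q) x t = pev P x t + pev Q x t.
Proof. by rewrite /pev rmorphD hornerD. Qed.

Lemma pevM n (P Q : {poly {mpoly K[n]}}) x t :
  pev (P * Q) x t = pev P x t * pev Q x t.
Proof. by rewrite /pev rmorphM hornerM. Qed.

Lemma pev_sum n (P : {poly {mpoly K[n]}}) x t :
  pev P x t = \sum_(i < size P) (P`_i).@[x 0] * t ^+ i.
Proof.
rewrite /pev (@horner_coef_wide _ (size P)) ?size_poly //.
by apply: eq_bigr => i _; rewrite coef_map.
Qed.

Lemma poly_eq0 (p : {poly K}) : (forall t, p.[t] = 0) -> p = 0.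
Proof.
move=> h; apply/eqP; apply: contraT => /closed_nonrootP[t].
by rewrite /root h eqxx.
Qed.

Lemma pev_eq0 n (P : {poly {mpoly K[n]}}) x :
  (forall t, pev P x t = 0) -> forall i, (P`_i).@[x 0] = 0.
Proof. by move=> /poly_eq0 h i; rewrite -coef_map h coef0. Qed.

Lemma pev_muni n (p : {mpoly K[n.+1]}) (x : 'rV[K]_n.+1) :
  p.@[x 0] = pev (muni p) (\row_i x 0 (lift ord_max i)) (x 0 ord_max).
Proof.
rewrite mevalE muniE /pev rmorph_sum horner_sum; apply: eq_bigr => m _ /=.
rewrite map_polyZ hornerZ map_polyXn hornerXn /= mevalZ !mevalX.
rewrite big_ord_recr /= mulrA; congr (_ * _ * _); apply: eq_bigr => i _.
by rewrite mxE mnmE; congr (x 0 _ ^+ m _); apply: val_inj; rewrite /= /bump leqNgt ltn_ord.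
Qed.

Lemma muniK n (p : {mpoly K[n.+1]}) :
  (map_poly (@mwiden n K) (muni p)).['X_ord_max] = p.
Proof.
rewrite muniE rmorph_sum horner_sum [RHS]mpolyE; apply: eq_bigr => m _ /=.
rewrite map_polyZ hornerZ map_polyXn hornerXn /= mwidenZ mwidenX -scalerAl.
congr (_ *: _); rewrite mpolyXn -mpolyXD; congr 'X_[_].
apply/mnmP => i; rewrite mnmDE mulmnE mnm1E.
have [<-|ni] := eqVneq ord_max i; first by rewrite mnmwiden_ordmax mul1n add0n.
have [j ->] : exists j, i = widen_ord (leqnSn n) j.
  have ltin : (i < n)%N by rewrite ltn_neqAle -ltnS ltn_ord andbT; apply: contra ni => /eqP e; apply/eqP/val_inj.
  by exists (Ordinal ltin); apply: val_inj.
by rewrite mnmwiden_widen mnmE mul0n addn0.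
Qed.

Lemma meval_eq0 n (p : {mpoly K[n]}) : (forall x : 'rV[K]_n, p.@[x 0] = 0) -> p = 0.
Proof.
elim: n p => [|n IH] p hp.
  by have := hp 0; rewrite (nvar0_mpolyC p) mevalC => ->; rewrite mpolyC0.
suff m0 : muni p = 0 by rewrite -(muniK p) m0 rmorph0 horner0.
apply/polyP => i; rewrite coef0; apply: IH => x; apply: pev_eq0 => t.
pose z : 'rV[K]_n.+1 := \row_i (if unlift ord_max i is Some j then x 0 j else t).
rewrite -(hp z) pev_muni mxE unlift_none; congr (pev _ _ t).
by apply/rowP => j; rewrite !mxE liftK.
Qed.

Lemma meval_inj n (p q : {mpoly K[n]}) :
  (forall x : 'rV[K]_n, p.@[x 0] = q.@[x 0]) -> p = q.
Proof.
move=> h; apply/eqP; rewrite -subr_eq0; apply/eqP/meval_eq0 => x.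
by rewrite mevalB h subrr.
Qed.

Lemma meval_neq0 n (p : {mpoly K[n]}) : p != 0 -> exists x : 'rV[K]_n, p.@[x 0] != 0.
Proof.
move=> p0; apply: NNPP => h; case/negP: p0; apply/eqP/meval_eq0 => x.
by apply/eqP; apply: contraT => px; case: h; exists x.
Qed.
End PolynomialFunctions.

(** * The Nullstellensatz *)

Section Nullstellensatz.
Variable K : closedFieldType.

Definition ideal (R : comNzRingType) (I : R -> Prop) : Prop :=
  [/\ I 0, forall a b, I a -> I b -> I (a + b) & forall a b, I b -> I (a * b)].

Lemma ideal_sum (R : comNzRingType) (I : R -> Prop) (J : finType) (f : J -> R) :
  ideal I -> (forall j, I (f j)) -> I (\sum_j f j).
Proof. by move=> [I0 ID _] hf; elim/big_ind: _. Qed.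

(** The Euclidean algorithm: at a root of [p], take the remainder modulo [p] of an
    element of the ideal that does not vanish there. *)
Lemma univariate_nullstellensatz (I : {poly K} -> Prop) (p : {poly K}) :
  (forall q r, I q -> I r -> I (q + r)) -> (forall q r, I r -> I (q * r)) ->
  p != 0 -> I p -> (forall z, exists2 q, I q & q.[z] != 0) -> I 1.
Proof.
move=> ID IM p0 Ip nozero.
have [b sb] := ubnP (size p); elim: b p p0 Ip sb => // b IHb p p0 Ip sp.
have [s1|s1] := eqVneq (size p) 1%N.
  have pc : p = (p`_0)%:P by apply: size1_polyC; rewrite s1.
  rewrite -(_ : (p`_0)^-1%:P * p = 1); first exact: IM.
  rewrite {2}pc -polyCM mulVf //; apply: contra p0 => /eqP h.
  by rewrite pc h polyC0.
have [z /rootP pz] := closed_rootP _ s1; have [q Iq qz] := nozero z.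
have Ir : I (q %% p).
  rewrite -(_ : q + (- (q %/ p)) * p = q %% p); first by apply: ID => //; apply: IM.
  by rewrite {1}(divp_eq q p) mulNr addrAC subrr add0r.
have rz : (q %% p).[z] = q.[z].
  by rewrite [in RHS](divp_eq q p) hornerD hornerM pz mulr0 add0r.
apply: (IHb (q %% p)) => //.
  by apply: contra qz => /eqP r0; rewrite -rz r0 horner0.
by apply: (@leq_trans (size p)); [rewrite ltn_modp | rewrite -ltnS].
Qed.

(** A point is given by the line of direction [c] that contains it: [x] is where
    that line meets the hyperplane on which the last coordinate vanishes, and [t]
    is the position on the line. *)
Definition line_point n (c : 'rV[K]_n.+1) (x : 'rV[K]_n) (t : K) : 'rV[K]_n.+1 :=
  \row_i ((if unlift ord_max i is Some j then x 0 j else 0) + t * c 0 i).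

(** The degree is at most [e] and the coefficient of degree [e] is the constant
    [k], which may be zero; in this form the condition is multiplicative. *)
Definition top_coef n (P : {poly {mpoly K[n]}}) (e : nat) (k : K) : Prop :=
  (size (P - k%:MP *: 'X^e)%R <= e)%N.

Lemma top_coef1 n : @top_coef n 1 0 1.
Proof. by rewrite /top_coef expr0 mpolyC1 scale1r subrr size_poly0. Qed.

Lemma top_coefM n (P Q : {poly {mpoly K[n]}}) d e k l :
  top_coef P d k -> top_coef Q e l -> top_coef (P * Q) (d + e) (k * l).
Proof.
rewrite /top_coef => hP hQ.
have sP : (size P <= d.+1)%N.
  rewrite -[P](subrK (k%:MP *: 'X^d)); apply: (leq_trans (size_polyD _ _)).
  rewrite geq_max (leq_trans hP) //= (leq_trans (size_scale_leq _ _)) //.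
  by rewrite size_polyXn.
have -> : P * Q - (k * l)%:MP *: 'X^(d + e) =
    P * (Q - l%:MP *: 'X^e) + (P - k%:MP *: 'X^d) * (l%:MP *: 'X^e).
  rewrite exprD mpolyCM -!mul_polyC polyCM; ring.
apply: (leq_trans (size_polyD _ _)); rewrite geq_max; apply/andP; split.
  apply: (leq_trans (size_polyMleq _ _)).
  by move: sP hQ; move: (size P) (size (Q - _)%R) => a b; lia.
apply: (leq_trans (size_polyMleq _ _)).
have sQ : (size (l%:MP_[n] *: 'X^e)%R <= e.+1)%N.
  by rewrite (leq_trans (size_scale_leq _ _)) // size_polyXn.
by move: hP sQ; move: (size (P - _)%R) (size (l%:MP_[n] *: 'X^e)%R) => a b; lia.
Qed.

Lemma top_coefXn n (P : {poly {mpoly K[n]}}) k m :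
  top_coef P 1 k -> top_coef (P ^+ m) m (k ^+ m).
Proof.
move=> hP; elim: m => [|m IH]; first by rewrite !expr0; apply: top_coef1.
by rewrite !exprS -add1n; apply: top_coefM.
Qed.

(** A linear change of coordinates makes a nonzero polynomial monic, up to a
    scalar, in one variable: any direction on which the homogeneous component
    of top degree does not vanish will do. *)
Lemma normalization n (f : {mpoly K[n.+1]}) : f != 0 ->
  exists (c : 'rV[K]_n.+1) (G : {poly {mpoly K[n]}}) (d : nat) (k : K),
    [/\ c 0 ord_max != 0, k != 0, top_coef G d k
      & forall x t, f.@[line_point c x t 0] = pev G x t].
Proof.
move=> f0; pose d := mdeg (mlead f).
pose top : {mpoly K[n.+1]} := \sum_(m <- msupp f | mdeg m == d) f@_m *: 'X_[m].
have top0 : top * 'X_ord_max != 0.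
  rewrite mulf_neq0 //; last by apply/eqP => /(congr1 (mcoeff U_(ord_max)));
    rewrite mcoeffXU eqxx mcoeff0 => /eqP; rewrite oner_eq0.
  apply/eqP => /(congr1 (mcoeff (mlead f))).
  rewrite mcoeff0 /top raddf_sum big_mkcond /=.
  rewrite (bigD1_seq (mlead f)) ?msupp_uniq ?mlead_supp //=.
  rewrite eqxx big1 ?addr0 => [/eqP|m nm].
    by rewrite mcoeffZ mcoeffX eqxx mulr1 -/(mleadc f) mleadc_eq0 (negbTE f0).
  by case: ifP => // _; rewrite mcoeffZ mcoeffX (negbTE nm) mulr0.
have [c] := meval_neq0 top0; rewrite mevalM mevalXU mulf_eq0 negb_or => /andP[tc cn].
pose rho (i : 'I_n.+1) : {poly {mpoly K[n]}} :=
  (if unlift ord_max i is Some j then 'X_j else 0)%:P + (c 0 i)%:MP *: 'X.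
pose G := \sum_(m <- msupp f) (f@_m)%:MP *: \prod_i rho i ^+ m i.
exists c, G, d, (top.@[c 0]); split=> //.
  rewrite /top_coef; have -> : (top.@[c 0])%:MP_[n] *: 'X^d = 
    \sum_(m <- msupp f) (if mdeg m == d then (f@_m * \prod_i c 0 i ^+ m i)%:MP_[n] *: 'X^(mdeg m) else 0) :> {poly {mpoly K[n]}}.
    rewrite -big_mkcond /top (raddf_sum (meval (c 0))) (raddf_sum (@mpolyC n K)) /= scaler_suml. apply: eq_bigr => m /eqP ->.
    by rewrite mevalZ mevalX.
  rewrite -sumrB big_seq; elim/big_ind: _ => [|P Q hP hQ|m hm].
  - by rewrite size_poly0.
  - by apply: (leq_trans (size_polyD _ _)); rewrite geq_max hP.
  have tm : top_coef (\prod_i rho i ^+ m i) (mdeg m) (\prod_i c 0 i ^+ m i).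
    rewrite mdegE; elim/big_rec3: _ => [|i P e k _ IH]; first exact: top_coef1.
    apply: top_coefM IH; apply: top_coefXn.
    by rewrite /top_coef expr1 addrK size_polyC_leq1.
  have mdm : (mdeg m <= d)%N.
    by rewrite -ltnS /d mlead_deg // msize_mdeg_lt.
  case: ifP => [/eqP md|nd].
    rewrite mpolyCM -scalerA -scalerBr -md.
    by apply: (leq_trans (size_scale_leq _ _)).
  rewrite subr0; apply: (leq_trans (size_scale_leq _ _)).
  rewrite -[\prod_i rho i ^+ m i](subrK ((\prod_i c 0 i ^+ m i)%:MP_[n] *: 'X^(mdeg m))).
  apply: (leq_trans (size_polyD _ _)); rewrite geq_max (leq_trans tm) //=.
  apply: (leq_trans (size_scale_leq _ _)); rewrite size_polyXn.
  by rewrite ltn_neqAle nd.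
move=> x t; rewrite mevalE /pev rmorph_sum horner_sum; apply: eq_bigr => m _ /=.
rewrite map_polyZ hornerZ /= mevalC rmorph_prod horner_prod; congr (_ * _).
apply: eq_bigr => i _; rewrite rmorphXn horner_exp; congr (_ ^+ _).
rewrite rmorphD hornerD /= map_polyC hornerC map_polyZ hornerZ map_polyX hornerX /= mevalC mxE.
by congr (_ + _); [case: unlift => [j|]; rewrite ?mevalXU ?meval0 | rewrite mulrC].
Qed.

(** Cramer's rule: the combination of the rows by the first column of the adjugate
    is the determinant. *)
Lemma det_ideal (R : comNzRingType) (J : {poly R} -> Prop) d (A : 'M[R]_d) :
  ideal J -> (d = 0%N -> J 1) -> (forall i, J (\sum_j (A i j)%:P * 'X^j)) ->
  J (\det A)%:P.
Proof.
move=> idJ; have [_ _ JM] := idJ.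
case: d A => [|d] A J1 JA; first by rewrite det_mx00; apply: J1.
suff -> : (\det A)%:P = \sum_i (\adj A 0 i)%:P * \sum_j (A i j)%:P * 'X^j.
  by apply: (ideal_sum idJ) => i; apply: JM.
transitivity (\sum_j (\sum_i \adj A 0 i * A i j)%:P * 'X^j).
  have E j : \sum_i \adj A 0 i * A i j = \det A *+ (0 == j).
    by have := congr1 (fun M : 'M_d.+1 => M 0 j) (mul_adj_mx A); rewrite /= [LHS]mxE => ->; rewrite mxE.
  rewrite (bigD1 0) //= E eqxx mulr1n expr0 mulr1 big1 ?addr0 // => j j0.
  by rewrite E eq_sym (negbTE j0) mulr0n mul0r.
rewrite [RHS](eq_bigr (fun i => \sum_j (\adj A 0 i)%:P * ((A i j)%:P * 'X^j))) => [|i _].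
  rewrite exchange_big; apply: eq_bigr => j _ /=.
  by rewrite rmorph_sum mulr_suml; apply: eq_bigr => i _; rewrite rmorphM mulrA.
by rewrite mulr_sumr.
Qed.

(** The Euclidean remainder by a monic polynomial commutes with evaluation of
    the coefficients; hence if [P] becomes 1 at [a], multiplication by [P]
    modulo [G] becomes the identity at [a], and its determinant is a constant
    of the ideal with value 1 at [a]. *)
Lemma elimination n (J : {poly {mpoly K[n]}} -> Prop) (G P : {poly {mpoly K[n]}})
    (a : 'rV[K]_n) :
  ideal J -> J G -> J P -> G \is monic -> (forall t, pev P a t = 1) ->
  exists2 D : {mpoly K[n]}, J D%:P & D.@[a 0] = 1.
Proof.
move=> idJ JG JP Gm P1; have [J0 JD JM] := idJ.
pose ev := map_poly (meval (a 0)) : {poly {mpoly K[n]}} -> {poly K}.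
have eG : ev G \is monic by apply: monic_map.
have sG : size (ev G) = size G by apply: size_map_poly_id0;
  rewrite (monicP Gm) meval1 oner_eq0.
have eP : ev P = 1.
  apply/eqP; rewrite -subr_eq0; apply/eqP/poly_eq0 => t.
  by rewrite hornerD hornerN hornerC -/(pev P a t) P1 subrr.
pose d := (size G).-1.
have sG1 : size G = d.+1 by rewrite prednK // lt0n size_poly_eq0 monic_neq0.
pose rm i := Pdiv.Ring.rmodp ('X^i * P) G.
have srm i : (size (rm i) <= d)%N.
  by rewrite -ltnS -sG1 Pdiv.Ring.ltn_rmodp monic_neq0.
pose A : 'M[{mpoly K[n]}]_d := \matrix_(i, j) (rm i)`_j.
have JA (i : 'I_d) : J (\sum_j (A i j)%:P * 'X^j).
  have -> : \sum_j (A i j)%:P * 'X^j = 'X^i * P + (- Pdiv.Ring.rdivp ('X^i * P) G) * G.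
    have -> : 'X^i * P + - Pdiv.Ring.rdivp ('X^i * P) G * G = rm i.
      by apply/eqP; rewrite mulNr subr_eq addrC; apply/eqP; apply: Pdiv.RingMonic.rdivp_eq.
    rewrite (eq_bigr (fun j : 'I_d => (rm i)`_j *: 'X^j)) => [|j _]; last first.
      by rewrite mxE mul_polyC.
    rewrite -(poly_def d (fun j => (rm i)`_j)); apply/polyP => k; rewrite coef_poly.
    by case: ltnP => // dk; rewrite nth_default // (leq_trans (srm i)).
  by apply: JD; apply: JM.
have rmE (i : 'I_d) : ev (rm i) = 'X^i.
  have := congr1 ev (Pdiv.RingMonic.rdivp_eq Gm ('X^i * P)).
  rewrite -/(rm i) /ev !rmorphM rmorphD rmorphM /= -/(ev P) eP mulr1 map_polyXn => E.
  set q := map_poly _ (Pdiv.Ring.rdivp _ _) in E.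
  have {}E : 'X^i - ev (rm i) = q * ev G by rewrite E /ev addrK.
  have [q0|qn0] := eqVneq q 0.
    by apply/eqP; rewrite eq_sym -subr_eq0 E q0 mul0r.
  have sEG : size (ev G) = d.+1 by rewrite -sG1.
  have : (size (q * ev G)%R <= d)%N.
    rewrite -E; apply: (leq_trans (size_polyD _ _)).
    rewrite size_polyN geq_max size_polyXn ltn_ord /=.
    exact: leq_trans (size_poly _ _) (srm i).
  have -> : size (q * ev G) = (size q + d.+1).-1 :=
    etrans (size_mul qn0 (monic_neq0 eG)) (congr1 (fun k => (size q + k).-1) sEG).
  by rewrite -size_poly_gt0 in qn0; move: qn0; move: (size q) => k; lia.
have JdA : J (\det A)%:P.
  apply: det_ideal => // d0; rewrite -(_ : G = 1) //.
  have : (size G <= 1)%N by rewrite sG1 d0.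
  move=> /size1_polyC E; rewrite E; congr _%:P.
  by move/monicP: Gm; rewrite lead_coefE sG1 d0.
exists (\det A) => //.
rewrite -(det_map_mx (meval (a 0))) -(det1 K d); congr (\det _).
apply/matrixP => i j; rewrite !mxE -(coef_map (meval (a 0))) -/(ev (rm i)) rmE.
by rewrite coefXn eq_sym.
Qed.

(** By induction on the number of variables: a point [a] in the zero set of
    the elimination ideal lifts to a zero of the ideal, because the ideal
    contains a polynomial that is monic in the last variable. *)
Lemma weak_nullstellensatz n (I : {mpoly K[n]} -> Prop) :
  ideal I -> ~ I 1 -> exists x : 'rV[K]_n, zero_locus I x.
Proof.
elim: n I => [|n IH] I idI I1; have [I0 ID IM] := idI.
  exists 0 => f If; apply: NNPP => f0; apply: I1.
  have -> : 1 = (f.@[(0 : 'rV[K]_0) 0])^-1%:MP * f.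
    rewrite {2}(nvar0_mpolyC f) -mpolyCM {1}(nvar0_mpolyC f) mevalC mulVf ?mpolyC1 //.
    by apply/eqP => h; apply: f0; rewrite (nvar0_mpolyC f) mevalC.
  exact: IM.
have [I00|/not_all_ex_not[f nIf]] := classic (forall f, I f -> f = 0).
  by exists 0 => f /I00 ->; rewrite meval0.
have [If /eqP f0] := imply_to_and _ _ nIf.
have [c [G [d [k [cn k0 topG evG]]]]] := normalization f0.
(* The ideal in the coordinates [x] on the hyperplane and [t] on the line. *)
pose J (P : {poly {mpoly K[n]}}) :=
  exists2 g, I g & forall x t, pev P x t = g.@[line_point c x t 0].
have lineK (z : 'rV[K]_n.+1) :
    line_point c (\row_j (z 0 (lift ord_max j) - z 0 ord_max / c 0 ord_max * c 0 (lift ord_max j)))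
      (z 0 ord_max / c 0 ord_max) = z.
  apply/rowP => i; rewrite mxE; case: (unliftP ord_max i) => [j ->|->].
    by rewrite mxE subrK.
  by rewrite add0r divfK.
have pol (Q : {poly {mpoly K[n]}}) : exists q : {mpoly K[n.+1]},
    forall x t, pev Q x t = q.@[line_point c x t 0].
  have : pfun (fun z : 'rV[K]_n.+1 => pev Q (\row_j (z 0 (lift ord_max j)
     - z 0 ord_max / c 0 ord_max * c 0 (lift ord_max j))) (z 0 ord_max / c 0 ord_max)).
    have pc : pfun (fun z : 'rV[K]_n.+1 => z 0 ord_max / c 0 ord_max).
      by apply: pfunM; [apply: pfun_coord | apply: pfun_const].
    apply: (pfun_eq (fun z => pev_sum _ _ _)); apply: pfun_sum => i; apply: pfunM.
      apply: pfun_comp_row => j.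
      apply: (@pfun_eq _ _ _ (fun z : 'rV[K]_n.+1 => z 0 (lift ord_max j)
        - z 0 ord_max / c 0 ord_max * c 0 (lift ord_max j))); first by move=> z; rewrite mxE.
      by apply: pfunB; [apply: pfun_coord | apply: pfunM => //; apply: pfun_const].
    exact: pfunXn.
  case=> q hq; exists q => x t; rewrite -hq.
  have lt : line_point c x t 0 ord_max / c 0 ord_max = t.
    by rewrite mxE unlift_none add0r mulfK.
  rewrite lt; congr pev; apply/rowP => j.
  by rewrite mxE mxE liftK addrK.
have idJ : ideal J.
  split.
  - by exists 0 => // x t; rewrite meval0 /pev rmorph0 horner0.
  - move=> P Q [g Ig hg] [h Ih hh]; exists (g + h); first exact: ID.
    by move=> x t; rewrite pevD mevalD hg hh.
  - move=> P Q [g Ig hg]; have [q hq] := pol P; exists (q * g); first exact: IM.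
    by move=> x t; rewrite pevM mevalM hg hq.
have J1 : ~ J 1.
  case=> g Ig hg; apply: I1; suff <- : g = 1 by [].
  by apply: meval_inj => z; rewrite -(lineK z) -hg /pev rmorph1 hornerC meval1.
have [J0 JD JM] := idJ.
pose I' (p : {mpoly K[n]}) := J p%:P.
have I'0 : I' 0 by rewrite /I' polyC0; exact: J0.
have I'D p q : I' p -> I' q -> I' (p + q).
  by rewrite /I' polyCD; exact: JD.
have I'M p q : I' q -> I' (p * q).
  by rewrite /I' polyCM; exact: JM.
have idI' : ideal I' := And3 I'0 I'D I'M.
have [a za] : exists a, zero_locus I' a by apply: IH => //; apply: J1.
have JG : J G by exists f => // x t; rewrite -evG.
pose G1 := (k^-1)%:MP%:P * G.
have JG1 : J G1 by apply: JM.
have topG1 : top_coef G1 d 1.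
  have t0 : top_coef (k^-1)%:MP_[n]%:P 0 k^-1.
    by rewrite /top_coef expr0 -mul_polyC mulr1 subrr size_poly0.
  by have := top_coefM t0 topG; rewrite mulVf.
have G1m : G1 \is monic.
  rewrite monicE lead_coefE; move: topG1; rewrite /top_coef mpolyC1 scale1r => sz.
  have sG : size G1 = d.+1.
    rewrite -[G1](subrK 'X^d) addrC size_polyDl size_polyXn //.
  rewrite sG /= -[G1](subrK 'X^d) coefD coefXn eqxx nth_default ?add0r //.
apply: NNPP => noz.
(* The values at [a] form an ideal of polynomials in one variable without
   common zeros, hence contain 1. *)
suff [P JP P1] : exists2 P, J P & forall t, pev P a t = 1.
  have [D JD1 D1] := elimination idJ JG1 JP G1m P1.
  by have := za _ JD1; rewrite D1 => /eqP; rewrite oner_eq0.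
pose Ja (p : {poly K}) := exists2 P, J P & map_poly (meval (a 0)) P = p.
have JaD p q : Ja p -> Ja q -> Ja (p + q).
  by move=> [P JP <-] [Q JQ <-]; exists (P + Q); [exact: JD | exact: rmorphD].
have JaM p q : Ja q -> Ja (p * q).
  move=> [Q JQ <-]; exists (map_poly (@mpolyC n K) p * Q); first exact: JM.
  rewrite rmorphM; congr (_ * _); apply/polyP => i.
  by rewrite !coef_map; exact: mevalC.
suff [P JP eP] : Ja 1 by exists P; [exact: JP | move=> t; rewrite /pev eP hornerC].
have [p [p0 Jp]] : exists p, p != 0 /\ Ja p.
  exists (map_poly (meval (a 0)) G1); split; last by exists G1; [exact: JG1 | ].
  by apply: monic_neq0; apply: monic_map.
have nozero b : exists2 q, Ja q & q.[b] != 0.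
  apply: NNPP => nq; apply: noz; exists (line_point c a b) => g Ig.
  have [P hP] : exists P, forall x t, pev P x t = g.@[line_point c x t 0].
    have [p' hp'] : pfun (fun z : 'rV[K]_n.+1 =>
        g.@[line_point c (\row_j z 0 (lift ord_max j)) (z 0 ord_max) 0]).
      apply: pfun_comp_row => j.
      have : pfun (fun z : 'rV[K]_n.+1 =>
          (if unlift ord_max j is Some l then z 0 (lift ord_max l) else 0) + z 0 ord_max * c 0 j).
        apply: pfunD; last by apply: pfunM; [apply: pfun_coord | apply: pfun_const].
        by case: unlift => [l|]; [apply: pfun_coord | apply: pfun_const].
      move=> h; apply: (pfun_eq _ h) => z; rewrite /line_point mxE.
      by case: unlift => [l|]; rewrite ?mxE.
    exists (muni p') => x t.
    pose z : 'rV[K]_n.+1 := \row_i (if unlift ord_max i is Some j then x 0 j else t).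
    have zl : \row_j z 0 (lift ord_max j) = x by apply/rowP => j; rewrite !mxE liftK.
    have zm : z 0 ord_max = t by rewrite mxE unlift_none.
    by have := hp' z; rewrite zl zm => ->; rewrite (pev_muni p' z) zl zm.
  rewrite -hP; apply: NNPP => /eqP Pb; apply: nq.
  exists (map_poly (meval (a 0)) P); last exact: Pb.
  exists P; last by [].
  by exists g; [exact: Ig | exact: hP].
exact: (univariate_nullstellensatz JaD JaM p0 Jp nozero).
Qed.
End Nullstellensatz.

Section StrongNullstellensatz.
Variable K : closedFieldType.

Definition extend n (x : 'rV[K]_n) (t : K) : 'rV[K]_n.+1 :=
  \row_i (if unlift ord_max i is Some j then x 0 j else t).

Lemma extendK n (x : 'rV[K]_n) t : \row_j extend x t 0 (lift ord_max j) = x.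
Proof. by apply/rowP => j; rewrite !mxE liftK. Qed.

Lemma meval_extend n (p : {mpoly K[n.+1]}) x t :
  p.@[extend x t 0] = pev (muni p) x t.
Proof.
by rewrite (pev_muni p (extend x t)) extendK mxE unlift_none.
Qed.

(** Rabinowitsch's trick, carried out on functions: [J] is the extension of
    [I] to the ring of polynomials in one more variable, which is taken to be
    the inverse of [h]. *)
Lemma nullstellensatz n (I : {mpoly K[n]} -> Prop) (h : {mpoly K[n]}) :
  ideal I -> (forall x, zero_locus I x -> h.@[x 0] = 0) -> exists k, I (h ^+ k).
Proof.
move=> idI hz; have [I0 ID IM] := idI.
pose J (p : {mpoly K[n.+1]}) := exists k g, I g /\
  forall x : 'rV[K]_n, h.@[x 0] != 0 -> p.@[extend x (h.@[x 0])^-1 0] * h.@[x 0] ^+ k = g.@[x 0].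
have clear_denominators (q : {mpoly K[n.+1]}) : exists k (g : {mpoly K[n]}),
    forall x : 'rV[K]_n, h.@[x 0] != 0 ->
    q.@[extend x (h.@[x 0])^-1 0] * h.@[x 0] ^+ k = g.@[x 0].
  pose P := muni q; exists (size P), (\sum_(i < size P) P`_i * h ^+ (size P - i)).
  move=> x hx; rewrite meval_extend pev_sum rmorph_sum mulr_suml; apply: eq_bigr => i _ /=.
  rewrite mevalM rmorphXn /= -mulrA exprVn; congr (_ * _).
  have expB s j : (j <= s)%N -> (h.@[x 0] ^+ j)^-1 * h.@[x 0] ^+ s = h.@[x 0] ^+ (s - j).
    by move=> js; rewrite -{1}(subnK js) exprD mulrCA mulVf ?mulr1 ?expf_neq0.
  by apply: expB; rewrite ltnW.
have idJ : ideal J.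
  split.
  - by exists 0%N, 0; split=> // x _; rewrite !meval0 mul0r.
  - move=> p q [k [f [If hf]]] [l [g [Ig hg]]]; exists (k + l)%N, (h ^+ l * f + h ^+ k * g).
    split; first by apply: ID; apply: IM.
    move=> x hx; rewrite !mevalD !mevalM !rmorphXn /= -hf // -hg // exprD; ring.
  - move=> q p [k [f [If hf]]]; have [l [g hg]] := clear_denominators q.
    exists (l + k)%N, (g * f); split; first exact: IM.
    move=> x hx; rewrite !mevalM -hf // -hg // exprD; ring.
have [[k [g [Ig hg]]]|J1] := classic (J 1).
  exists k.+1; rewrite exprS; suff -> : h * h ^+ k = h * g by apply: IM.
  apply: meval_inj => x; rewrite !mevalM rmorphXn /=.
  have [->|hx] := eqVneq h.@[x 0] 0; first by rewrite !mul0r.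
  by rewrite -hg // meval1 mul1r.
have [z Jz] := weak_nullstellensatz idJ J1.
pose x : 'rV[K]_n := \row_j z 0 (lift ord_max j).
have zE : z = extend x (z 0 ord_max).
  by apply/rowP => i; rewrite mxE; case: unliftP => [j ->|->] //; rewrite mxE.
have hx : h.@[x 0] = 0.
  apply: hz => f If; have [q hq] : pfun (fun z : 'rV[K]_n.+1 => f.@[(\row_j z 0 (lift ord_max j)) 0]).
    apply: pfun_comp_row => j; apply: (@pfun_eq _ _ _ (fun z : 'rV[K]_n.+1 => z 0 (lift ord_max j))).
      by move=> w; rewrite mxE.
    exact: pfun_coord.
  rewrite /x hq; apply: Jz; exists 0%N, f; split=> // y _.
  by rewrite expr0 mulr1 -hq extendK.
have [p hp] : pfun (fun z : 'rV[K]_n.+1 => z 0 ord_max * h.@[(\row_j z 0 (lift ord_max j)) 0] - 1).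
  apply: pfunB; last exact: pfun_const.
  apply: pfunM; first exact: pfun_coord.
  apply: pfun_comp_row => j; apply: (@pfun_eq _ _ _ (fun z : 'rV[K]_n.+1 => z 0 (lift ord_max j))).
    by move=> w; rewrite mxE.
  exact: pfun_coord.
suff : p.@[z 0] = 0.
  by rewrite -hp -/x hx mulr0 sub0r => /eqP; rewrite oppr_eq0 oner_eq0.
apply: Jz; exists 0%N, 0; split=> // y hy; rewrite -hp meval0 expr0 mulr1 mxE unlift_none.
by rewrite extendK mulVf // subrr.
Qed.

(** The denominators of a regular function form an ideal, whose zeros lie
    outside the principal open set. *)
Lemma regular_principal n (V U : 'rV[K]_n -> Prop) (h : {mpoly K[n]}) f :
  zariski_closed V -> (forall x, U x <-> V x /\ h.@[x 0] != 0) -> regular U f ->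
  exists (a : {mpoly K[n]}) k, forall x, U x -> f x = a.@[x 0] / h.@[x 0] ^+ k.
Proof.
move=> [S VS] UE regf.
pose I (b : {mpoly K[n]}) := exists a : {mpoly K[n]}, forall y, U y -> b.@[y 0] * f y = a.@[y 0].
have idI : ideal I.
  split.
  - by exists 0 => y _; rewrite !meval0 mul0r.
  - by move=> b c [p hp] [q hq]; exists (p + q) => y Uy; rewrite !mevalD mulrDl hp ?hq.
  - by move=> b c [p hp]; exists (b * p) => y Uy; rewrite !mevalM -mulrA hp.
have [|k [a ha]] := nullstellensatz (h := h) idI.
  move=> x Ix; apply: NNPP => /eqP hx.
  have Vx : V x.
    apply/VS => g Sg; apply: Ix; exists 0 => y Uy.
    have /UE[/VS Vy _] := Uy; by rewrite Vy // mul0r meval0.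
  have [a [b [bx hab]]] := regf x ((UE x).2 (conj Vx hx)).
  have Ibb : I (b * b).
    exists (a * b) => y Uy; rewrite !mevalM.
    have [->|b0] := eqVneq b.@[y 0] 0; first by rewrite !(mul0r, mulr0).
    by rewrite hab // mulrACA divff // mulr1 mulrC.
  by have := Ix _ Ibb; rewrite mevalM => /eqP; rewrite mulf_eq0 orbb (negbTE bx).
exists a, k => x Ux; rewrite -ha // rmorphXn /= mulrC mulKf //.
by rewrite expf_neq0 //; have /UE[] := Ux.
Qed.

Lemma regular_closed n (V : 'rV[K]_n -> Prop) f :
  zariski_closed V -> regular V f ->
  exists a : {mpoly K[n]}, forall x, V x -> f x = a.@[x 0].
Proof.
move=> cV rf; have [|a [k ha]] := @regular_principal n V V 1 f cV _ rf.
  by move=> x; rewrite meval1 oner_eq0; split=> [|[]].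
by exists a => x Vx; rewrite ha // meval1 expr1n divr1.
Qed.

End StrongNullstellensatz.

(** * Regular functions and morphisms *)

Section Regular.
Variable K : closedFieldType.

Definition reg_at n (V : 'rV[K]_n -> Prop) (f : 'rV[K]_n -> K) (x : 'rV[K]_n) : Prop :=
  exists a b : {mpoly K[n]}, b.@[x 0] != 0 /\
    forall y, V y -> b.@[y 0] != 0 -> f y = a.@[y 0] / b.@[y 0].

Lemma reg_at_near n (V : 'rV[K]_n -> Prop) f g (x : 'rV[K]_n) (c : {mpoly K[n]}) :
  c.@[x 0] != 0 -> (forall y, V y -> c.@[y 0] != 0 -> f y = g y) ->
  reg_at V g x -> reg_at V f x.
Proof.
move=> cx fg [a [b [bx h]]]; exists (a * c), (b * c); split; first by rewrite mevalM mulf_neq0.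
move=> y Vy; rewrite !mevalM mulf_eq0 negb_or => /andP[by_ cy].
by rewrite fg // h // invfM mulrACA divff // mulr1.
Qed.

Lemma reg_at_eq n (V : 'rV[K]_n -> Prop) f g x :
  (forall y, V y -> f y = g y) -> reg_at V g x -> reg_at V f x.
Proof.
by move=> fg; apply: (@reg_at_near _ _ _ _ _ 1) => [|y Vy _]; rewrite ?meval1 ?oner_eq0 ?fg.
Qed.

Lemma reg_at_poly n (V : 'rV[K]_n -> Prop) (p : {mpoly K[n]}) x : reg_at V (fun y => p.@[y 0]) x.
Proof. by exists p, 1; split=> [|y _ _]; rewrite meval1 ?oner_eq0 // divr1. Qed.

Lemma reg_at_pfun n (V : 'rV[K]_n -> Prop) f x : pfun f -> reg_at V f x.
Proof. by move=> [p hp]; apply: reg_at_eq (reg_at_poly _ p x) => y _; apply: hp. Qed.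

Lemma reg_at_const n (V : 'rV[K]_n -> Prop) c x : reg_at V (fun=> c) x.
Proof. exact/reg_at_pfun/pfun_const. Qed.

Lemma reg_atD n (V : 'rV[K]_n -> Prop) f g x :
  reg_at V f x -> reg_at V g x -> reg_at V (fun y => f y + g y) x.
Proof.
move=> [a [b [bx h]]] [c [d [dx k]]]; exists (a * d + c * b), (b * d).
split=> [|y Vy]; first by rewrite mevalM mulf_neq0.
rewrite mevalD !mevalM mulf_eq0 negb_or => /andP[b0 d0]; rewrite h // k //.
by field; rewrite ?b0 ?d0.
Qed.

Lemma reg_atM n (V : 'rV[K]_n -> Prop) f g x :
  reg_at V f x -> reg_at V g x -> reg_at V (fun y => f y * g y) x.
Proof.
move=> [a [b [bx h]]] [c [d [dx k]]]; exists (a * c), (b * d).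
split=> [|y Vy]; first by rewrite mevalM mulf_neq0.
rewrite !mevalM mulf_eq0 negb_or => /andP[b0 d0]; rewrite h // k //.
by field; rewrite ?b0 ?d0.
Qed.

Lemma reg_atV n (V : 'rV[K]_n -> Prop) f x :
  V x -> f x != 0 -> reg_at V f x -> reg_at V (fun y => (f y)^-1) x.
Proof.
move=> Vx fx [a [b [bx h]]]; exists (b * b), (a * b).
have ax : a.@[x 0] != 0 by move: fx; rewrite h // mulf_eq0 negb_or => /andP[].
split=> [|y Vy]; first by rewrite mevalM mulf_neq0.
rewrite !mevalM mulf_eq0 negb_or => /andP[a0 b0]; rewrite h //.
by field; rewrite ?a0 ?b0.
Qed.

Lemma reg_atXn n (V : 'rV[K]_n -> Prop) f k x :
  reg_at V f x -> reg_at V (fun y => f y ^+ k) x.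
Proof.
move=> rf; elim: k => [|k IH]; first exact: reg_at_const.
by apply: reg_at_eq (reg_atM rf IH) => y _; rewrite exprS.
Qed.

Lemma reg_atXz n (V : 'rV[K]_n -> Prop) f (k : int) x :
  V x -> 0 <= k \/ f x != 0 -> reg_at V f x -> reg_at V (fun y => f y ^ k) x.
Proof.
move=> Vx; case: k => [k _|k [//|fx]] rf; first exact: reg_atXn.
by apply: reg_atV => //; [rewrite expf_neq0 | apply: reg_atXn].
Qed.

Lemma reg_at_sum n (V : 'rV[K]_n -> Prop) I (r : seq I) P (f : I -> 'rV[K]_n -> K) x :
  (forall i, reg_at V (f i) x) -> reg_at V (fun y => \sum_(i <- r | P i) f i y) x.
Proof.
move=> rf; elim: r => [|i r IH].
  by apply: reg_at_eq (reg_at_const _ 0 x) => y _; rewrite big_nil.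
case Pi: (P i); last by apply: reg_at_eq IH => y _; rewrite big_cons Pi.
by apply: reg_at_eq (reg_atD (rf i) IH) => y _; rewrite big_cons Pi.
Qed.

Lemma reg_at_prod n (V : 'rV[K]_n -> Prop) I (r : seq I) P (f : I -> 'rV[K]_n -> K) x :
  (forall i, reg_at V (f i) x) -> reg_at V (fun y => \prod_(i <- r | P i) f i y) x.
Proof.
move=> rf; elim: r => [|i r IH].
  by apply: reg_at_eq (reg_at_const _ 1 x) => y _; rewrite big_nil.
case Pi: (P i); last by apply: reg_at_eq IH => y _; rewrite big_cons Pi.
by apply: reg_at_eq (reg_atM (rf i) IH) => y _; rewrite big_cons Pi.
Qed.

Lemma reg_at_meval n k (V : 'rV[K]_n -> Prop) (p : {mpoly K[k]}) (F : 'rV[K]_n -> 'rV[K]_k) x :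
  (forall j, reg_at V (fun y => F y 0 j) x) -> reg_at V (fun y => p.@[F y 0]) x.
Proof.
move=> rF; apply: (@reg_at_eq _ _ _ (fun y => \sum_(m <- msupp p) p@_m * \prod_i F y 0 i ^+ m i)).
  by move=> y _; rewrite mevalE.
apply: reg_at_sum => m; apply: reg_atM; first exact: reg_at_const.
by apply: reg_at_prod => i; apply: reg_atXn.
Qed.

Lemma reg_at_comp n k (V : 'rV[K]_n -> Prop) (W : 'rV[K]_k -> Prop) f F x :
  V x -> (forall y, V y -> W (F y)) -> (forall j, reg_at V (fun y => F y 0 j) x) ->
  reg_at W f (F x) -> reg_at V (fun y => f (F y)) x.
Proof.
move=> Vx VW rF [a [b [bx h]]].
have [c [d [dx hcd]]] := reg_at_meval b rF.
apply: (@reg_at_near _ _ _ (fun y => a.@[F y 0] / b.@[F y 0]) _ (c * d)).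
- rewrite mevalM mulf_neq0 //; move: bx; rewrite hcd // mulf_eq0 negb_or.
  by case/andP.
- move=> y Vy; rewrite mevalM mulf_eq0 negb_or => /andP[cy dy].
  by apply: h; [apply: VW | rewrite hcd // mulf_neq0 // invr_eq0].
- by apply: reg_atM; [|apply: reg_atV => //]; apply: reg_at_meval.
Qed.

Lemma regular_pfun n (V : 'rV[K]_n -> Prop) f : pfun f -> regular V f.
Proof. by move=> pf x _; apply: reg_at_pfun. Qed.

Lemma regular_eq n (V : 'rV[K]_n -> Prop) f g :
  (forall x, V x -> f x = g x) -> regular V g -> regular V f.
Proof. by move=> fg rg x Vx; apply: (reg_at_eq fg (rg x Vx)). Qed.

Lemma regular_comp n k (V : 'rV[K]_n -> Prop) (W : 'rV[K]_k -> Prop) f F :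
  morphism V W F -> regular W f -> regular V (fun y => f (F y)).
Proof.
move=> [VW rF] rf x Vx; apply: (reg_at_comp Vx VW) => [j|]; first exact: rF.
exact/rf/VW.
Qed.

Lemma morphism_comp n k l (V : 'rV[K]_n -> Prop) (W : 'rV[K]_k -> Prop)
    (Z : 'rV[K]_l -> Prop) F G :
  morphism V W F -> morphism W Z G -> morphism V Z (fun x => G (F x)).
Proof.
move=> mF [WZ rG]; split=> [x Vx|j]; first by apply/WZ; apply: mF.1.
exact: (regular_comp mF (rG j)).
Qed.

Lemma morphism_eq n k (V : 'rV[K]_n -> Prop) (W : 'rV[K]_k -> Prop) F G :
  (forall x, V x -> F x = G x) -> morphism V W G -> morphism V W F.
Proof.
move=> FG [VW rG]; split=> [x Vx|j]; first by rewrite FG //; apply: VW.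
by apply: regular_eq (rG j) => x Vx; rewrite FG.
Qed.

Lemma morphism_sub n k (V V' : 'rV[K]_n -> Prop) (W : 'rV[K]_k -> Prop) F :
  (forall x, V' x -> V x) -> morphism V W F -> morphism V' W F.
Proof.
move=> V'V [VW rF]; split=> [x /V'V/VW //|j x /V'V Vx].
have [a [b [bx h]]] := rF j x Vx; exists a, b; split=> // y /V'V Vy; exact: h.
Qed.

Lemma morphism_row_mx n k l (V : 'rV[K]_n -> Prop) (W : 'rV[K]_k -> Prop)
    (Z : 'rV[K]_l -> Prop) F G :
  morphism V W F -> morphism V Z G -> morphism V (product W Z) (fun x => row_mx (F x) (G x)).
Proof.
move=> [VW rF] [VZ rG]; split=> [x Vx|j].
  by split; rewrite ?row_mxKl ?row_mxKr; [apply: VW | apply: VZ].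
case: (split_ordP j) => i ->.
  by apply: regular_eq (rF i) => x _; rewrite row_mxEl.
by apply: regular_eq (rG i) => x _; rewrite row_mxEr.
Qed.

Lemma pfun_lsubmx n k (i : 'I_n) : pfun (fun z : 'rV[K]_(n + k) => lsubmx z 0 i).
Proof. by apply: (pfun_eq _ (pfun_coord _ (lshift k i))) => z; rewrite mxE. Qed.

Lemma pfun_rsubmx n k (i : 'I_k) : pfun (fun z : 'rV[K]_(n + k) => rsubmx z 0 i).
Proof. by apply: (pfun_eq _ (pfun_coord _ (rshift n i))) => z; rewrite mxE. Qed.

Lemma morphism_lsubmx n k (V : 'rV[K]_n -> Prop) (W : 'rV[K]_k -> Prop) :
  morphism (product V W) V lsubmx.
Proof. by split=> [z []//|j]; apply/regular_pfun/pfun_lsubmx. Qed.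

Lemma morphism_rsubmx n k (V : 'rV[K]_n -> Prop) (W : 'rV[K]_k -> Prop) :
  morphism (product V W) W rsubmx.
Proof. by split=> [z []//|j]; apply/regular_pfun/pfun_rsubmx. Qed.

Lemma morphism_pfun n k (V : 'rV[K]_n -> Prop) (W : 'rV[K]_k -> Prop) F :
  (forall x, V x -> W (F x)) -> (forall j, pfun (fun x => F x 0 j)) -> morphism V W F.
Proof. by move=> VW pF; split=> // j; apply: regular_pfun. Qed.

Lemma morphism_const n k (V : 'rV[K]_n -> Prop) (W : 'rV[K]_k -> Prop) c :
  W c -> morphism V W (fun=> c).
Proof. by move=> Wc; apply: morphism_pfun => // j; apply: pfun_const. Qed.

Lemma morphism_id n (V : 'rV[K]_n -> Prop) : morphism V V id.
Proof. by apply: morphism_pfun => // j; apply: pfun_coord. Qed.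

Lemma morphism2_comp n k l p (V : 'rV[K]_n -> Prop) (W : 'rV[K]_k -> Prop)
    (Y : 'rV[K]_l -> Prop) (Z : 'rV[K]_p -> Prop) F G M :
  morphism V W F -> morphism V Y G -> morphism2 W Y Z M ->
  morphism V Z (fun x => M (F x) (G x)).
Proof.
move=> mF mG mM; have := morphism_comp (morphism_row_mx mF mG) mM.
by apply: morphism_eq => x _; rewrite row_mxKl row_mxKr.
Qed.

Lemma isomorphism_of n k (V : 'rV[K]_n -> Prop) (W : 'rV[K]_k -> Prop) F G :
  morphism V W F -> morphism W V G -> (forall x, V x -> G (F x) = x) ->
  (forall y, W y -> F (G y) = y) -> isomorphism V W F.
Proof. by move=> mF mG GF FG; split=> //; exists G. Qed.

Lemma monoid_transport n k (V : 'rV[K]_n -> Prop) mu (W : 'rV[K]_k -> Prop) F G :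
  algebraic_monoid V mu -> locally_closed W -> irreducible W ->
  morphism V W F -> morphism W V G -> (forall x, V x -> G (F x) = x) ->
  (forall y, W y -> F (G y) = y) ->
  let nu x y := F (mu (G x) (G y)) in
  algebraic_monoid W nu /\ monoid_isomorphism V mu W nu F.
Proof.
move=> [_ mmu amu [e [Ve eu]]] lW iW mF mG GF FG nu.
have Vmu x y : V x -> V y -> V (mu x y).
  by move=> Vx Vy; have := mmu.1 (row_mx x y); rewrite row_mxKl row_mxKr; apply;
    split; rewrite ?row_mxKl ?row_mxKr.
have VG y : W y -> V (G y) by apply: mG.1.
have WF x : V x -> W (F x) by apply: mF.1.
have un d : is_unit V mu d -> is_unit W nu (F d).
  move=> [Vd ud]; split=> [|y Wy]; first exact: WF.
  by rewrite /nu GF //; have [-> ->] := ud _ (VG y Wy); rewrite FG.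
split; split=> //.
- apply: morphism_comp mF; apply: morphism2_comp mmu.
    exact: morphism_comp (morphism_lsubmx _ _) mG.
  exact: morphism_comp (morphism_rsubmx _ _) mG.
- move=> x y z /VG Wx /VG Wy /VG Wz; rewrite /nu.
  by rewrite (GF _ (Vmu _ _ Wx Wy)) (GF _ (Vmu _ _ Wy Wz)) amu.
- by exists (F e); apply: un.
- exact: isomorphism_of mF mG GF FG.
- by move=> x y Vx Vy; rewrite /nu !GF.
Qed.

Lemma closed_zeros n (p : {mpoly K[n]}) : zariski_closed (fun x => p.@[x 0] = 0).
Proof. by exists (fun f => f = p) => x; split=> [px f ->|]; [|apply]. Qed.

Lemma irreducible_mul n (V : 'rV[K]_n -> Prop) (p q : {mpoly K[n]}) :
  irreducible V -> (forall x, V x -> p.@[x 0] * q.@[x 0] = 0) ->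
  (forall x, V x -> p.@[x 0] = 0) \/ (forall x, V x -> q.@[x 0] = 0).
Proof.
move=> [_ irr] pq; apply: irr; try exact: closed_zeros.
by move=> x /pq/eqP; rewrite mulf_eq0 => /orP[]/eqP; [left|right].
Qed.

Lemma closed_product n k (V : 'rV[K]_n -> Prop) (W : 'rV[K]_k -> Prop) :
  zariski_closed V -> zariski_closed W -> zariski_closed (product V W).
Proof.
move=> [S VS] [T WT].
exists (fun f : {mpoly K[n + k]} => (exists2 g, S g & forall z : 'rV[K]_(n + k), f.@[z 0] = g.@[lsubmx z 0]) \/
                 (exists2 g, T g & forall z : 'rV[K]_(n + k), f.@[z 0] = g.@[rsubmx z 0])) => z.
split=> [[/VS Vz /WT Wz] f [] [g Sg ->]|zz]; [exact: Vz|exact: Wz|].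
split; [apply/VS | apply/WT] => g Sg.
  have [f hf] := pfun_comp_row g (@pfun_lsubmx n k).
  by rewrite hf; apply: zz; left; exists g.
have [f hf] := pfun_comp_row g (@pfun_rsubmx n k).
by rewrite hf; apply: zz; right; exists g.
Qed.

End Regular.

(** * The unit group of an affine monoid is a principal open subset *)

Section FiniteRank.
Variable K : closedFieldType.

(** Functions on a product in the algebraic tensor product of the spaces of
    functions on the factors. *)
Definition finite_rank (A B : Type) (Phi : A -> B -> K) : Prop :=
  exists (I : finType) (f : I -> A -> K) (g : I -> B -> K),
    forall a b, Phi a b = \sum_i f i a * g i b.

Lemma finite_rank_eq A B (Phi Psi : A -> B -> K) :
  (forall a b, Phi a b = Psi a b) -> finite_rank Psi -> finite_rank Phi.
Proof. by move=> e [I [f [g h]]]; exists I, f, g => a b; rewrite e h. Qed.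

Lemma finite_rankl A B (f : A -> K) : finite_rank (fun a (_ : B) => f a).
Proof.
by exists unit, (fun _ => f), (fun _ _ => 1) => a b; rewrite big_const card_unit /= addr0 mulr1.
Qed.

Lemma finite_rankr A B (g : B -> K) : finite_rank (fun (_ : A) b => g b).
Proof.
by exists unit, (fun _ _ => 1), (fun _ => g) => a b; rewrite big_const card_unit /= addr0 mul1r.
Qed.

Lemma finite_rankD A B (Phi Psi : A -> B -> K) :
  finite_rank Phi -> finite_rank Psi -> finite_rank (fun a b => Phi a b + Psi a b).
Proof.
move=> [I [f [g h]]] [I' [f' [g' h']]]; exists (I + I')%type.
exists (fun i => match i with inl i => f i | inr i => f' i end).
exists (fun i => match i with inl i => g i | inr i => g' i end) => a b.
by rewrite big_sumType h h'.
Qed.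

Lemma finite_rankM A B (Phi Psi : A -> B -> K) :
  finite_rank Phi -> finite_rank Psi -> finite_rank (fun a b => Phi a b * Psi a b).
Proof.
move=> [I [f [g h]]] [I' [f' [g' h']]]; exists (I * I')%type.
exists (fun i a => f i.1 a * f' i.2 a), (fun i b => g i.1 b * g' i.2 b) => a b.
rewrite h h' big_distrlr /= pair_big /=; apply: eq_bigr => i _; exact: mulrACA.
Qed.

Lemma finite_rank_sum A B J (r : seq J) (Phi : J -> A -> B -> K) :
  (forall j, finite_rank (Phi j)) -> finite_rank (fun a b => \sum_(j <- r) Phi j a b).
Proof.
move=> h; elim: r => [|j r IH].
  by apply: finite_rank_eq (finite_rankl _ (fun=> 0)) => a b; rewrite big_nil.
by apply: finite_rank_eq (finite_rankD (h j) IH) => a b; rewrite big_cons.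
Qed.

Lemma finite_rank_prod A B J (r : seq J) (Phi : J -> A -> B -> K) :
  (forall j, finite_rank (Phi j)) -> finite_rank (fun a b => \prod_(j <- r) Phi j a b).
Proof.
move=> h; elim: r => [|j r IH].
  by apply: finite_rank_eq (finite_rankl _ (fun=> 1)) => a b; rewrite big_nil.
by apply: finite_rank_eq (finite_rankM (h j) IH) => a b; rewrite big_cons.
Qed.

Lemma finite_rank_meval A B k (p : {mpoly K[k]}) (F : A -> B -> 'rV[K]_k) :
  (forall j, finite_rank (fun a b => F a b 0 j)) ->
  finite_rank (fun a b => p.@[F a b 0]).
Proof.
move=> hF; apply: (@finite_rank_eq _ _ _ (fun a b =>
  \sum_(m <- msupp p) p@_m * \prod_i F a b 0 i ^+ m i)).
  by move=> a b; rewrite mevalE.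
apply: finite_rank_sum => m; apply: finite_rankM; first exact: (finite_rankl _ (fun=> _)).
apply: finite_rank_prod => i; elim: (m i) => [|e IH].
  by apply: finite_rank_eq (finite_rankl _ (fun=> 1)) => a b; rewrite expr0.
by apply: finite_rank_eq (finite_rankM (hF i) IH) => a b; rewrite exprS.
Qed.

Lemma max_nat (P : nat -> Prop) N :
  P 0%N -> (forall d, P d -> (d <= N)%N) -> exists d, P d /\ ~ P d.+1.
Proof.
move=> P0 PN; apply: NNPP => nex.
have Pall d : P d.
  by elim: d => // d Pd; apply: NNPP => nPd; apply: nex; exists d.
by have := PN _ (Pall N.+1); rewrite ltnn.
Qed.

(** Bordered minors: a maximal nonzero minor of a function of finite rank,
    with columns [y] and rows [z], determines the whole function. *)
Lemma maximal_minor A B (Phi : A -> B -> K) : finite_rank Phi ->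
  exists d (z : 'I_d -> A) (y : 'I_d -> B),
    let M := (\matrix_(k, l) Phi (z l) (y k)) in
    M \in unitmx /\ forall a b,
      Phi a b = ((\row_l Phi (z l) b) *m invmx M *m (\col_k Phi a (y k))) 0 0.
Proof.
move=> [I [f [g PhiE]]].
pose P d := exists (z : 'I_d -> A) (y : 'I_d -> B),
  (\matrix_(k, l) Phi (z l) (y k)) \in unitmx.
have [||d [[z [y uM]] nP]] := @max_nat P #|I|.
- have emp (C : Type) : 'I_0 -> C by case.
  by exists (emp _), (emp _); rewrite unitmxE det_mx00 unitr1.
- move=> d [z [y uM]].
  have E : \matrix_(k, l) Phi (z l) (y k) =
      (\matrix_(k < d, i < #|I|) g (enum_val i) (y k)) *m (\matrix_(i < #|I|, l < d) f (enum_val i) (z l)).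
    apply/matrixP => k l; rewrite !mxE PhiE (reindex (@enum_val I predT)) /=.
      by apply: eq_bigr => i _; rewrite !mxE mulrC.
    exact/onW_bij/enum_val_bij.
  by rewrite -(mxrank_unit uM) E; apply: leq_trans (mxrankM_maxl _ _) (rank_leq_col _).
exists d, z, y; split=> // a b; apply: NNPP => neq; apply: nP.
rewrite -addn1; pose z' (i : 'I_(d + 1)) := if split i is inl l then z l else a.
pose y' (i : 'I_(d + 1)) := if split i is inl l then y l else b.
exists z', y'; set M := (\matrix_(k, l) Phi (z l) (y k)) in uM neq.
have zl l : z' (lshift 1 l) = z l by rewrite /z' (unsplitK (inl l)).
have zr l : z' (rshift d l) = a by rewrite /z' (unsplitK (inr l)).
have yl l : y' (lshift 1 l) = y l by rewrite /y' (unsplitK (inl l)).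
have yr l : y' (rshift d l) = b by rewrite /y' (unsplitK (inr l)).
set r := \row_l Phi (z l) b in neq; set c := \col_k Phi a (y k) in neq.
have -> : (\matrix_(k, l) Phi (z' l) (y' k)) = block_mx M c r (Phi a b)%:M.
  rewrite -[LHS]submxK; congr block_mx; apply/matrixP => k l; rewrite !mxE ?zl ?zr ?yl ?yr //.
  by rewrite !ord1 eqxx mulr1n.
have -> : block_mx M c r (Phi a b)%:M =
   block_mx 1%:M 0 (r *m invmx M) 1%:M *m block_mx M c 0 ((Phi a b)%:M - r *m invmx M *m c).
  rewrite mulmx_block !mul1mx !mul0mx ?mulmx0 !addr0 -mulmxA mulVmx // mulmx1.
  by rewrite addrC subrK.
rewrite unitmx_mul !unitmxE det_lblock !det1 mulr1 unitr1 det_ublock unitrM.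
rewrite -unitmxE uM /= det_mx11 unitfE.
have -> : ((Phi a b)%:M - r *m invmx M *m c) 0 0 = Phi a b - (r *m invmx M *m c) 0 0.
  by rewrite mxE [X in X + _]mxE eqxx mulr1n [X in _ + X]mxE.
by rewrite subr_eq0; apply/eqP => E; apply: neq.
Qed.

(** The functions [w |-> q (w M^k)], [k >= 0], span a space of finite
    dimension; dividing a linear relation among them by the lowest power of
    [M] expresses [q (w M^-1)] through the [q (w M^k)]. *)
Lemma vanishing_inverse d (M : 'M[K]_d) (q : {mpoly K[d]}) (v : 'rV[K]_d) :
  M \in unitmx ->
  (forall k, q.@[iter k (mulmx^~ M) v 0] = 0) -> q.@[(v *m invmx M) 0] = 0.
Proof.
move=> uM hq.
have iterE (N : 'M_d) k (w : 'rV_d) : iter k (mulmx^~ N) w = w *m iter k (mulmx^~ N) 1%:M.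
  by elim: k => [|k IH]; rewrite /= ?mulmx1 // IH mulmxA.
have [I [f [g hfg]]] : finite_rank (fun k (w : 'rV[K]_d) => q.@[iter k (mulmx^~ M) w 0]).
  apply: finite_rank_meval => j.
  apply: (@finite_rank_eq _ _ _ (fun k (w : 'rV[K]_d) => \sum_l w 0 l * (iter k (mulmx^~ M) 1%:M) l j)).
    by move=> k w; rewrite iterE mxE.
  apply: finite_rank_sum => l; apply: finite_rankM; first exact: (finite_rankr _ (fun w : 'rV[K]_d => w 0 l)).
  exact: (finite_rankl _ (fun k => iter k (mulmx^~ M) 1%:M l j)).
pose F := \matrix_(k < #|I|.+1, i < #|I|) f (enum_val i) k.
have : kermx F != 0.
  by rewrite kermx_eq0 /row_free eqn_leq negb_and -!ltnNge ltnS rank_leq_col orbT.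
case/rowV0Pn => c /sub_kermxP cF c0.
have rel (w : 'rV[K]_d) : \sum_k c 0 k * q.@[iter k (mulmx^~ M) w 0] = 0.
  transitivity (\sum_i (c *m F) 0 (enum_rank i) * g i w); last first.
    by rewrite cF big1 // => i _; rewrite mxE mul0r.
  under eq_bigr => k _ do rewrite hfg mulr_sumr.
  rewrite exchange_big; apply: eq_bigr => i _ /=; rewrite mxE mulr_suml.
  by apply: eq_bigr => k _; rewrite mxE enum_rankK mulrA.
have [k0 ck0] : exists k, c 0 k != 0.
  apply: NNPP => nex; case/negP: c0; apply/eqP/rowP => k; rewrite mxE.
  by apply/eqP; apply: contraT => ck; case: nex; exists k.
case: (@arg_minnP _ k0 (fun k => c 0 k != 0) (fun k => k : nat) ck0) => a ca mina.
have cancel k (w : 'rV[K]_d) : iter k (mulmx^~ M) (iter k (mulmx^~ (invmx M)) w) = w.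
  by elim: k w => // k IH w; rewrite iterSr /= mulmxKV // IH.
have cancelS k : iter k (mulmx^~ M) (iter k.+1 (mulmx^~ (invmx M)) v) = v *m invmx M.
  by rewrite iterSr cancel.
have := rel (iter a.+1 (mulmx^~ (invmx M)) v); rewrite (bigD1 a) //= cancelS big1.
  by rewrite addr0 => /eqP; rewrite mulf_eq0 (negbTE ca) => /eqP.
move=> k ka; have [->|ck] := eqVneq (c 0 k) 0; first by rewrite mul0r.
have lt : (a < k)%N by rewrite ltn_neqAle eq_sym ka mina.
by rewrite -[k : nat](subnK lt) iterD cancel hq mulr0.
Qed.

End FiniteRank.

Section Units.
Variable K : closedFieldType.

Lemma is_unit_unique n (V : 'rV[K]_n -> Prop) mu e d : is_unit V mu e -> is_unit V mu d -> d = e.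
Proof. by move=> [Ve ue] [Vd ud]; rewrite -(ud _ Ve).1; have [_ ->] := ue _ Vd. Qed.

(** The regular functions [z |-> f (z y)] span a space of finite dimension,
    on which the monoid acts by a matrix [M x], and [x] is invertible if and
    only if [M x] is.  Indeed, a polynomial relation that holds at all the
    points [x ^ k], with [k >= 0], also holds at the point with coordinates
    given by the inverse matrix; this point is then the inverse of [x]. *)
Lemma units_principal n (X : 'rV[K]_n -> Prop) mu e :
  zariski_closed X -> morphism2 X X X mu ->
  (forall x y z, X x -> X y -> X z -> mu (mu x y) z = mu x (mu y z)) ->
  (forall x y, X x -> X y -> mu x y = mu y x) -> is_unit X mu e ->
  exists h : {mpoly K[n]}, forall x, invertible X mu x <-> X x /\ h.@[x 0] != 0.
Proof.
move=> cX mmu amu cmu ue; have [Xe eu] := ue.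
have Xmu x y : X x -> X y -> X (mu x y).
  move=> Xx Xy; have := mmu.1 (row_mx x y); rewrite row_mxKl row_mxKr; apply.
  by split; rewrite ?row_mxKl ?row_mxKr.
have regl x : X x -> forall j, exists p : {mpoly K[n]}, forall y, X y -> mu x y 0 j = p.@[y 0].
  move=> Xx j; apply: regular_closed => //.
  exact: (morphism2_comp (morphism_const _ Xx) (morphism_id _) mmu).2.
pose T := {x : 'rV[K]_n | X x}.
pose mul (x y : T) : T := exist _ (mu (sval x) (sval y)) (Xmu _ _ (proj2_sig x) (proj2_sig y)).
pose one : T := exist _ e Xe.
have mulA x y z : sval (mul (mul x y) z) = sval (mul x (mul y z)).
  by apply: amu; apply: proj2_sig.
pose Phi (a : 'I_n * T) (y : T) := sval (mul a.2 y) 0 a.1.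
have PhiA j z x y : Phi (j, z) (mul x y) = Phi (j, mul z x) y.
  by rewrite /Phi -mulA.
have [|d [z [y [uB PhiE]]]] := @maximal_minor K _ _ Phi.
  have /fin_all_exists[P hP] j := regular_closed (closed_product cX cX) (mmu.2 j).
  apply: (@finite_rank_eq _ _ _ _ (fun a b => (P a.1).@[row_mx (sval a.2) (sval b) 0])).
    move=> a b; rewrite -hP ?row_mxKl ?row_mxKr //.
    by split; rewrite ?row_mxKl ?row_mxKr; apply: proj2_sig.
  apply: (@finite_rank_eq _ _ _ _ (fun a b => \sum_j (j == a.1)%:R * (P j).@[row_mx (sval a.2) (sval b) 0])).
    move=> a b; rewrite (bigD1 a.1) //= eqxx mul1r big1 ?addr0 // => j nj.
    by rewrite (negbTE nj) mul0r.
  apply: finite_rank_sum => j; apply: finite_rankM.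
    exact: (finite_rankl _ (fun a : 'I_n * T => (j == a.1)%:R)).
  apply: finite_rank_meval => i; case: (split_ordP i) => l ->.
    apply: finite_rank_eq (finite_rankl _ (fun a : 'I_n * T => sval a.2 0 l)) => a b.
    by rewrite row_mxEl.
  apply: finite_rank_eq (finite_rankr _ (fun b : T => sval b 0 l)) => a b.
  by rewrite row_mxEr.
set B := (\matrix_(k, l) Phi (z l) (y k)) in uB PhiE.
pose v (x : T) := \row_l Phi (z l) x.
pose N (x : T) := \matrix_(k, l) Phi ((z l).1, mul (z l).2 x) (y k).
pose M (x : T) := invmx B *m N x.
pose C := invmx B *m \matrix_(k, j) Phi (j, one) (y k).
have vmul x x' : v (mul x x') = v x' *m M x.
  apply/rowP => l; rewrite mxE [z l]surjective_pairing PhiA PhiE -mulmxA -/B mulmxA mulmxA.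
  by rewrite mxE [RHS]mxE; apply: eq_bigr => k _; rewrite !mxE.
have vC x : v x *m C = sval x.
  apply/rowP => j; have -> : sval x 0 j = Phi (j, one) x.
    by rewrite /Phi /= (eu _ (proj2_sig x)).1.
  by rewrite PhiE /C mulmxA mxE [RHS]mxE; apply: eq_bigr => k _; rewrite !mxE.
have vinj x x' : v x = v x' -> sval x = sval x' by rewrite -!vC => ->.
have vext x x' : sval x = sval x' -> v x = v x'.
  by move=> E; apply/rowP => l; rewrite !mxE /Phi /= E.
have Beq A A' : (forall k, v (y k) *m A = v (y k) *m A') -> A = A' :> 'M_d.
  move=> h; rewrite -[A](mulKmx uB) -[A'](mulKmx uB); congr (_ *m _).
  apply/row_matrixP => k; rewrite !row_mul.
  by have -> : row k B = v (y k) by apply/rowP => l; rewrite !mxE.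
have M1 : M one = 1%:M.
  apply: Beq => k; rewrite -vmul mulmx1; apply: vext => /=.
  by have [] := eu _ (proj2_sig (y k)).
have /fin_all_exists[V hV] l : exists p : {mpoly K[n]}, forall x : T, v x 0 l = p.@[sval x 0].
  have [p hp] := regl _ (proj2_sig (z l).2) (z l).1.
  by exists p => x; rewrite mxE -hp //; apply: proj2_sig.
have /fin_all_exists[Q hQ] (kl : 'I_d * 'I_d) : exists p : {mpoly K[n]},
    forall x : T, N x kl.1 kl.2 = p.@[sval x 0].
  have [p hp] : exists p : {mpoly K[n]}, forall x, X x ->
      mu (mu (sval (z kl.2).2) x) (sval (y kl.1)) 0 (z kl.2).1 = p.@[x 0].
    apply: regular_closed => //.
    have m1 := morphism2_comp (morphism_const _ (proj2_sig (z kl.2).2)) (morphism_id _) mmu.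
    exact: (morphism2_comp m1 (morphism_const _ (proj2_sig (y kl.1))) mmu).2.
  by exists p => x; rewrite mxE -hp //; apply: proj2_sig.
exists (\det (map_mx (@mpolyC n K) (invmx B) *m \matrix_(k, l) Q (k, l))) => x.
have detE (t : T) : (\det (map_mx (@mpolyC n K) (invmx B) *m \matrix_(k, l) Q (k, l))).@[sval t 0]
    = \det (M t).
  rewrite -det_map_mx map_mxM -map_mx_comp; congr (\det (_ *m _)).
    by apply/matrixP => k l; rewrite !mxE /= mevalC.
  by apply/matrixP => k l; rewrite (hQ (k, l)) !mxE.
split=> [[Xx [x' [Xx' uxx' _]]]|[Xx]].
  split=> //; pose t : T := exist _ x Xx; pose t' : T := exist _ x' Xx'.
  rewrite (detE t) -unitfE -unitmxE.
  have [] // := @mulmx1_unit _ _ (M t') (M t); rewrite -M1; apply: Beq => k.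
  rewrite mulmxA -!vmul; apply: vext; rewrite -mulA /=; congr (mu _ _).
  exact: is_unit_unique ue uxx'.
pose t : T := exist _ x Xx; rewrite (detE t) -unitfE -unitmxE => uM.
have vpow k : v (iter k (mul t) one) = iter k (mulmx^~ (M t)) (v one).
  by elim: k => // k IH; rewrite iterS vmul IH.
pose w := v one *m invmx (M t).
have wzero (q : {mpoly K[d]}) : (forall s, q.@[v s 0] = 0) -> q.@[w 0] = 0.
  by move=> hq; apply: vanishing_inverse => // k; rewrite -vpow.
have pC (p : {mpoly K[n]}) : exists q : {mpoly K[d]}, forall u : 'rV_d, q.@[u 0] = p.@[(u *m C) 0].
  have [|q hq] := @pfun_comp_row K d n p (fun u => u *m C); last by exists q => u; rewrite -hq.
  move=> j; apply: (@pfun_eq _ _ _ (fun u : 'rV[K]_d => \sum_l u 0 l * C l j)).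
    by move=> u; rewrite mxE.
  by apply: pfun_sum => l; apply: pfunM; [apply: pfun_coord | apply: pfun_const].
have Xw : X (w *m C).
  have [S XS] := cX; apply/XS => p Sp; have [q hq] := pC p; rewrite -hq; apply: wzero => s.
  by rewrite hq vC; have /XS := proj2_sig s; apply.
pose t' : T := exist _ (w *m C) Xw.
have vt' : v t' = w.
  apply/rowP => l; rewrite hV /=; apply/eqP; rewrite -subr_eq0; apply/eqP.
  have [q hq] := pC (V l).
  have := wzero (q - 'X_l); rewrite mevalB hq mevalXU; apply => s.
  by rewrite mevalB mevalXU hq vC -hV subrr.
have xt' : mu x (w *m C) = e.
  by apply: (vinj (mul t t') one); rewrite vmul vt' /w mulmxKV.
split; first exact: Xx.
by exists (w *m C); split; [exact: Xw | rewrite xt' | rewrite cmu // xt'].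
Qed.

End Units.

(** * The unit group of a commutative monoid on a surface *)

Section RankData.
Variable K : closedFieldType.

(** Affine spaces of dimension 0 and 1 are treated alike: [tau] is the coordinate,
    or 0 on a point. *)
Lemma pfun_poly1 d : (d <= 1)%N ->
  exists tau : 'rV[K]_d -> K, forall p : {mpoly K[d]}, exists q : {poly K},
    forall z : 'rV[K]_d, p.@[z 0] = q.[tau z].
Proof.
case: d => [|[|//]] _.
  by exists (fun=> 0) => p; exists (p@_0%MM)%:P => z; rewrite {1}(nvar0_mpolyC p) mevalC hornerC.
exists (fun z => z 0 0) => p; exists (\sum_(m <- msupp p) p@_m *: 'X^(m 0)) => z.
rewrite mevalE horner_sum; apply: eq_bigr => m _.
by rewrite hornerZ hornerXn big_ord_recl big_ord0 mulr1.
Qed.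

Lemma linear_dependence (I : finType) N (v : I -> 'rV[K]_N) : (N < #|I|)%N ->
  exists c : I -> K, (exists i, c i != 0) /\ \sum_i c i *: v i = 0.
Proof.
move=> NI; pose A := \matrix_(k < #|I|) v (enum_val k).
have : kermx A != 0.
  rewrite kermx_eq0 /row_free neq_ltn; apply/orP; left.
  by apply: leq_ltn_trans NI; apply: rank_leq_col.
case/rowV0Pn => c /sub_kermxP cA c0; exists (fun i => c 0 (enum_rank i)); split.
  apply: NNPP => nex; case/negP: c0; apply/eqP/rowP => k; rewrite mxE.
  by apply/eqP; apply: contraT => ck; case: nex; exists (enum_val k); rewrite enum_valK.
transitivity (c *m A); last exact: cA.
rewrite mulmx_sum_row (reindex (@enum_val I predT)) /=; last exact/onW_bij/enum_val_bij.
by apply: eq_bigr => k _; rewrite enum_valK rowK.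
Qed.

Definition mon2 (i j : nat) : 'X_{1..2} := [multinom (if (k : 'I_2) == 0%R then i else j) | k < 2].

Lemma big2 (R : Type) (idx : R) (op : Monoid.law idx) (f : 'I_2 -> R) :
  \big[op/idx]_i f i = op (f 0) (f 1).
Proof.
rewrite !big_ord_recl big_ord0 Monoid.mulm1; congr (op _ (f _)); exact: val_inj.
Qed.

Lemma I2_ind (P : 'I_2 -> Prop) : P 0 -> P 1 -> forall i, P i.
Proof.
move=> P0 P1 [[|[|//]] h].
  by rewrite (_ : Ordinal h = 0) //; apply: val_inj.
by rewrite (_ : Ordinal h = 1) //; apply: val_inj.
Qed.

Lemma mon2_inj i j k l : mon2 i j = mon2 k l -> i = k /\ j = l.
Proof. by move=> /mnmP h; have := h 0; have := h 1; rewrite !mnmE /=. Qed.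

Lemma meval_mon2 i j (v : 'I_2 -> K) : ('X_[mon2 i j]).@[v] = v 0 ^+ i * v 1 ^+ j.
Proof. by rewrite mevalX big2 !mnmE. Qed.

(** Two fractions in one variable are algebraically dependent: the monomials
    of degree at most [d] in each of them, multiplied by a common denominator,
    have degree linear in [d], and there are [(d + 1)^2] of them. *)
Lemma fractions_dependent (N D : 'I_2 -> {poly K}) :
  exists (d : nat) (c : 'I_d.+1 * 'I_d.+1 -> K), (exists i, c i != 0) /\
    \sum_ij c ij *: (N 0 ^+ ij.1 * D 0 ^+ (d - ij.1) * (N 1 ^+ ij.2 * D 1 ^+ (d - ij.2))) = 0.
Proof.
pose E := (\sum_i (size (N i) + size (D i))).+1%N.
have sE (p : {poly K}) k : (size p < E)%N -> (size (p ^+ k)%R <= (k * E).+1)%N.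
  move=> sp; apply: (leq_trans (size_poly_exp_leq _ _)); rewrite ltnS mulnC leq_mul2l.
  by rewrite (leq_trans (leq_pred _)) ?orbT // ltnW.
have NE i : (size (N i) < E)%N /\ (size (D i) < E)%N.
  rewrite /E (bigD1 i) //= !ltnS; split; first by rewrite -addnA leq_addr.
  by rewrite addnAC leq_addl.
pose d := (2 * E)%N.
have s2 i (k : nat) : (k <= d)%N -> (size (N i ^+ k * D i ^+ (d - k))%R <= (d * E).+1)%N.
  move=> kd; apply: (leq_trans (size_polyMleq _ _)).
  have := sE _ k (NE i).1; have := sE _ (d - k)%N (NE i).2; rewrite mulnBl.
  have : (k * E <= d * E)%N by rewrite leq_mul2r kd orbT.
  by move: (size _) (size _) (k * E)%N (d * E)%N => x y z w; lia.
pose q (ij : 'I_d.+1 * 'I_d.+1) :=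
  N 0 ^+ ij.1 * D 0 ^+ (d - ij.1) * (N 1 ^+ ij.2 * D 1 ^+ (d - ij.2)).
have sq ij : (size (q ij) <= (2 * (d * E)).+1)%N.
  apply: (leq_trans (size_polyMleq _ _)).
  have kd (k : 'I_d.+1) : (k <= d)%N by rewrite -ltnS.
  have := s2 0 _ (kd ij.1); have := s2 1 _ (kd ij.2).
  by move: (size _) (size _) (d * E)%N => x y w; lia.
have [|c [c0 cq]] := @linear_dependence _ (2 * (d * E)).+1 (fun ij => \row_k (q ij)`_k).
  rewrite card_prod !card_ord /d; have : (0 < E)%N by []. 
  by move: (E) => e; nia.
exists d, c; split=> //; apply/polyP => k; rewrite coef0 coef_sum.
have [sk|ks] := ltnP k (2 * (d * E)).+1.
  have := congr1 (fun v : 'rV_(2 * (d * E)).+1 => v 0 (Ordinal sk)) cq.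
  rewrite summxE [RHS]mxE => h; rewrite -[RHS]h.
  by apply: eq_bigr => ij _; rewrite coefZ !mxE.
by rewrite big1 // => ij _; rewrite coefZ nth_default ?mulr0 // (leq_trans (sq ij)).
Qed.

Lemma homogeneous_scale (x a b a' b' : K) d i j : (i <= d)%N -> (j <= d)%N ->
  a ^+ i * b ^+ (d - i) * (a' ^+ j * b' ^+ (d - j)) * x ^+ (d + d) =
  (a * x) ^+ i * (b * x) ^+ (d - i) * ((a' * x) ^+ j * (b' * x) ^+ (d - j)).
Proof.
move=> id jd; have -> : x ^+ (d + d) = x ^+ i * x ^+ (d - i) * (x ^+ j * x ^+ (d - j)).
  by rewrite -!exprD !subnKC.
by rewrite !exprMn; ring.
Qed.

Lemma homogeneous_fraction (a b a' b' : K) d i j : (i <= d)%N -> (j <= d)%N ->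
  b != 0 -> b' != 0 ->
  (a / b) ^+ i * (a' / b') ^+ j * (b ^+ d * b' ^+ d) =
  a ^+ i * b ^+ (d - i) * (a' ^+ j * b' ^+ (d - j)).
Proof.
move=> id jd b0 b'0; rewrite -{1}(subnKC id) -{2}(subnKC jd) !exprD !expr_div_n.
by field; rewrite !expf_neq0.
Qed.

Lemma torus_nonzero d (P : {mpoly K[d]}) :
  (forall z : 'rV[K]_d, (forall i, z 0 i != 0) -> P.@[z 0] = 0) -> P = 0.
Proof.
move=> hP; have : P * \prod_i 'X_i = 0.
  apply: meval_eq0 => z; rewrite mevalM rmorph_prod /=.
  have [/forallP h|] := boolP [forall i, z 0 i != 0]; first by rewrite hP ?mul0r.
  rewrite negb_forall => /existsP[i /negPn/eqP zi].
  by rewrite (bigD1 i) //= mevalXU zi mul0r mulr0.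
move/eqP; rewrite mulf_eq0 => /orP[/eqP//|/eqP /(congr1 (meval (fun=> 1)))].
rewrite rmorph_prod meval0 big1 => [/eqP|i _]; first by rewrite oner_eq0.
exact: mevalXU.
Qed.

Lemma GmGa_principal r s (z : 'rV[K]_(r + s)) :
  GmGa z <-> True /\ (\prod_(i < r) 'X_(lshift s i) : {mpoly K[r + s]}).@[z 0] != 0.
Proof.
rewrite rmorph_prod /=; split=> [h|[_ h] i].
  by split=> //; apply/prodf_neq0 => i _; rewrite mevalXU; have := h i; rewrite mxE.
by move/prodf_neq0: h => /(_ i isT); rewrite mevalXU mxE.
Qed.

Lemma full_closed n : zariski_closed (fun _ : 'rV[K]_n => True).
Proof. by exists (fun=> False) => x; split=> // _ f. Qed.

(** The group of units is a dense open subset with coordinates [z]: if [r + s > 2],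
    three of them are algebraically independent on [X], and if [r + s < 2], any
    two fractions on [X] become fractions in one variable. *)
Lemma rank_sum n (X : 'rV[K]_n -> Prop) r s (F : 'rV[K]_(r + s) -> 'rV[K]_n)
    (G : 'rV[K]_n -> 'rV[K]_(r + s)) (U : 'rV[K]_n -> Prop) (h : {mpoly K[n]}) :
  zariski_closed X -> irreducible X -> has_dimension X 2%N ->
  (forall x, U x <-> X x /\ h.@[x 0] != 0) ->
  morphism (@GmGa K r s) U F -> morphism U (@GmGa K r s) G ->
  (forall z, GmGa z -> G (F z) = z) -> (forall x, U x -> F (G x) = x) ->
  (r + s)%N = 2%N.
Proof.
move=> cX iX [[a [b [bne indep]]] nindep] UE mF mG GF FG.
have U0 : U (F (const_mx 1)).
  by apply: mF.1 => i; rewrite !mxE oner_neq0.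
have XU x : U x -> X x by move=> /UE[].
have zeroU (q : {mpoly K[n]}) : (forall z, GmGa z -> q.@[F z 0] = 0) -> forall x, X x -> q.@[x 0] = 0.
  move=> hq; have [x Xx|//|/(_ _ (XU _ U0)) h0] := @irreducible_mul _ _ _ q h iX.
    have [->|hx] := eqVneq h.@[x 0] 0; first by rewrite mulr0.
    have Ux : U x by apply/UE.
    by rewrite -(FG x Ux) hq ?mul0r //; apply: mG.1.
  by have /UE[_] := U0; rewrite h0 eqxx.
have [lt2|gt2|//] := ltngtP (r + s)%N 2%N; exfalso.
  have [tau htau] := pfun_poly1 (lt2 : (r + s <= 1)%N).
  pose fn (ib : 'I_2 * bool) := if ib.2 then a ib.1 else b ib.1.
  have [H hH] := htau (\prod_(i < r) 'X_(lshift s i)).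
  have /fin_all_exists[A /fin_all_exists[k hAk]] ib : exists (A : {poly K}) (k : nat), forall z,
      GmGa z -> (fn ib).@[F z 0] = A.[tau z] / H.[tau z] ^+ k.
    have [|A [k hA]] := regular_principal (full_closed _) (@GmGa_principal r s) (f := fun z => (fn ib).@[F z 0]).
      by apply: (regular_comp (f := fun y => (fn ib).@[y 0]) mF); apply/regular_pfun/pfun_poly.
    have [q hq] := htau A; exists q, k => z Uz; by rewrite hA // hq hH.
  pose m := (\sum_ib k ib)%N.
  pose N i := A (i, true) * H ^+ (m - k (i, true)); pose D i := A (i, false) * H ^+ (m - k (i, false)).
  have Hn0 z : GmGa z -> H.[tau z] != 0 by move=> /GmGa_principal[_]; rewrite hH.
  have km ib : (k ib <= m)%N by rewrite /m (bigD1 ib) //= leq_addr.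
  have common ib z : GmGa z -> (fn ib).@[F z 0] * H.[tau z] ^+ m = (A ib * H ^+ (m - k ib)).[tau z].
    move=> Uz; rewrite hAk // hornerM horner_exp -{1}(subnK (km ib)) exprD mulrA mulrAC.
    by rewrite divfK // expf_neq0 // Hn0.
  have [d [c [[ij cij] rel]]] := fractions_dependent N D.
  pose P : {mpoly K[2]} := \sum_ij c ij *: 'X_[mon2 ij.1 ij.2].
  have : P != 0.
    apply/eqP => /(congr1 (mcoeff (mon2 ij.1 ij.2))).
    rewrite mcoeff0 raddf_sum (bigD1 ij) //= mcoeffZ mcoeffX eqxx mulr1 big1 ?addr0 => [|kl nkl].
      by move/eqP; rewrite (negbTE cij).
    rewrite mcoeffZ mcoeffX; case: eqP => [/mon2_inj[e1 e2]|]; last by rewrite mulr0.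
    by case/eqP: nkl; case: kl ij e1 e2 {cij} => [k1 k2] [l1 l2] /= /val_inj-> /val_inj->.
  case/eqP; apply: indep => x Xx bx.
  pose q := \sum_ij c ij *: (a 0 ^+ ij.1 * b 0 ^+ (d - ij.1) * (a 1 ^+ ij.2 * b 1 ^+ (d - ij.2))).
  have /(_ x Xx) : forall x, X x -> q.@[x 0] = 0.
    apply: zeroU => z Uz; apply: (mulIf (expf_neq0 (d + d) (expf_neq0 m (Hn0 z Uz)))).
    have rz := congr1 (horner^~ (tau z)) rel; rewrite /= horner_sum horner0 in rz.
    rewrite mul0r -[RHS]rz rmorph_sum mulr_suml.
    apply: eq_bigr => kl _; rewrite /= hornerZ mevalZ -[LHS]mulrA; congr (_ * _).
    rewrite !hornerM !horner_exp /N /D -!common // !mevalM !rmorphXn /=.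
    by apply: homogeneous_scale; rewrite -ltnS.
  rewrite /q /P !rmorph_sum /= => q0.
  apply: (mulIf (mulf_neq0 (expf_neq0 d (bx 0)) (expf_neq0 d (bx 1)))).
  rewrite mul0r -[RHS]q0 mulr_suml; apply: eq_bigr => kl _.
  rewrite !mevalZ meval_mon2 !mevalM !rmorphXn /= -[LHS]mulrA; congr (_ * _).
  by apply: homogeneous_fraction; rewrite ?bx // -ltnS.
apply: nindep.
have /fin_all_exists[p /fin_all_exists[k hpk]] i : exists (p : {mpoly K[n]}) (k : nat), forall x,
    U x -> G x 0 i = p.@[x 0] / h.@[x 0] ^+ k.
  exact: regular_principal cX UE (mG.2 i).
exists (fun i => p (widen_ord gt2 i)), (fun i => h ^+ k (widen_ord gt2 i)); split=> [i|P hP].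
  exists (F (const_mx 1)); have /UE[X0 h0] := U0; split=> //.
  by rewrite rmorphXn expf_neq0.
apply: torus_nonzero => z zn0.
pose w : 'rV[K]_(r + s) := \row_i (if (i < 3)%N then z 0 (inord i) else 1).
have Uw : GmGa w by move=> i; rewrite !mxE; case: ifP => _; rewrite ?zn0 ?oner_neq0.
have UFw : U (F w) by apply: mF.1.
have /UE[XFw hFw] := UFw.
have <- := hP (F w) XFw; last by move=> i; rewrite rmorphXn expf_neq0.
by apply: meval_eq => i; rewrite rmorphXn -hpk // GF // mxE /= ltn_ord inord_val.
Qed.

End RankData.

Section GroupSpace.
Variable K : closedFieldType.

(** The variety of the group of units [G_m^r x G_a^(2 - r)]. *)
Definition group_space (r : nat) (z : 'rV[K]_2) : Prop :=
  forall i : 'I_2, (i < r)%N -> z 0 i != 0.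

Definition group_mul (r : nat) (z w : 'rV[K]_2) : 'rV[K]_2 :=
  \row_i (if (i < r)%N then z 0 i * w 0 i else z 0 i + w 0 i).

Lemma GmGaE r s (z : 'rV[K]_(r + s)) :
  GmGa z <-> forall i : 'I_(r + s), (i < r)%N -> z 0 i != 0.
Proof.
split=> h i => [ir|]; last by rewrite mxE; apply: h => /=.
have -> : i = lshift s (Ordinal ir) by apply: val_inj.
by have := h (Ordinal ir); rewrite mxE.
Qed.

Lemma GmGa_mulE r s (z w : 'rV[K]_(r + s)) :
  GmGa_mul z w = \row_i (if (i < r)%N then z 0 i * w 0 i else z 0 i + w 0 i).
Proof.
apply/rowP => i; rewrite !mxE; case: split_ordP => j -> /=.
  by rewrite !mxE.
by rewrite !mxE.
Qed.

Definition unit_parametrization n (X : 'rV[K]_n -> Prop) mu (r : nat)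
    (F : 'rV[K]_2 -> 'rV[K]_n) (G : 'rV[K]_n -> 'rV[K]_2) : Prop :=
  [/\ morphism (group_space r) (invertible X mu) F,
      morphism (invertible X mu) (group_space r) G,
      forall z, group_space r z -> G (F z) = z,
      forall x, invertible X mu x -> F (G x) = x
    & forall z w, group_space r z -> group_space r w -> F (group_mul r z w) = mu (F z) (F w)].

Lemma rank_data n (X : 'rV[K]_n -> Prop) mu r :
  zariski_closed X -> irreducible X -> has_dimension X 2%N ->
  commutative_monoid_of_rank X mu r ->
  (r <= 2)%N /\ exists F G, unit_parametrization X mu r F G.
Proof.
move=> cX iX dX [[[_ mmu amu [e ue]] cmu] [s [F [[mF [G [mG GF FG]]] morF _]]]].
have [h hE] := units_principal cX mmu amu cmu ue.
have rs := rank_sum cX iX dX hE mF mG GF FG.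
split; first by rewrite -rs leq_addr.
case: r rs F G mF mG GF FG morF => [|[|[|r]]] rs //.
- have {rs} -> : s = 2%N by move: rs; rewrite add0n.
  move=> F G mF mG GF FG morF; exists F, G.
  have E (z : 'rV[K]_2) : group_space 0 z <-> @GmGa K 0 2 z by rewrite GmGaE.
  split=> //.
  + by apply: (morphism_sub _ mF) => z /E.
  + by split=> [x /mG.1/E //|]; exact: mG.2.
  + by move=> z /E; exact: GF.
  + by move=> z w /E Uz /E Uw; rewrite -morF //; congr F; rewrite GmGa_mulE.
- have {rs} -> : s = 1%N by move: rs; rewrite add1n => -[].
  move=> F G mF mG GF FG morF; exists F, G.
  have E (z : 'rV[K]_2) : group_space 1 z <-> @GmGa K 1 1 z by rewrite GmGaE.
  split=> //.
  + by apply: (morphism_sub _ mF) => z /E.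
  + by split=> [x /mG.1/E //|]; exact: mG.2.
  + by move=> z /E; exact: GF.
  + by move=> z w /E Uz /E Uw; rewrite -morF //; congr F; rewrite GmGa_mulE.
- have {rs} -> : s = 0%N by move: rs; case: s.
  move=> F G mF mG GF FG morF; exists F, G.
  have E (z : 'rV[K]_2) : group_space 2 z <-> @GmGa K 2 0 z by rewrite GmGaE.
  split=> //.
  + by apply: (morphism_sub _ mF) => z /E.
  + by split=> [x /mG.1/E //|]; exact: mG.2.
  + by move=> z /E; exact: GF.
  + by move=> z w /E Uz /E Uw; rewrite -morF //; congr F; rewrite GmGa_mulE.
Qed.

Lemma torus_group r (z : 'rV[K]_2) : torus z -> group_space r z.
Proof. by move=> Tz i _; apply: Tz. Qed.

Lemma group_space2 (z : 'rV[K]_2) : group_space 2 z <-> torus z.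
Proof. by split=> [h i|h i _]; [apply: h | apply: h]. Qed.

End GroupSpace.

(** * Toric charts *)

Section Characters.
Variable K : closedFieldType.
Implicit Types (t s : 'rV[K]_2) (u v : 'rV[int]_2).

Lemma characterE u t : character u t = t 0 0 ^ u 0 0 * t 0 1 ^ u 0 1.
Proof. by rewrite /character big2. Qed.

Lemma character0 t : character 0 t = 1.
Proof. by rewrite characterE !mxE !expr0z mulr1. Qed.

Lemma characterD u v t : torus t -> character (u + v) t = character u t * character v t.
Proof. by move=> Tt; rewrite !characterE !mxE !expfzDr ?Tt // mulrACA. Qed.

Lemma characterN u t : torus t -> character (- u) t = (character u t)^-1.
Proof. by move=> Tt; rewrite !characterE !mxE -!invr_expz invfM. Qed.

Lemma character_neq0 u t : torus t -> character u t != 0.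
Proof. by move=> Tt; rewrite characterE mulf_neq0 // expfz_neq0 // Tt. Qed.

Lemma characterMn u k t : torus t -> character (u *+ k) t = character u t ^+ k.
Proof.
move=> Tt; elim: k => [|k IH]; first by rewrite mulr0n character0.
by rewrite mulrS characterD // IH exprS.
Qed.

Lemma character_mul u s t : character u (torus_mul s t) = character u s * character u t.
Proof. by rewrite !characterE !mxE !expfzMl mulrACA. Qed.

Lemma torus_mulP s t : torus s -> torus t -> torus (torus_mul s t).
Proof. by move=> Ts Tt i; rewrite mxE mulf_neq0. Qed.

Lemma torus_oneP : torus (torus_one K).
Proof. by move=> i; rewrite mxE oner_neq0. Qed.

End Characters.

Section Isolation.
Variable K : closedFieldType.
Hypothesis char0 : [pchar K] =i pred0.

Lemma natr_eq0 k : (k%:R == 0 :> K) = (k == 0%N).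
Proof. by rewrite (pcharf0P K).1. Qed.

Lemma natr_inj k l : k%:R = l%:R :> K -> k = l.
Proof.
wlog kl : k l / (k <= l)%N => [h e|]; first by case/orP: (leq_total k l) => ?; [|apply/esym]; apply: h.
move/eqP; rewrite eq_sym -subr_eq0 -natrB // natr_eq0 subn_eq0 => lk.
by apply/eqP; rewrite eqn_leq kl.
Qed.

(** Stated for spaces of functions up to pointwise equality, as the functions on a
    variety matter only on the variety. *)
Definition linear_space (T : Type) (A : (T -> K) -> Prop) : Prop :=
  [/\ forall f g, f =1 g -> A g -> A f, A (fun=> 0),
      forall f g, A f -> A g -> A (fun x => f x + g x)
    & forall c f, A f -> A (fun x => c * f x)].

Lemma linear_sum T A I (r : seq I) (P : pred I) (f : I -> T -> K) : linear_space A ->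
  (forall i, P i -> A (f i)) -> A (fun x => \sum_(i <- r | P i) f i x).
Proof.
move=> [Ae A0 AD _] hf; elim: r => [|i r IH].
  by apply: Ae A0 => x; rewrite big_nil.
case Pi: (P i); last by apply: Ae IH => x; rewrite big_cons Pi.
by apply: Ae (AD _ _ (hf i Pi) IH) => x; rewrite big_cons Pi.
Qed.

(** The powers of 2 being distinct, the operators that replace [s] by [2 s]
    and subtract [2 ^ d] times the original eliminate the terms one by one. *)
Lemma isolate_coefficients T A d (g : nat -> T -> K) : linear_space A ->
  (forall s, s != 0 -> A (fun x => \sum_(i < d) s ^+ i * g i x)) ->
  forall i, (i < d)%N -> A (g i).
Proof.
move=> lA; have [Ae A0 AD AM] := lA.
elim: d g => // d IH g hg.
have n2 k : (2%:R : K) ^+ k != 0 by rewrite expf_neq0 // natr_eq0.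
have lt i : (i < d)%N -> A (g i).
  move=> id; pose w i := 2%:R ^+ i - 2%:R ^+ d : K.
  have wi : w i != 0.
    rewrite subr_eq0 -!natrX; apply/eqP => /natr_inj/eqP.
    by rewrite eqn_exp2l // => /eqP e; move: id; rewrite e ltnn.
  suff h : A (fun x => w i * g i x).
    by apply: Ae (AM (w i)^-1 _ h) => x; rewrite mulKf.
  apply: (IH (fun i x => w i * g i x)) id => s s0.
  have s20 : 2%:R * s != 0 by rewrite mulf_neq0 // natr_eq0.
  apply: Ae (AD _ _ (hg _ s20) (AM (- 2%:R ^+ d) _ (hg _ s0))) => x.
  rewrite !big_ord_recr /= exprMn.
  have -> : \sum_(i < d) s ^+ i * (w i * g i x) =
      \sum_(i < d) (2%:R * s) ^+ i * g i x - 2%:R ^+ d * \sum_(i < d) s ^+ i * g i x.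
    rewrite mulr_sumr -sumrB; apply: eq_bigr => k _; rewrite /w exprMn; ring.
  ring.
move=> i; rewrite ltnS leq_eqVlt => /orP[/eqP->|]; last exact: lt.
have h1 : A (fun x => \sum_(i < d) g i x) by apply: linear_sum => // j _; apply: lt.
apply: Ae (AD _ _ (hg 1 (oner_neq0 _)) (AM (-1) _ h1)) => x.
rewrite big_ord_recr /= expr1n mul1r mulN1r addrAC.
under eq_bigr => k _ do rewrite expr1n mul1r.
by rewrite subrr add0r.
Qed.

(** The derivatives give the powers of degree below the degree of [p], by induction;
    subtracting them from [p] leaves the leading monomial. *)
Lemma derivation_stable (V : {poly K} -> Prop) :
  (forall p q, V p -> V q -> V (p + q)) -> (forall c p, V p -> V (c *: p)) ->
  (forall p, V p -> V p^`()) ->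
  forall p k, V p -> p`_k != 0 -> V 'X^k.
Proof.
move=> VD VZ Vd p; have [m sm] := ubnP (size p); elim: m p sm => // m IH p sp k Vp pk.
have V0 : V 0 by rewrite -(scale0r p); apply: VZ.
have deriveX j : V 'X^(j.+1) -> V 'X^j.
  move=> /Vd; rewrite derivXn /= => /(VZ (j.+1%:R)^-1).
  by rewrite -scaler_nat scalerA mulVf ?scale1r // natr_eq0.
have low j l : (j < l)%N -> p`_l != 0 -> V 'X^j.
  case: l => // l; rewrite ltnS => jl pl.
  have Vl : V 'X^l.
    have szd : (size p^`() < m)%N.
      have [p0|p0] := eqVneq p 0; first by move: pl; rewrite p0 coef0 eqxx.
      exact: leq_trans (lt_size_deriv p0) sp.
    apply: (IH _ szd) (Vd _ Vp) _.
    by rewrite coef_deriv -mulr_natr mulf_neq0 // natr_eq0.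
  by move: Vl; rewrite -(subnK jl); elim: (l - j)%N => // i IHi /deriveX.
have [pd|pd|pd] := ltngtP k (size p).-1.
- by apply: low pd _; rewrite -lead_coefE lead_coef_eq0; apply: contra pk => /eqP ->; rewrite coef0.
- move: pk; rewrite nth_default ?eqxx //; apply: leq_trans pd; exact: leqSpred.
have Vlow : V (\sum_(j < k) (- p`_j) *: 'X^j).
  apply: (big_ind V) => //= j _; apply: VZ; exact: low (ltn_ord j) pk.
have := VZ (p`_k)^-1 _ (VD _ _ Vp Vlow); suff -> : p + \sum_(j < k) (- p`_j) *: 'X^j = p`_k *: 'X^k.
  by rewrite scalerA mulVf // scale1r.
have sp1 : size p = k.+1.
  by rewrite pd prednK // lt0n; apply: contra pk; rewrite size_poly_eq0 => /eqP ->; rewrite coef0.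
under eq_bigr => j _ do rewrite scaleNr.
by rewrite sumrN -{1}(coefK p) poly_def sp1 big_ord_recr /= addrAC subrr add0r.
Qed.

End Isolation.

Section Bivariate.
Variable K : closedFieldType.

(** The inner variable is the first one, so that the coefficient of
    [a ^ i * b ^ j] is [P`_j`_i]. *)
Definition eval2 (P : {poly {poly K}}) (a b : K) : K := P.[b%:P].[a].

Lemma eval2E P a b : eval2 P a b = \sum_(j < size P) b ^+ j * (P`_j).[a].
Proof.
rewrite /eval2 (horner_coef P) horner_sum; apply: eq_bigr => j _.
by rewrite hornerM -polyC_exp hornerC mulrC.
Qed.

Lemma eval2_swap P a b : eval2 (swapXY P) a b = eval2 P b a.
Proof. exact: horner2_swapXY. Qed.

Lemma eval2D P Q a b : eval2 (P + Q) a b = eval2 P a b + eval2 Q a b.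
Proof. by rewrite /eval2 !hornerD. Qed.

Lemma eval2M P Q a b : eval2 (P * Q) a b = eval2 P a b * eval2 Q a b.
Proof. by rewrite /eval2 !hornerM. Qed.

Lemma eval2_eq0 P : (forall a b, eval2 P a b = 0) -> P = 0.
Proof.
move=> hP; apply/polyP => j; rewrite coef0; apply: poly_eq0 => a.
have E : map_poly (horner_eval a) P = 0.
  apply: poly_eq0 => b; rewrite -(hP a b) /eval2.
  have := horner_map (horner_eval a) P b%:P; rewrite /= /horner_eval hornerC => ->.
  by [].
by have := congr1 (fun p : {poly K} => p`_j) E; rewrite /= coef_map coef0.
Qed.

Lemma bivariate (p : {mpoly K[2]}) :
  exists P, forall x : 'rV[K]_2, p.@[x 0] = eval2 P (x 0 0) (x 0 1).
Proof.
exists (\sum_(m <- msupp p) (p@_m *: 'X^(m 0)) *: 'X^(m 1)) => x.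
rewrite mevalE /eval2 !horner_sum; apply: eq_bigr => m _.
by rewrite hornerZ hornerXn hornerM -polyC_exp hornerC hornerZ hornerXn big2 mulrA.
Qed.

Lemma pfun_eval2 P : pfun (fun x : 'rV[K]_2 => eval2 P (x 0 0) (x 0 1)).
Proof.
apply: (pfun_eq (fun x => eval2E P _ _)); apply: pfun_sum => j; apply: pfunM.
  exact/pfunXn/pfun_coord.
apply: (@pfun_eq _ _ _ (fun x : 'rV[K]_2 => \sum_(i < size P`_j) P`_j`_i * x 0 0 ^+ i)).
  by move=> x; rewrite horner_coef.
by apply: pfun_sum => i; apply: pfunM; [apply: pfun_const | apply/pfunXn/pfun_coord].
Qed.

End Bivariate.

Section Charts.
Variable K : closedFieldType.
Hypothesis char0 : [pchar K] =i pred0.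
Variable n : nat.
Implicit Types (F : 'rV[K]_2 -> 'rV[K]_n) (u v w : 'rV[int]_2).

Definition pulled F (U : 'rV[K]_2 -> Prop) (f : 'rV[K]_2 -> K) : Prop :=
  exists p : {mpoly K[n]}, forall z, U z -> p.@[F z 0] = f z.

Definition weights F u : Prop := pulled F (@torus K) (character u).

Lemma pulled_linear F U : linear_space (pulled F U).
Proof.
split.
- by move=> f g fg [p hp]; exists p => z Uz; rewrite hp // fg.
- by exists 0 => z _; rewrite meval0.
- by move=> f g [p hp] [q hq]; exists (p + q) => z Uz; rewrite mevalD hp ?hq.
- by move=> c f [p hp]; exists (c *: p) => z Uz; rewrite mevalZ hp.
Qed.

Lemma weights0 F : weights F 0.
Proof. by exists 1 => t Tt; rewrite meval1 character0. Qed.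

Lemma weightsD F u v : weights F u -> weights F v -> weights F (u + v).
Proof. by move=> [p hp] [q hq]; exists (p * q) => t Tt; rewrite mevalM hp // hq // characterD. Qed.

(** A point of the torus gives coordinates on the variety [X] when its regular
    functions are spanned by characters: [weights F] is then the monoid of
    their exponents. *)
Definition toric_chart (X : 'rV[K]_n -> Prop) F : Prop :=
  [/\ forall t, torus t -> X (F t),
      forall p : {mpoly K[n]}, exists (I : finType) (c : I -> K) (u : I -> 'rV[int]_2),
        (forall i, c i != 0 -> weights F (u i)) /\
        forall t, torus t -> p.@[F t 0] = \sum_i c i * character (u i) t,
      forall p : {mpoly K[n]}, (forall t, torus t -> p.@[F t 0] = 0) -> forall x, X x -> p.@[x 0] = 0
    & forall u, exists v w, [/\ weights F v, weights F w & u = v - w]].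

(** The denominator of Laurent polynomials: the product of the invertible
    coordinates. *)
Definition den (r : nat) (z : 'rV[K]_2) : K := \prod_(i < 2 | (i < r)%N) z 0 i.

(** The weight of [z_0 ^ i * z_1 ^ j / den r z ^ N]. *)
Definition expo (r i j N : nat) : 'rV[int]_2 :=
  \row_(k < 2) ((if k == 0 then i else j)%:Z - (if (k < r)%N then N else 0%N)%:Z).

Lemma den_neq0 r z : group_space r z -> den r z != 0.
Proof. by move=> Uz; apply/prodf_neq0 => i; apply: Uz. Qed.

Lemma character_expo r i j N t : torus t ->
  character (expo r i j N) t = t 0 0 ^+ i * t 0 1 ^+ j / den r t ^+ N.
Proof.
move=> Tt; rewrite characterE !mxE /= !expfzDr ?Tt // !exprnN mulrACA; congr (_ * _).
rewrite /den big_mkcond big2 /= expfzMl.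
by congr (_ * _); case: ifP => _; rewrite ?exp1rz ?oppr0 ?expr0z.
Qed.

(** The element [s] of the multiplicative factor with index [k] of the group. *)
Definition unit_at (r : nat) (k : 'I_2) (s : K) : 'rV[K]_2 :=
  \row_(l < 2) (if l == k then s else if (l < r)%N then 1 else 0).

Lemma unit_atP r k s : s != 0 -> group_space r (unit_at r k s).
Proof. by move=> s0 l lr; rewrite mxE; case: ifP => // _; rewrite lr oner_neq0. Qed.

Lemma group_mul_unit_at r (k l : 'I_2) s z : (k < r)%N ->
  group_mul r (unit_at r k s) z 0 l = if l == k then s * z 0 l else z 0 l.
Proof.
move=> kr; rewrite !mxE; case: eqVneq => [->|nlk]; first by rewrite kr.
by case: (l < r)%N; rewrite ?mul1r ?add0r.
Qed.

Lemma group_mulP r (z w : 'rV[K]_2) : group_space r z -> group_space r w -> group_space r (group_mul r z w).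
Proof. by move=> Uz Uw i ir; rewrite mxE ir mulf_neq0 ?Uz ?Uw. Qed.

Lemma den_unit_at r (k : 'I_2) s z : (k < r)%N ->
  den r (group_mul r (unit_at r k s) z) = s * den r z.
Proof.
move=> kr; rewrite /den (bigD1 k) //= [in RHS](bigD1 k) //= mulrA.
rewrite group_mul_unit_at // eqxx; congr (_ * _); apply: eq_bigr => l /andP[_ lk].
by rewrite group_mul_unit_at // (negbTE lk).
Qed.

Definition stable r F : Prop := forall (p : {mpoly K[n]}) s, group_space r s ->
  exists q : {mpoly K[n]}, forall z, group_space r z -> q.@[F z 0] = p.@[F (group_mul r s z) 0].

(** Scaling the coordinate [k] is a translation by the group, and it multiplies
    the terms by distinct powers of the scalar. *)
Lemma scaling_isolates r F (k : 'I_2) d (g : nat -> 'rV[K]_2 -> K) N :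
  (k < r)%N -> stable r F ->
  (forall i s z, g i (group_mul r (unit_at r k s) z) = g i z) ->
  pulled F (group_space r) (fun z => (\sum_(i < d) z 0 k ^+ i * g i z) / den r z ^+ N) ->
  forall i, (i < d)%N -> pulled F (group_space r) (fun z => z 0 k ^+ i * g i z / den r z ^+ N).
Proof.
move=> kr st ginv [p hp] i id.
apply: (@isolate_coefficients _ char0 _ (pulled F (group_space r)) d
  (fun i z => z 0 k ^+ i * g i z / den r z ^+ N) (pulled_linear _ _) _ i id).
move=> s s0; have [q hq] := st p _ (@unit_atP r k s s0); exists (s ^+ N *: q) => z Uz.
rewrite mevalZ hq // hp; last by apply: group_mulP => //; apply: unit_atP.
rewrite den_unit_at // mulr_suml mulr_sumr; apply: eq_bigr => l _.
rewrite group_mul_unit_at // eqxx ginv exprMn exprMn invfM.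
by have sN : s ^+ N != 0 by [rewrite expf_neq0]; field; rewrite expf_neq0 ?den_neq0.
Qed.

(** A property of the charts that come from group actions: translations separate
    the monomials of a function. *)
Definition monomial_closed r F : Prop := forall p P N,
  (forall z, group_space r z -> p.@[F z 0] = eval2 P (z 0 0) (z 0 1) / den r z ^+ N) ->
  forall i j, P`_j`_i != 0 -> weights F (expo r i j N).

Lemma weights_of_monomial r F c i j N : c != 0 ->
  pulled F (group_space r) (fun z => c * (z 0 0 ^+ i * z 0 1 ^+ j) / den r z ^+ N) ->
  weights F (expo r i j N).
Proof.
move=> c0 [p hp]; exists (c^-1 *: p) => t Tt.
by rewrite mevalZ hp ?character_expo // -?mulrA ?mulKf //; apply: torus_group.
Qed.

Lemma nonzero_coef (P : {poly {poly K}}) i j : P`_j`_i != 0 ->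
  (j < size P)%N /\ (i < size (P`_j)%R)%N.
Proof.
move=> Pji; split; rewrite ltnNge; apply: contra Pji => h; apply/eqP.
  by rewrite [P`_j]nth_default ?coef0.
by rewrite nth_default.
Qed.

Lemma monomial_closed2 F : stable 2 F -> monomial_closed 2 F.
Proof.
move=> st p P N hp i j Pji; have [jP iP] := nonzero_coef Pji.
have [||q hq] := @scaling_isolates 2 F 1 (size P) (fun l z => (P`_l).[z 0 0]) N isT st _ _ j jP.
- by move=> l s z; rewrite group_mul_unit_at.
- by exists p => z Uz; rewrite hp // eval2E.
have [||q' hq'] := @scaling_isolates 2 F 0 (size P`_j)
  (fun l z => P`_j`_l * z 0 1 ^+ j) N isT st _ _ i iP.
- by move=> l s z; rewrite group_mul_unit_at.
- exists q => z Uz; rewrite hq // horner_coef mulr_sumr; congr (_ / _).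
  by apply: eq_bigr => l _; ring.
by apply: (weights_of_monomial Pji); exists q' => z Uz; rewrite hq' //; congr (_ / _); ring.
Qed.

(** In rank one the additive factor acts by translations on the coefficients
    of the powers of the multiplicative coordinate, hence these are closed
    under derivation. *)
Lemma translation_derivation F i N : stable 1 F -> forall q : {poly K},
  pulled F (group_space 1) (fun z => z 0 0 ^+ i * q.[z 0 1] / den 1 z ^+ N) ->
  pulled F (group_space 1) (fun z => z 0 0 ^+ i * q^`().[z 0 1] / den 1 z ^+ N).
Proof.
move=> st q [p hp]; have [Ae A0 AD AM] := pulled_linear F (group_space 1).
have [sq|sq] := leqP (size q) 1.
  by apply: Ae A0 => z; rewrite (size1_polyC sq) derivC horner0 mulr0 mul0r.
rewrite -nderivn1; apply: (@isolate_coefficients _ char0 _ (pulled F (group_space 1)) (size q)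
  (fun l z => z 0 0 ^+ i * q^`N(l).[z 0 1] / den 1 z ^+ N) (pulled_linear _ _) _ 1 sq) => s s0.
pose s' : 'rV[K]_2 := \row_l (if l == 0 then 1 else s).
have Us' : group_space 1 s' by move=> [[|[]]] //= lt1; rewrite mxE oner_neq0.
have [p' hp'] := st p _ Us'; exists p' => z Uz; rewrite hp' // hp; last exact: group_mulP.
have -> : den 1 (group_mul 1 s' z) = den 1 z.
  by rewrite /den big_mkcond [RHS]big_mkcond !big2 /= !mxE /= mul1r.
rewrite !mxE /= mul1r addrC nderiv_taylor; last exact: mulrC.
rewrite mulr_sumr mulr_suml; apply: eq_bigr => l _; ring.
Qed.

Lemma monomial_closed1_full F p P N : stable 1 F ->
  (forall z, group_space 1 z -> p.@[F z 0] = eval2 P (z 0 0) (z 0 1) / den 1 z ^+ N) ->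
  forall i j, P`_j`_i != 0 ->
    pulled F (group_space 1) (fun z => z 0 0 ^+ i * z 0 1 ^+ j / den 1 z ^+ N).
Proof.
move=> st hp i j Pji; have [Ae A0 AD AM] := pulled_linear F (group_space 1).
rewrite -coef_swapXY in Pji; have [iP jP] := nonzero_coef Pji.
have [||q hq] := @scaling_isolates 1 F 0 (size (swapXY P))
  (fun l z => ((swapXY P)`_l).[z 0 1]) N isT st _ _ i iP.
- by move=> l s z; rewrite group_mul_unit_at.
- by exists p => z Uz; rewrite hp // -eval2_swap eval2E.
pose V (q : {poly K}) := pulled F (group_space 1) (fun z => z 0 0 ^+ i * q.[z 0 1] / den 1 z ^+ N).
have : V 'X^j.
  apply: (derivation_stable char0 _ _ _ _ Pji).
  - by move=> q1 q2 V1 V2; apply: Ae (AD _ _ V1 V2) => z; rewrite hornerD; ring.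
  - by move=> c q1 V1; apply: Ae (AM c _ V1) => z; rewrite hornerZ; ring.
  - by move=> q1; apply: translation_derivation.
  - by exists q.
by apply: Ae => z; rewrite hornerXn.
Qed.

Lemma monomial_closed1 F : stable 1 F -> monomial_closed 1 F.
Proof.
move=> st p P N hp i j Pji; apply: (weights_of_monomial (oner_neq0 _)).
have [Ae _ _ _] := pulled_linear F (group_space 1).
by apply: Ae (monomial_closed1_full st hp Pji) => z; rewrite mul1r.
Qed.

Lemma group_space_principal r (z : 'rV[K]_2) :
  group_space r z <-> True /\ (\prod_(i < 2 | (i < r)%N) 'X_i : {mpoly K[2]}).@[z 0] != 0.
Proof.
rewrite rmorph_prod /=; split=> [h|[_ h] i ir].
  by split=> //; apply/prodf_neq0 => i ir; rewrite mevalXU h.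
by move/prodf_neq0: h => /(_ i ir); rewrite mevalXU.
Qed.

Lemma den_meval r (z : 'rV[K]_2) :
  (\prod_(i < 2 | (i < r)%N) 'X_i : {mpoly K[2]}).@[z 0] = den r z.
Proof. by rewrite rmorph_prod; apply: eq_bigr => i _; rewrite /= mevalXU. Qed.

Lemma laurent_form r (f : 'rV[K]_2 -> K) : regular (group_space r) f ->
  exists P N, forall z, group_space r z -> f z = eval2 P (z 0 0) (z 0 1) / den r z ^+ N.
Proof.
move=> rf; have [a [k ha]] := regular_principal (@full_closed K 2) (group_space_principal r) rf.
by have [P hP] := bivariate a; exists P, k => z Uz; rewrite ha // hP den_meval.
Qed.

Lemma regular_pullback r F (W : 'rV[K]_n -> Prop) (p : {mpoly K[n]}) :
  morphism (group_space r) W F -> regular (group_space r) (fun z => p.@[F z 0]).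
Proof.
by move=> mF; apply: (regular_comp (f := fun y => p.@[y 0]) mF); apply/regular_pfun/pfun_poly.
Qed.

Lemma laurent_characters r (P : {poly {poly K}}) N t : torus t ->
  eval2 P (t 0 0) (t 0 1) / den r t ^+ N =
  \sum_(ji : 'I_(size P) * 'I_(\max_(j < size P) size (P`_j)%R)%N)
    P`_ji.1`_ji.2 * character (expo r ji.2 ji.1 N) t.
Proof.
move=> Tt; set d := (\max_(j < _) _)%N; rewrite eval2E mulr_suml.
rewrite -(pair_bigA _ (fun (j : 'I_(size P)) (i : 'I_d) =>
  P`_j`_i * character (expo r i j N) t)) /=; apply: eq_bigr => j _.
rewrite (@horner_coef_wide _ d); last exact: (leq_bigmax j).
rewrite mulr_sumr mulr_suml; apply: eq_bigr => i _; rewrite character_expo //; ring.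
Qed.

Lemma chart_expansion r F (W : 'rV[K]_n -> Prop) : morphism (group_space r) W F ->
  monomial_closed r F -> forall p : {mpoly K[n]},
  exists (I : finType) (c : I -> K) (u : I -> 'rV[int]_2),
    (forall i, c i != 0 -> weights F (u i)) /\
    forall t, torus t -> p.@[F t 0] = \sum_i c i * character (u i) t.
Proof.
move=> mF mc p; have [P [N hP]] := laurent_form (regular_pullback p mF).
pose d := (\max_(j < size P) size (P`_j)%R)%N.
exists ('I_(size P) * 'I_d)%type, (fun ji : 'I_(size P) * 'I_d => P`_ji.1`_ji.2),
  (fun ji : 'I_(size P) * 'I_d => expo r ji.2 ji.1 N).
split=> [[j i] /= Pji|t Tt]; first exact: mc hP _ _ Pji.
by rewrite hP ?laurent_characters //; apply: torus_group.
Qed.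

(** The differences of weights form a group, so it is enough to find the two basis
    vectors among them. *)
Lemma weights_group F : (forall k, exists v w, [/\ weights F v, weights F w & delta_mx 0 k = v - w]) ->
  forall u, exists v w, [/\ weights F v, weights F w & u = v - w].
Proof.
move=> h; pose L u := exists v w, [/\ weights F v, weights F w & u = v - w].
have LD u u' : L u -> L u' -> L (u + u').
  move=> [v [w [Sv Sw ->]]] [v' [w' [Sv' Sw' ->]]]; exists (v + v'), (w + w').
  by split; [exact: weightsD | exact: weightsD | rewrite opprD addrACA].
have LN u : L u -> L (- u).
  by move=> [v [w [Sv Sw ->]]]; exists w, v; split; [exact: Sw | exact: Sv | rewrite opprB].
have LM u (k : int) : L u -> L (u *~ k).
  move=> Lu; have Ln i : L (u *+ i).
    elim: i => [|i IH]; [exists 0, 0 | by rewrite mulrS; apply: LD].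
    by split; [exact: weights0 | exact: weights0 | rewrite subr0].
  by case: k => k; [apply: Ln | apply/LN/Ln].
move=> u; suff -> : u = delta_mx 0 0 *~ u 0 0 + delta_mx 0 1 *~ u 0 1 by apply: LD; apply: LM; apply: h.
rewrite -!scaler_int !intz; apply/rowP => k; rewrite !mxE !eqxx /=.
by move: k; apply: I2_ind; rewrite /= ?mulr0 ?mulr1 ?addr0 ?add0r.
Qed.

End Charts.

Section ChartOfMonoid.
Variable K : closedFieldType.
Hypothesis char0 : [pchar K] =i pred0.
Variable n : nat.
Implicit Types (X : 'rV[K]_n -> Prop) (F : 'rV[K]_2 -> 'rV[K]_n).

Lemma open_dense X (h p : {mpoly K[n]}) (x0 : 'rV[K]_n) : irreducible X -> X x0 -> h.@[x0 0] != 0 ->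
  (forall x, X x -> h.@[x 0] != 0 -> p.@[x 0] = 0) -> forall x, X x -> p.@[x 0] = 0.
Proof.
move=> iX X0 h0 hp; have [x Xx|//|/(_ _ X0)/eqP] := @irreducible_mul _ _ _ p h iX.
  by have [->|hx] := eqVneq h.@[x 0] 0; [rewrite mulr0 | rewrite hp ?mul0r].
by rewrite (negbTE h0).
Qed.

Lemma eval2_torus (P : {poly {poly K}}) :
  (forall a b, a != 0 -> b != 0 -> eval2 P a b = 0) -> P = 0.
Proof.
move=> hP; have : P * ('X%:P * 'X) = 0.
  apply: eval2_eq0 => a b; rewrite !eval2M.
  have eY : eval2 'X a b = b by rewrite /eval2 hornerX hornerC.
  have eX : eval2 'X%:P a b = a by rewrite /eval2 hornerC hornerX.
  rewrite eX eY; have [->|a0] := eqVneq a 0; first by rewrite mul0r mulr0.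
  have [->|b0] := eqVneq b 0; first by rewrite !mulr0.
  by rewrite hP ?mul0r.
move/eqP; rewrite !mulf_eq0 polyX_eq0 polyC_eq0 polyX_eq0 !orbF => /eqP //.
Qed.

(** A nonconstant polynomial has a root. *)
Lemma nonvanishing_constant1 (q : {poly K}) : (forall a, q.[a] != 0) -> forall a, q.[a] = q.[0].
Proof.
move=> hq a; have [s1|/closed_rootP[z /rootP qz]] := eqVneq (size q) 1%N.
  by rewrite (size1_polyC (eq_leq s1)) !hornerC.
by have := hq z; rewrite qz eqxx.
Qed.

Lemma eval2_horner (P : {poly {poly K}}) a b : eval2 P a b = (map_poly (horner_eval a) P).[b].
Proof. by have := horner_map (horner_eval a) P b%:P; rewrite /= /horner_eval hornerC => ->. Qed.

(** The restrictions to lines parallel to the axes are constant. *)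
Lemma nonvanishing_constant2 (P : {poly {poly K}}) :
  (forall a b, eval2 P a b != 0) -> forall a b, eval2 P a b = eval2 P 0 0.
Proof.
move=> hP a b; rewrite {1}/eval2 nonvanishing_constant1; last by move=> c; apply: hP.
rewrite -/(eval2 P 0 b) !eval2_horner nonvanishing_constant1 // => c.
by rewrite -eval2_horner.
Qed.

(** Multiplication by units translates the group of units and acts on the
    polynomial functions on [X]; this makes the weights of a function again weights
    of functions.  In rank zero the polynomial that defines the complement of the
    group of units is a unit on [K^2], hence a constant, and all elements of [X]
    are invertible.  The group coordinates are fractions [p / h^m], where [h] defines
    that complement, and [h^m] has some weight; so each basis vector of the character
    lattice is a difference of weights of [h^m] and of its multiples [p]. *)
Lemma unit_parametrization_chart X mu r F G e :
  zariski_closed X -> irreducible X -> morphism2 X X X mu ->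
  (forall x y z, X x -> X y -> X z -> mu (mu x y) z = mu x (mu y z)) ->
  (forall x y, X x -> X y -> mu x y = mu y x) -> is_unit X mu e -> (r <= 2)%N ->
  unit_parametrization X mu r F G ->
  [/\ toric_chart X F, stable r F & r = 0%N -> forall x, X x -> invertible X mu x].
Proof.
move=> cX iX mmu amu cmu ue r2 [mF mG GF FG morF].
have [h hE] := units_principal cX mmu amu cmu ue.
have XF z : group_space r z -> X (F z) /\ h.@[F z 0] != 0 by move=> /mF.1/hE.
pose one : 'rV[K]_2 := const_mx 1.
have T1 : torus one by move=> i; rewrite mxE oner_neq0.
have U1 : group_space r one by apply: torus_group.
have st : stable r F.
  move=> p s Us; have [q hq] : exists q : {mpoly K[n]}, forall x, X x -> p.@[mu (F s) x 0] = q.@[x 0].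
    apply: regular_closed => //.
    have mFs := morphism2_comp (morphism_const X (XF s Us).1) (morphism_id _) mmu.
    by apply: (regular_comp (f := fun y => p.@[y 0]) mFs); apply/regular_pfun/pfun_poly.
  by exists q => z Uz; rewrite -hq ?morF //; apply: (XF z Uz).1.
have dense (p : {mpoly K[n]}) : (forall t, torus t -> p.@[F t 0] = 0) -> forall x, X x -> p.@[x 0] = 0.
  move=> hp; have [P [N hP]] := laurent_form (regular_pullback p mF).
  have P0 : P = 0.
    apply: eval2_torus => a b a0 b0; pose t : 'rV[K]_2 := \row_i (if i == 0 then a else b).
    have Tt : torus t by move=> i; rewrite mxE; case: ifP.
    have := hP t (torus_group Tt); rewrite hp // !mxE /= => /esym/eqP.
    rewrite mulf_eq0 invr_eq0 expf_eq0 (negbTE (den_neq0 (torus_group Tt))) andbF orbF.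
    by move/eqP.
  apply: (open_dense iX (XF _ U1).1 (XF _ U1).2) => x Xx hx.
  have Ux : invertible X mu x by apply/hE.
  rewrite -(FG x Ux) hP; last exact: mG.1.
  by rewrite P0 /eval2 !horner0 mul0r.
have all0 : r = 0%N -> forall x, X x -> invertible X mu x.
  move=> r0; have [P [N hP]] := laurent_form (regular_pullback h mF).
  have U (z : 'rV[K]_2) : group_space r z by move=> i; rewrite r0.
  have hF z : h.@[F z 0] = eval2 P (z 0 0) (z 0 1).
    rewrite hP // (_ : den r z = 1) ?expr1n ?divr1 // /den big1 // => i.
    by rewrite r0.
  have hc z : h.@[F z 0] = eval2 P 0 0.
    rewrite hF; apply: nonvanishing_constant2 => a b.
    have := (XF (\row_i (if i == 0 then a else b)) (U _)).2.
    by rewrite hF !mxE.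
  have := dense (h - (eval2 P 0 0)%:MP) => hd x Xx; apply/hE; split=> //.
  have /eqP : (h - (eval2 P 0 0)%:MP).@[x 0] = 0.
    by apply: hd => // t _; rewrite mevalB hc mevalC subrr.
  by rewrite mevalB mevalC subr_eq0 => /eqP ->; rewrite -(hc one) (XF _ U1).2.
have mc : monomial_closed r F.
  case: r r2 mF mG GF FG morF XF U1 st dense all0 => [|[|[|//]]] _ mF mG GF FG morF XF U1 st dense all0.
  - move=> p P N _ i j _.
    have /fin_all_exists[q hq] k : exists q : {mpoly K[n]}, forall x, X x -> G x 0 k = q.@[x 0].
      apply: regular_closed => //; apply: (morphism_sub _ mG).2 => x Xx; exact: all0.
    exists (q 0 ^+ i * q 1 ^+ j) => t Tt.
    have XFt := (XF t (torus_group Tt)).1.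
    rewrite character_expo // mevalM !rmorphXn /= -!hq // GF; last exact: torus_group.
    by rewrite /den big1 // expr1n divr1.
  - exact: monomial_closed1.
  - exact: monomial_closed2.
split=> //; split=> //.
- by move=> t Tt; apply: (XF t (torus_group Tt)).1.
- exact: chart_expansion mF mc.
apply: weights_group => k.
have [p [m hp]] := regular_principal cX hE (mG.2 k).
have [P [N hP]] := laurent_form (regular_pullback (h ^+ m) mF).
have [[i [j Pji]]|P0] := classic (exists i j, P`_j`_i != 0); last first.
  have := hP one U1; rewrite (_ : P = 0) /eval2 ?horner0 ?mul0r ?rmorphXn => [/eqP|].
    by rewrite (negbTE (expf_neq0 _ (XF _ U1).2)).
  apply/polyP => j; apply/polyP => i; rewrite !coef0; apply/eqP.
  by apply: contraT => Pji; case: P0; exists i, j.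
exists (expo r (i + (k == 0)) (j + (k == 1)) N), (expo r i j N); split; last first.
- apply/rowP => l; rewrite !mxE eqxx /=; move: k l {hp}; apply: I2_ind; apply: I2_ind => /=;
  by rewrite ?addn0 ?addn1; case: (_ < r)%N; lia.
- exact: mc hP _ _ Pji.
pose Q := P * (if k == 0 then 'X%:P else 'X).
apply: (mc p Q N) => [z Uz|].
  have Ux : invertible X mu (F z) by apply: mF.1.
  have hz := hp _ Ux; rewrite GF // in hz.
  have -> : p.@[F z 0] = z 0 k * (h ^+ m).@[F z 0].
    by rewrite hz rmorphXn divfK // expf_neq0 //; apply: (XF z Uz).2.
  rewrite hP // /Q eval2M; move: k {hp hz Q}; apply: I2_ind; rewrite /eval2 /= ?hornerX ?hornerC ?hornerX; ring.
rewrite /Q; move: k {hp Q}; apply: I2_ind; rewrite /= ?addn0 ?addn1.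
  by rewrite coefMC coefMX.
by rewrite coefMX.
Qed.

End ChartOfMonoid.

(** * Charts and toric structures *)

Section RootsOfUnity.
Variable K : closedFieldType.
Hypothesis char0 : [pchar K] =i pred0.

Lemma primitive_root_exists N : (0 < N)%N -> exists z : K, N.-primitive_root z.
Proof.
move=> N0; pose p : {poly K} := 'X^N - 1; have [rs Dp] := closed_field_poly_normal p.
rewrite (monicP _) ?monicXnsubC // scale1r in Dp.
have rs1 : all N.-unity_root rs by apply/allP => z; rewrite -root_prod_XsubC -Dp.
have sz : (N < (size rs).+1)%N by rewrite -(size_prod_XsubC rs id) -Dp size_XnsubC.
have [|z] := hasP (cyclic.has_prim_root N0 rs1 _ sz); last by exists z.
rewrite -separable.separable_prod_XsubC -Dp cyclotomic.separable_Xn_sub_1 //.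
by rewrite natr_eq0 // -lt0n.
Qed.

(** The case [N = 0] is included so that [N] can be the generator of any proper
    subgroup of the integers. *)
Lemma nontrivial_root N : N != 1%N -> exists z : K, [/\ z != 0, z != 1 & z ^+ N = 1].
Proof.
case: N => [|[//|N]] _.
  exists 2%:R; rewrite natr_eq0 // expr0; split=> //.
  by apply/eqP => /(@natr_inj _ char0 2 1).
have [z pz] := @primitive_root_exists N.+2 isT; have zN := prim_expr_order pz.
exists z; split=> //.
  by apply/eqP => z0; move: zN; rewrite z0 expr0n => /eqP; rewrite eq_sym oner_eq0.
by have := eq_prim_root_expr pz 1 0; rewrite expr1 expr0 => ->; rewrite eqn_mod_dvd.
Qed.

End RootsOfUnity.

Section Subgroups.

Lemma nat_min (P : nat -> Prop) : (exists k, P k) -> exists k, P k /\ forall l, (l < k)%N -> ~ P l.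
Proof.
case=> k; have [m km] := ubnP k; elim: m k km => // m IH k km Pk.
have [[l [lk Pl]]|h] := classic (exists l, (l < k)%N /\ P l).
  by apply: IH Pl; apply: leq_trans lk _.
by exists k; split=> // l lk Pl; apply: h; exists l.
Qed.

Lemma int_subgroup (H : int -> Prop) : H 0 -> (forall a b, H a -> H b -> H (a - b)) ->
  exists g : nat, forall a, H a <-> (g%:Z %| a)%Z.
Proof.
move=> H0 HB; have HN a : H a -> H (- a) by move=> /(HB _ _ H0); rewrite sub0r.
have HD a b : H a -> H b -> H (a + b) by move=> Ha /HN Hb; have := HB _ _ Ha Hb; rewrite opprK.
have HM a (k : int) : H a -> H (k * a).
  move=> Ha; have Hn m : H (m%:Z * a).
    by elim: m => [|m IH]; rewrite ?mul0r // -addn1 PoszD mulrDl mul1r; apply: HD.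
  by case: k => k; [apply: Hn | rewrite NegzE mulNr; apply/HN/Hn].
have [[g [[g0 Hg] gmin]]|none] := classic (exists k, ((0 < k)%N /\ H k%:Z) /\ forall l, (l < k)%N -> ~ ((0 < l)%N /\ H l%:Z)).
  exists g => a; split=> [Ha|/dvdzP[k ->]]; last exact: HM.
  have Hr : H (a %% g%:Z)%Z.
    by have := HB _ _ Ha (HM _ (a %/ g%:Z)%Z Hg); rewrite {1}(divz_eq a g%:Z) addrAC subrr add0r.
  have r0 : 0 <= (a %% g%:Z)%Z by rewrite modz_ge0 //; lia.
  have rg : (a %% g%:Z)%Z < g%:Z by apply: ltz_pmod; lia.
  apply/dvdz_mod0P; case: (a %% g%:Z)%Z Hr r0 rg => // r Hr _ rg.
  have [->//|rn0] := eqVneq r 0%N.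
  by case: (gmin r) => //; split=> //; rewrite lt0n.
exists 0%N => a; rewrite dvd0z; split=> [Ha|/eqP->//].
apply: contraT => a0; case: none; apply: nat_min.
exists `|a|%N; split; first by rewrite absz_gt0.
by case: (lerP 0 a) => ha; [rewrite gez0_abs | rewrite ltz0_abs //; apply: HN].
Qed.

(** The projection of [L] to the second factor, and the intersection with the first
    factor, are subgroups [g Z] and [d Z] of the integers; a root of unity of order
    dividing [g], or [d], other than 1 gives a point of the torus on which [L]
    is trivial. *)
Lemma annihilated_subgroup (K : closedFieldType) (char0 : [pchar K] =i pred0)
    (L : 'rV[int]_2 -> Prop) :
  L 0 -> (forall u v, L u -> L v -> L (u - v)) ->
  (forall t : 'rV[K]_2, torus t -> (forall u, L u -> character u t = 1) -> t = torus_one K) ->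
  forall u, L u.
Proof.
move=> L0 LB ann; pose vec (a b : int) : 'rV[int]_2 := \row_i (if i == 0 then a else b).
have vecE (u : 'rV[int]_2) : u = vec (u 0 0) (u 0 1).
  by apply/rowP; apply: I2_ind; rewrite mxE.
have vecB a b c d : vec a b - vec c d = vec (a - c) (b - d).
  by apply/rowP; apply: I2_ind; rewrite !mxE.
have vec0 : vec 0 0 = 0 by apply/rowP; apply: I2_ind; rewrite !mxE.
have LN u : L u -> L (- u) by move=> /(LB _ _ L0); rewrite sub0r.
have LD u v : L u -> L v -> L (u + v) by move=> Lu /LN Lv; have := LB _ _ Lu Lv; rewrite opprK.
have LM u (k : int) : L u -> L (k *: u).
  move=> Lu; have Ln m : L (m%:Z *: u).
    by elim: m => [|m IH]; rewrite ?scale0r // intS scalerDl scale1r; apply: LD.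
  by case: k => k; [apply: Ln | rewrite NegzE scaleNr; apply/LN/Ln].
have [|a b [x Lx] [y Ly]|g hg] := @int_subgroup (fun b => exists a, L (vec a b)).
- by exists 0; rewrite vec0.
- by exists (x - y); rewrite -vecB; apply: LB.
have g1 : g = 1%N.
  apply/eqP/contraT => /(nontrivial_root char0)[z [z0 z1 zg]].
  pose t : 'rV[K]_2 := \row_i (if i == 0 then 1 else z).
  have /rowP/(_ 1) : t = torus_one K.
    apply: ann => [i|u Lu]; first by rewrite mxE; case: ifP; rewrite ?oner_neq0.
    have /dvdzP[k E] : (g%:Z %| (u 0 1)%R)%Z by apply/hg; exists (u 0 0); rewrite -vecE.
    by rewrite characterE !mxE /= exp1rz mul1r E mulrC -exprz_exp -exprnP zg exp1rz.
  by rewrite !mxE /= => /eqP; rewrite (negbTE z1).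
have [a La] : exists a, L (vec a 1) by apply/hg; rewrite g1.
have [|b c|d hd] := @int_subgroup (fun b => L (vec b 0)); first by rewrite vec0.
  by move=> Lb Lc; rewrite -[0]subr0 -vecB; apply: LB.
have proj u : L u -> L (vec (u 0 0 - u 0 1 * a) 0).
  move=> Lu; have := LB _ _ Lu (LM _ (u 0 1) La); congr L; rewrite {1}(vecE u).
  by apply/rowP; apply: I2_ind; rewrite !mxE /= ?mulr1 ?subrr.
have d1 : d = 1%N.
  apply/eqP/contraT => /(nontrivial_root char0)[z [z0 z1 zd]].
  pose t : 'rV[K]_2 := \row_i (if i == 0 then z else z ^ (- a)).
  have /rowP/(_ 0) : t = torus_one K.
    apply: ann => [i|u Lu]; first by rewrite mxE; case: ifP; rewrite ?expfz_neq0.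
    have /dvdzP[k E] : (d%:Z %| (u 0 0 - u 0 1 * a)%R)%Z by apply/hd/proj.
    rewrite characterE !mxE /= exprz_exp -expfzDr //.
    have -> : u 0 0 + - a * u 0 1 = d%:Z * k by rewrite mulNr (mulrC a) E mulrC.
    by rewrite -exprz_exp -exprnP zd exp1rz.
  by rewrite !mxE /= => /eqP; rewrite (negbTE z1).
move=> u; have -> : u = u 0 1 *: vec a 1 + vec (u 0 0 - u 0 1 * a) 0.
  by apply/rowP; apply: I2_ind; rewrite !mxE /= ?mulr1 ?addr0 // addrC subrK.
by apply: LD; [apply: LM | apply/hd; rewrite d1].
Qed.

End Subgroups.

Section ToricStructures.
Variable K : closedFieldType.
Hypothesis char0 : [pchar K] =i pred0.
Variable n : nat.
Implicit Types (X : 'rV[K]_n -> Prop) (F : 'rV[K]_2 -> 'rV[K]_n) (act : 'rV[K]_2 -> 'rV[K]_n -> 'rV[K]_n).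

Lemma chart_eq X F f g : toric_chart X F -> pfun f -> pfun g ->
  (forall t, torus t -> f (F t) = g (F t)) -> forall x, X x -> f x = g x.
Proof.
move=> [_ _ dense _] [p hp] [q hq] fg x Xx; apply/eqP; rewrite -subr_eq0 hp hq -mevalB.
by apply/eqP; apply: dense Xx => t Tt; rewrite mevalB -hp -hq fg // subrr.
Qed.

Lemma group_mul2 (s t : 'rV[K]_2) : group_mul 2 s t = torus_mul s t.
Proof. by apply/rowP => i; rewrite !mxE ltn_ord. Qed.

(** The orbit map of the base point is a chart: the translates by the torus
    isolate the characters that occur in a regular function, and the weights
    generate the character lattice because the action is effective. *)
Lemma toric_structure_chart X act x0 : zariski_closed X -> irreducible X ->
  toric_structure X act x0 -> toric_chart X (fun t => act t x0).
Proof.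
move=> cX iX [[mact act1 actM] eff X0 [S orbS]]; set F := fun t => act t x0.
have mF : morphism (@torus K) X F.
  exact: (morphism2_comp (morphism_id _) (morphism_const _ X0) mact).
have mF2 : morphism (group_space 2) X F by apply: (morphism_sub _ mF) => z /group_space2.
have XF t : torus t -> X (F t) by apply: mF.1.
have actp (p : {mpoly K[n]}) s : torus s -> exists q : {mpoly K[n]}, forall x, X x -> p.@[act s x 0] = q.@[x 0].
  move=> Ts; apply: regular_closed => //.
  have ms := morphism2_comp (morphism_const X Ts) (morphism_id _) mact.
  by apply: (regular_comp (f := fun y => p.@[y 0]) ms); apply/regular_pfun/pfun_poly.
have st : stable 2 F.
  move=> p s /group_space2 Ts; have [q hq] := actp p s Ts.
  exists q => z /group_space2 Tz; rewrite -hq; last exact: XF.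
  by rewrite group_mul2 /F actM.
have exps := chart_expansion mF2 (monomial_closed2 char0 st).
have dense (p : {mpoly K[n]}) : (forall t, torus t -> p.@[F t 0] = 0) -> forall x, X x -> p.@[x 0] = 0.
  move=> hp; have [_ nz] : X x0 /\ ~ zero_locus S x0.
    by apply/orbS; exists (torus_one K); [apply: torus_oneP | rewrite act1].
  have [h nh] := not_all_ex_not _ _ nz; have [Sh h0] := imply_to_and _ _ nh.
  apply: (open_dense iX X0 (h := h)); first exact/eqP.
  move=> x Xx hx; have [t Tt ->] : exists2 t, torus t & x = act t x0.
    by apply/orbS; split=> // z; move: hx; rewrite z ?eqxx.
  exact: hp.
split=> //.
have L0 : exists v w, [/\ weights F v, weights F w & 0 = v - w].
  by exists 0, 0; split; [exact: weights0 | exact: weights0 | rewrite subr0].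
apply: (annihilated_subgroup char0 L0) => [u u' [v [w [Sv Sw ->]]] [v' [w' [Sv' Sw' ->]]]|t Tt ann].
  exists (v + w'), (w + v'); split; [exact: weightsD | exact: weightsD | by rewrite opprB opprD addrACA].
apply: (eff t Tt) => x Xx; apply/rowP => j.
have [q hq] := actp 'X_j t Tt.
have hq' y : X y -> act t y 0 j = q.@[y 0] by move=> Xy; rewrite -hq // mevalXU.
rewrite hq' //; apply/eqP; rewrite -subr_eq0 -(mevalXU (x 0) j) -mevalB; apply/eqP.
apply: dense Xx => s Ts; rewrite mevalB -hq'; last exact: XF.
have -> : act t (F s) = F (torus_mul t s) by rewrite /F actM.
have [I [c [u [cu E]]]] := exps 'X_j; rewrite -(mevalXU (F (torus_mul t s) 0) j).
rewrite !E //; last exact: torus_mulP.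
rewrite -sumrB big1 // => i _; have [->|ci] := eqVneq (c i) 0; first by rewrite !mul0r subrr.
rewrite character_mul ann ?mul1r ?subrr //.
by exists (u i), 0; split; [exact: cu | exact: weights0 | rewrite subr0].
Qed.

Lemma chart_polynomials X F : toric_chart X F -> forall p : {mpoly K[n]},
  exists (I : finType) (c : I -> K) (u : I -> 'rV[int]_2) (g : I -> {mpoly K[n]}),
  [/\ forall i, c i != 0 -> forall t, torus t -> (g i).@[F t 0] = character (u i) t,
      forall t, torus t -> p.@[F t 0] = \sum_i c i * character (u i) t
    & forall x, X x -> p.@[x 0] = \sum_i c i * (g i).@[x 0]].
Proof.
move=> chX p; have [_ exps dense _] := chX; have [I [c [u [cu E]]]] := exps p.
have /fin_all_exists[g hg] i : exists g : {mpoly K[n]}, c i != 0 -> forall t, torus t -> g.@[F t 0] = character (u i) t.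
  have [c0|c0] := classic (c i != 0); last by exists 0 => /c0.
  by have [g hg] := cu i c0; exists g.
exists I, c, u, g; split=> //.
apply: (chart_eq chX (pfun_poly p)).
  by apply: pfun_sum => i; apply: pfunM; [apply: pfun_const | apply: pfun_poly].
move=> t Tt; rewrite E //; apply: eq_bigr => i _.
by have [->|ci] := eqVneq (c i) 0; [rewrite !mul0r | rewrite hg].
Qed.

(** The coordinates of the torus are quotients [V k / W k] of weight functions; where
    none of these vanishes, the quotients are the coordinates of a preimage. *)
Lemma chart_open X F : zariski_closed X -> toric_chart X F ->
  exists h : {mpoly K[n]}, forall x, X x /\ h.@[x 0] != 0 <-> exists2 t, torus t & x = F t.
Proof.
move=> cX chX; have [XF exps dense gen] := chX.
have /fin_all_exists[V /fin_all_exists[W hVW]] (k : 'I_2) : exists V W : {mpoly K[n]},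
    exists v w, [/\ forall t, torus t -> V.@[F t 0] = character v t,
      forall t, torus t -> W.@[F t 0] = character w t & delta_mx 0 k = v - w].
  by have [v [w [[V hV] [W hW] E]]] := gen (delta_mx 0 k); exists V, W, v, w.
have VW k t : torus t -> [/\ (V k).@[F t 0] != 0, (W k).@[F t 0] != 0 & (V k).@[F t 0] = t 0 k * (W k).@[F t 0]].
  move=> Tt; have [v [w [hV hW E]]] := hVW k; rewrite hV // hW //; split; try exact: character_neq0.
  have -> : v = delta_mx 0 k + w by rewrite E subrK.
  rewrite characterD //; congr (_ * _); rewrite characterE !mxE eqxx /=.
  by move: k {hV hW E hVW}; apply: I2_ind; rewrite /= ?expr0z ?expr1z ?mulr1 ?mul1r.
exists (\prod_k (V k * W k)) => x; rewrite rmorph_prod; split=> [[Xx /prodf_neq0 hx]|[t Tt ->]]; last first.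
  split; first exact: XF.
  by apply/prodf_neq0 => k _; have [v0 w0 _] := VW k t Tt; rewrite /= mevalM mulf_neq0.
have nz k : (V k).@[x 0] != 0 /\ (W k).@[x 0] != 0.
  by have := hx k isT; rewrite /= mevalM mulf_eq0 negb_or => /andP.
pose t : 'rV[K]_2 := \row_k ((V k).@[x 0] / (W k).@[x 0]).
have Tt : torus t.
  by move=> k; rewrite mxE mulf_neq0 ?invr_eq0; have [] := nz k.
exists t => //.
(* A weight function is a monomial in the [V k] and [W k] and their inverses, on
   the orbit and hence everywhere. *)
have key u (g : {mpoly K[n]}) : (forall s, torus s -> g.@[F s 0] = character u s) -> g.@[x 0] = character u t.
  move=> hg; pose num k (z : int) := if z is Posz i then V k ^+ i else W k ^+ `|z|.
  pose dn k (z : int) := if z is Posz i then W k ^+ i else V k ^+ `|z|.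
  have rel : g.@[x 0] * \prod_k (dn k (u 0 k)).@[x 0] = \prod_k (num k (u 0 k)).@[x 0].
    apply: (chart_eq chX (f := fun x => g.@[x 0] * \prod_k (dn k (u 0 k)).@[x 0])
      (g := fun x => \prod_k (num k (u 0 k)).@[x 0])) Xx.
    - by apply: pfunM; [apply: pfun_poly | apply: pfun_prod => k; apply: pfun_poly].
    - by apply: pfun_prod => k; apply: pfun_poly.
    move=> s Ts; rewrite hg // /character -big_split; apply: eq_bigr => k _ /=.
    have [v0 w0 E] := VW k s Ts; case: (u 0 k) => i; rewrite /num /dn !rmorphXn /= E exprMn //.
    by rewrite NegzE -exprnN mulKf // expf_neq0 // Ts.
  have dn0 k : (dn k (u 0 k)).@[x 0] != 0.
    by have [v0 w0] := nz k; rewrite /dn; case: (u 0 k) => i; rewrite rmorphXn expf_neq0.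
  apply: (@mulIf _ (\prod_k (dn k (u 0 k)).@[x 0])); first by apply/prodf_neq0 => k _.
  rewrite rel /character -big_split; apply: eq_bigr => k _; rewrite mxE /=.
  have [v0 w0] := nz k; rewrite /num /dn; case: (u 0 k) => i; rewrite !rmorphXn /=.
    by rewrite -exprnP expr_div_n divfK // expf_neq0.
  by rewrite NegzE -exprnN expr_div_n invf_div divfK // expf_neq0.
apply/rowP => j; rewrite -(mevalXU (x 0) j) -(mevalXU (F t 0) j).
have [I [c [u [g [hg -> // ->//]]]]] := chart_polynomials chX 'X_j.
apply: eq_bigr => i _; have [->|ci] := eqVneq (c i) 0; first by rewrite !mul0r.
by rewrite (key (u i)) //; apply: hg.
Qed.

(** The torus scales the weight functions; the coordinate functions being sums of
    weight functions, this extends the translations of the torus to [X]. *)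
Lemma toric_of_chart X F : zariski_closed X -> toric_chart X F -> toric X.
Proof.
move=> cX chX; have [XF exps dense gen] := chX.
have /fin_all_exists[I /fin_all_exists[c /fin_all_exists[u /fin_all_exists[g hg]]]] (j : 'I_n) :=
  chart_polynomials chX 'X_j.
pose act (t : 'rV[K]_2) (x : 'rV[K]_n) : 'rV[K]_n :=
  \row_j \sum_i c j i * character (u j i) t * (g j i).@[x 0].
have actF t s : torus t -> torus s -> act t (F s) = F (torus_mul t s).
  move=> Tt Ts; apply/rowP => j; have [hg1 hg2 _] := hg j.
  rewrite mxE -(mevalXU (F (torus_mul t s) 0) j) hg2; last exact: torus_mulP.
  apply: eq_bigr => i _; have [->|ci] := eqVneq (c j i) 0; first by rewrite !mul0r.
  by rewrite hg1 // character_mul mulrA.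
have pact t j : pfun (fun x => act t x 0 j).
  apply: (@pfun_eq _ _ _ (fun x => \sum_i c j i * character (u j i) t * (g j i).@[x 0])).
    by move=> x; rewrite mxE.
  by apply: pfun_sum => i; apply: pfunM; [apply: pfun_const | apply: pfun_poly].
have Xact t x : torus t -> X x -> X (act t x).
  move=> Tt Xx; have [S XS] := cX; apply/XS => p Sp.
  apply: (chart_eq chX (pfun_comp_row p (pact t)) (pfun_const _ 0)) Xx => s Ts.
  rewrite actF //; have /XS h : X (F (torus_mul t s)) by apply/XF/torus_mulP.
  exact: h.
have act_eq (A B : 'rV[K]_n -> 'rV[K]_n) : (forall j, pfun (fun x => A x 0 j)) ->
    (forall j, pfun (fun x => B x 0 j)) -> (forall t, torus t -> A (F t) = B (F t)) ->
    forall x, X x -> A x = B x.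
  move=> pA pB AB x Xx; apply/rowP => j; apply: (chart_eq chX (pA j) (pB j)) Xx => t Tt.
  by rewrite AB.
have mul1 (s : 'rV[K]_2) : torus_mul (torus_one K) s = s.
  by apply/rowP => i; rewrite !mxE mul1r.
have T1 := torus_oneP K.
have [h hE] := chart_open cX chX.
exists act, (F (torus_one K)); split; first split.
- split=> [z [Tz Xz]|j]; first exact: Xact.
  apply: (@regular_eq _ _ _ _ (fun z => \sum_i c j i * character (u j i) (lsubmx z) * (g j i).@[rsubmx z 0])).
    by move=> z _; rewrite mxE.
  move=> z Vz; apply: reg_at_sum => i; apply: reg_atM; last first.
    by apply/reg_at_pfun/pfun_comp_row => l; apply: pfun_rsubmx.
  apply: reg_atM; first exact: reg_at_const.
  apply: reg_at_prod => k; apply: (reg_atXz Vz); first by right; apply: Vz.1.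
  exact/reg_at_pfun/pfun_lsubmx.
- apply: (act_eq (act (torus_one K)) id (pact _)).
    by move=> j; apply: pfun_coord.
  by move=> t Tt; rewrite actF // mul1.
- move=> s t x Ts Tt; apply: (act_eq (act (torus_mul s t)) (fun x => act s (act t x)) (pact _)).
    move=> j; have [p hp] := pact s j; apply: (pfun_eq (fun x => hp (act t x))).
    exact: pfun_comp_row.
  move=> r Tr; rewrite !actF //; try exact: torus_mulP.
  by congr F; apply/rowP => i; rewrite !mxE mulrA.
- move=> t Tt fixt; apply/rowP => k.
  have S1 w : weights F w -> character w t = 1.
    move=> [p hp]; rewrite -hp //.
    have -> : F t = F (torus_one K).
      rewrite -[RHS](fixt _ (XF _ T1)) actF //; congr F.
      by apply/rowP => i; rewrite !mxE mulr1.
    by rewrite hp // characterE !mxE !exp1rz mulr1.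
  have [v [w [Sv Sw E]]] := gen (delta_mx 0 k).
  have : character (delta_mx 0 k) t = 1.
    by rewrite E characterD // characterN // !S1 // invr1 mulr1.
  rewrite mxE characterE !mxE eqxx /=.
  by move: k {E}; apply: I2_ind; rewrite /= ?expr0z ?expr1z ?mulr1 ?mul1r.
- exact: XF.
exists (fun f => f = h) => x; split.
  move=> [t Tt ->]; rewrite actF //.
  have [Xx hx] : X (F (torus_mul t (torus_one K))) /\ h.@[F (torus_mul t (torus_one K)) 0] != 0.
    by apply/hE; exists (torus_mul t (torus_one K)) => //; apply: torus_mulP.
  by split=> // z; move: hx; rewrite z ?eqxx.
move=> [Xx nz]; have /hE[t Tt ->] : X x /\ h.@[x 0] != 0.
  by split=> //; apply/eqP => hx; apply: nz => f ->.
exists t => //; rewrite actF //; congr F; apply/rowP => i; rewrite !mxE mulr1 //.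
Qed.

End ToricStructures.

(** * The weight monoid of a chart *)

Section Weights.
Variable K : closedFieldType.
Variable n : nat.
Implicit Types (X : 'rV[K]_n -> Prop) (F : 'rV[K]_2 -> 'rV[K]_n) (u v w : 'rV[int]_2).

(** Linear independence of characters: after multiplication by a common denominator
    it is the uniqueness of the coefficients of a polynomial. *)
Lemma character_occurs (I : finType) (c : I -> K) (v : I -> 'rV[int]_2) u :
  (forall t : 'rV[K]_2, torus t -> character u t = \sum_i c i * character (v i) t) ->
  exists2 i, c i != 0 & v i = u.
Proof.
move=> huv; pose M := (\sum_k absz (u 0%R k) + \sum_i \sum_k absz (v i 0%R k))%N.
pose e w k := absz (w 0 k + M%:Z).
have eE w k : (absz (w 0%R k) <= M)%N -> (e w k)%:Z = w 0 k + M%:Z.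
  by move=> h; rewrite /e gez0_abs //; lia.
have uM k : (absz (u 0%R k) <= M)%N by rewrite /M (bigD1 k) //= -addnA leq_addr.
have vM i k : (absz (v i 0%R k) <= M)%N.
  apply: leq_trans (leq_addl _ _); rewrite (bigD1 i) //= (bigD1 k) //=.
  by rewrite -addnA leq_addr.
pose P : {poly {poly K}} :=
  \sum_i (c i *: 'X^(e (v i) 0)) *: 'X^(e (v i) 1) - 'X^(e u 0) *: 'X^(e u 1).
have ev (a b d : K) k l : eval2 ((d *: 'X^k) *: 'X^l) a b = d * (a ^+ k * b ^+ l).
  by rewrite /eval2 hornerZ hornerXn hornerM -polyC_exp hornerC hornerZ hornerXn mulrA.
have shift w (a b : K) : a != 0 -> b != 0 -> (forall k, (absz (w 0%R k) <= M)%N) ->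
    a ^+ e w 0 * b ^+ e w 1 = character w (\row_i (if i == 0 then a else b)) * (a * b) ^+ M.
  move=> a0 b0 wM; rewrite characterE !mxE /= exprMn mulrACA.
  by congr (_ * _); rewrite exprnP eE // expfzDr // exprnP.
have /eval2_torus P0 : forall a b, a != 0 -> b != 0 -> eval2 P a b = 0.
  move=> a b a0 b0; rewrite /P -['X^(e u 0)]scale1r /eval2 hornerD hornerN hornerD hornerN.
  rewrite -!/(eval2 _ a b) ev mul1r shift //.
  rewrite /eval2 !horner_sum huv; last by move=> i; rewrite mxE; case: ifP.
  rewrite mulr_suml -sumrB big1 // => i _.
  by rewrite -/(eval2 _ a b) ev shift // mulrA subrr.
apply: NNPP => none; have := congr1 (fun Q : {poly {poly K}} => Q`_(e u 1)`_(e u 0)) P0.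
rewrite /P /= !coef0 coefB coef_sum coefB coef_sum.
rewrite coefZ coefXn eqxx mulr1 coefXn eqxx big1 => [|i _].
  by move/eqP; rewrite sub0r oppr_eq0 oner_eq0.
rewrite coefZ coefXn; have [E1|_] := eqVneq (e u 1) (e (v i) 1); last by rewrite mulr0 coef0.
rewrite mulr1 coefZ coefXn; have [E0|_] := eqVneq (e u 0) (e (v i) 0); last by rewrite mulr0.
rewrite mulr1; apply/eqP; apply: contraT => ci; case: none; exists i => //.
apply/rowP; apply: I2_ind; apply: (addIr M%:Z).
  by rewrite -!eE // E0.
by rewrite -!eE // E1.
Qed.

(** Normality makes the weight monoid saturated: a character is a quotient of
    two regular functions, and it is integral if one of its powers is regular. *)
Lemma weights_saturated X F u k : normal_affine X -> toric_chart X F ->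
  weights F (u *+ k.+1) -> weights F u.
Proof.
move=> nX chX [g hg]; have [XF _ dense gen] := chX.
have [v [w [[a ha] [b hb] E]]] := gen u.
have T1 := torus_oneP K.
have [||x Xx bx|f hf] := nX a b ('X^(k.+1) - g%:P).
- by exists (F (torus_one K)); split; [apply: XF | rewrite hb // character_neq0].
- exact: monicXnsubC.
- rewrite rmorphB /= map_polyXn map_polyC /= hornerD hornerN hornerXn hornerC expr_div_n.
  apply/eqP; rewrite subr_eq0; apply/eqP; apply: (mulIf (expf_neq0 k.+1 bx)).
  rewrite divfK ?expf_neq0 //.
  have : forall x, X x -> a.@[x 0] ^+ k.+1 = g.@[x 0] * b.@[x 0] ^+ k.+1.
    apply: (chart_eq chX); first exact/pfunXn/pfun_poly.
      by apply: pfunM; [apply: pfun_poly | apply/pfunXn/pfun_poly].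
    move=> t Tt; rewrite ha // hg // hb // characterMn // -exprMn -characterD //.
    by rewrite E subrK.
  by apply.
exists f => t Tt; rewrite -hf; [|exact: XF | by rewrite hb // character_neq0].
by rewrite ha // hb // E characterD // characterN.
Qed.

Definition char_span (B : 'rV[int]_2 -> Prop) (f : 'rV[K]_2 -> K) : Prop :=
  exists (I : finType) (c : I -> K) (v : I -> 'rV[int]_2),
    (forall i, B (v i)) /\ forall t, torus t -> f t = \sum_i c i * character (v i) t.

Lemma char_span_const B c : B 0 -> char_span B (fun=> c).
Proof.
exists unit, (fun=> c), (fun=> 0); split=> // t Tt.
by rewrite big_const card_unit /= addr0 character0 mulr1.
Qed.

Lemma char_spanD B f g : char_span B f -> char_span B g -> char_span B (fun t => f t + g t).
Proof.
move=> [I [c [v [Bv hf]]]] [J [d [w [Bw hg]]]]; exists (I + J)%type.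
exists (fun i => match i with inl i => c i | inr i => d i end).
exists (fun i => match i with inl i => v i | inr i => w i end).
by split=> [[i|i]|t Tt]; [exact: Bv | exact: Bw | rewrite big_sumType hf ?hg].
Qed.

Lemma char_spanM B f g : (forall u v, B u -> B v -> B (u + v)) ->
  char_span B f -> char_span B g -> char_span B (fun t => f t * g t).
Proof.
move=> BD [I [c [v [Bv hf]]]] [J [d [w [Bw hg]]]]; exists (I * J)%type.
exists (fun ij => c ij.1 * d ij.2), (fun ij => v ij.1 + w ij.2).
split=> [ij|t Tt]; first exact: BD.
rewrite hf ?hg // big_distrlr /= pair_big /=; apply: eq_bigr => ij _.
by rewrite characterD // mulrACA.
Qed.

Lemma char_span_eq B f g : (forall t, torus t -> f t = g t) -> char_span B g -> char_span B f.
Proof. by move=> fg [I [c [v [Bv hg]]]]; exists I, c, v; split=> // t Tt; rewrite fg ?hg. Qed.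

(** Generators are the weights that occur in the coordinate functions: a weight
    function is a polynomial in these, and its character occurs in the expansion. *)
Lemma weights_finitely_generated X F : toric_chart X F ->
  exists (J : finType) (g : J -> 'rV[int]_2), (forall j, weights F (g j)) /\
    forall u, weights F u -> exists k : J -> nat, u = \sum_j g j *+ k j.
Proof.
move=> chX; have [_ exps _ _] := chX.
have /fin_all_exists[I /fin_all_exists[c /fin_all_exists[v hv]]] (l : 'I_n) := exps 'X_l.
pose J := {l : 'I_n & I l}.
pose g (j : J) := if c (tag j) (tagged j) == 0 then 0 else v (tag j) (tagged j).
exists J, g; split=> [[l i]|u [p hp]].
  by rewrite /g /=; case: eqVneq => [_|ci]; [apply: weights0 | apply: (hv l).1].
pose B w := exists k : J -> nat, w = \sum_j g j *+ k j.
have B0 : B 0 by exists (fun=> 0%N); rewrite big1.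
have BD w w' : B w -> B w' -> B (w + w').
  move=> [k ->] [k' ->]; exists (fun j => k j + k' j)%N; rewrite -big_split.
  by apply: eq_bigr => j _; rewrite mulrnDr.
have Bg j : B (g j).
  exists (fun i => (i == j) : nat); rewrite (bigD1 j) //= eqxx mulr1n big1 ?addr0 // => i nij.
  by rewrite (negbTE nij).
have spanX l : char_span B (fun t => F t 0 l).
  exists (I l), (c l), (fun i => g (Tagged I i)); split=> [i|t Tt]; first exact: Bg.
  rewrite -(mevalXU (F t 0) l) (hv l).2 //; apply: eq_bigr => i _; rewrite /g /=.
  by case: eqVneq => [->|//]; rewrite !mul0r.
have [Q [d [w [Bw hw]]]] : char_span B (character u).
  apply: (@char_span_eq _ _ (fun t => \sum_(m <- msupp p) p@_m * \prod_l F t 0 l ^+ m l)).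
    by move=> t Tt; rewrite -hp // mevalE.
  elim: (msupp p) => [|m s IH].
    by apply: char_span_eq (char_span_const 0 B0) => t _; rewrite big_nil.
  apply: (@char_span_eq _ _ (fun t => p@_m * \prod_l F t 0 l ^+ m l + \sum_(m <- s) p@_m * \prod_l F t 0 l ^+ m l)).
    by move=> t _; rewrite big_cons.
  apply: char_spanD IH; apply: (char_spanM BD); first exact: char_span_const.
  elim: (index_enum _) => [|l r IH].
    by apply: char_span_eq (char_span_const 1 B0) => t _; rewrite big_nil.
  apply: (@char_span_eq _ _ (fun t => F t 0 l ^+ m l * \prod_(l <- r) F t 0 l ^+ m l)).
    by move=> t _; rewrite big_cons.
  apply: (char_spanM BD) IH; elim: (m l) => [|k IH]; first exact: char_span_const.
  apply: (@char_span_eq _ _ (fun t => F t 0 l * F t 0 l ^+ k)).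
    by move=> t _; rewrite exprS.
  exact: (char_spanM BD).
by have [i _ <-] := character_occurs hw; apply: Bw.
Qed.

End Weights.

Section PlaneCones.
Implicit Types (u v w q : 'rV[int]_2).

Definition cross u v : int := u 0 0 * v 0 1 - u 0 1 * v 0 0.

Lemma pairingE (R : pzRingType) (p u : 'rV[R]_2) : pairing p u = p 0 0 * u 0 0 + p 0 1 * u 0 1.
Proof. by rewrite /pairing big2. Qed.

Lemma rV2_eq u v : u 0 0 = v 0 0 -> u 0 1 = v 0 1 -> u = v.
Proof. by move=> e0 e1; apply/rowP; apply: I2_ind. Qed.

Lemma crossvv u : cross u u = 0.
Proof. by rewrite /cross mulrC subrr. Qed.

(** In an open half-plane the sign of the cross product is a total preorder,
    so that a finite family has an extreme member; [e] selects the direction. *)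
Lemma extreme (J : finType) (P : pred J) (v : J -> 'rV[int]_2) (e : int) k l j0 :
  P j0 -> (forall j, P j -> 0 < k * v j 0 0 + l * v j 0 1) ->
  exists2 a, P a & forall j, P j -> 0 <= e * cross (v a) (v j).
Proof.
move=> Pj0 pos.
suff : forall s : seq J, (exists2 j, j \in s & P j) ->
    exists a, [/\ a \in s, P a & forall j, j \in s -> P j -> 0 <= e * cross (v a) (v j)].
  move=> /(_ (enum J)) [|a [_ Pa ha]]; first by exists j0; rewrite // mem_enum.
  by exists a => // j Pj; apply: ha; rewrite ?mem_enum.
elim=> [[j]|b s IH [j]]; first by rewrite in_nil.
have [Pb|nPb] := boolP (P b); last first.
  rewrite inE => /orP[/eqP->|js] Pj; first by rewrite Pj in nPb.
  have [|a [as_ Pa ha]] := IH; first by exists j.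
  exists a; split=> //; first by rewrite inE as_ orbT.
  by move=> i; rewrite inE => /orP[/eqP->|]; [rewrite (negbTE nPb) | apply: ha].
move=> _ _; have [[i is_ Pi]|none] := classic (exists2 j, j \in s & P j); last first.
  exists b; rewrite inE eqxx; split=> // i; rewrite inE => /orP[/eqP-> _|is_ Pi].
    by rewrite crossvv mulr0.
  by case: none; exists i.
have [|a [as_ Pa ha]] := IH; first by exists i.
have [ab|ba] := lerP 0 (e * cross (v a) (v b)).
  exists a; split=> //; first by rewrite inE as_ orbT.
  by move=> m; rewrite inE => /orP[/eqP-> _|]; [exact: ab | apply: ha].
exists b; rewrite inE eqxx; split=> // m; rewrite inE => /orP[/eqP-> _|ms Pm].
  by rewrite crossvv mulr0.
have am := ha m ms Pm; have pa := pos a Pa; have pb := pos b Pb; have pm := pos m Pm.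
set fa := k * v a 0 0 + l * v a 0 1 in pa; set fm := k * v m 0 0 + l * v m 0 1 in pm.
set fb := k * v b 0 0 + l * v b 0 1 in pb.
have E : fa * (e * cross (v b) (v m)) = fb * (e * cross (v a) (v m)) + fm * (- (e * cross (v a) (v b))).
  by rewrite /fa /fb /fm /cross; ring.
rewrite -(pmulr_rge0 _ pa) E addr_ge0 // mulr_ge0 // ?oppr_ge0 ltW //.
Qed.

Definition normal_vector (e : int) u : 'rV[int]_2 := \row_i (if i == 0 then - (e * u 0 1) else e * u 0 0).

Lemma pairing_normal e u v : pairing (normal_vector e u) v = e * cross u v.
Proof. by rewrite pairingE !mxE /cross /=; ring. Qed.

Lemma pairingD q u v : pairing q (u + v) = pairing q u + pairing q v.
Proof. by rewrite !pairingE !mxE; ring. Qed.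

Lemma pairingMn q u k : pairing q (u *+ k) = pairing q u *+ k.
Proof. by elim: k => [|k IH]; rewrite ?mulr0n ?mulrS ?pairingD ?IH // pairingE !mxE !mulr0. Qed.

Lemma pairing_sum q (J : finType) (f : J -> 'rV[int]_2) : pairing q (\sum_j f j) = \sum_j pairing q (f j).
Proof.
by apply: (big_morph (pairing q)) => [u v|]; [apply: pairingD | rewrite pairingE !mxE !mulr0].
Qed.

Lemma scale_nonneg u (k : int) : 0 <= k -> k *: u = u *+ `|k|%N.
Proof. by case: k => k // _; rewrite -scaler_nat /= natz. Qed.

Lemma primitive_vector u : u != 0 ->
  exists (d : int) v, [/\ 0 < d, coprimez (v 0 0) (v 0 1) & u = d *: v].
Proof.
move=> u0; pose d := gcdz (u 0 0) (u 0 1).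
have d0 : d != 0.
  rewrite gcdz_eq0; apply: contra u0 => /andP[/eqP e0 /eqP e1].
  by apply/eqP/rV2_eq; rewrite mxE.
have dp : 0 < d by rewrite lt_neqAle eq_sym d0.
have /dvdzP[a ea] : (d %| (u 0 0)%R)%Z by apply: dvdz_gcdl.
have /dvdzP[b eb] : (d %| (u 0 1)%R)%Z by apply: dvdz_gcdr.
exists d, (\row_i (if i == 0 then a else b)); split=> //.
  rewrite !mxE /=; apply/eqP; apply: (mulIf d0); rewrite mul1r.
  by have := mulz_gcdl a b d; rewrite -ea -eb -/d gtz0_abs.
by apply: rV2_eq; rewrite !mxE /= mulrC.
Qed.

(** The inner normals of the facets of the cone spanned by [S] are the [q j] with
    [j < m]; the others complete them to a basis, of the lattice if [m < 2]. *)
Definition facets (S : 'rV[int]_2 -> Prop) (m : nat) (q : 'I_2 -> 'rV[int]_2) : Prop :=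
  [/\ (m <= 2)%N, forall j : 'I_2, (j < m)%N -> coprimez (q j 0 0) (q j 0 1),
      cross (q 0) (q 1) != 0, (m < 2)%N -> `|cross (q 0) (q 1)| = 1
    & forall u, S u <-> forall j : 'I_2, (j < m)%N -> 0 <= pairing (q j) u].

Variables (S : 'rV[int]_2 -> Prop) (J : finType) (g : J -> 'rV[int]_2).
Hypothesis S0 : S 0.
Hypothesis SD : forall u v, S u -> S v -> S (u + v).
Hypothesis Ssat : forall u k, S (u *+ k.+1) -> S u.
Hypothesis Sgroup : forall u, exists v w, [/\ S v, S w & u = v - w].
Hypothesis Sg : forall j, S (g j).
Hypothesis gens : forall u, S u -> exists k : J -> nat, u = \sum_j g j *+ k j.

Lemma monoid_scale u (k : int) : 0 <= k -> S u -> S (k *: u).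
Proof.
move=> k0 Su; rewrite scale_nonneg //; elim: `|k|%N => [|m IH]; first by rewrite mulr0n.
by rewrite mulrS; apply: SD.
Qed.

Lemma monoid_unscale u (k : int) : 0 < k -> S (k *: u) -> S u.
Proof.
move=> k0; rewrite scale_nonneg ?ltW //.
by have : (0 < `|k|)%N; [lia | case: `|k|%N => // m _; apply: Ssat].
Qed.

Lemma functional_nonneg q : (forall j, 0 <= pairing q (g j)) -> forall u, S u -> 0 <= pairing q u.
Proof.
move=> qg u /gens[k ->]; rewrite pairing_sum; apply: sumr_ge0 => j _.
by rewrite pairingMn mulrn_wge0.
Qed.

Lemma functional_eq0 q : (forall j, pairing q (g j) = 0) -> q = 0.
Proof.
move=> qg; have qS u : S u -> pairing q u = 0.
  move=> /gens[k ->]; rewrite pairing_sum big1 // => j _.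
  by rewrite pairingMn qg mul0rn.
have q0 u : pairing q u = 0.
  have [v [w [Sv Sw ->]]] := Sgroup u.
  have -> : pairing q (v - w) = pairing q v - pairing q w by rewrite !pairingE !mxE; ring.
  by rewrite !qS // subrr.
have := q0 (delta_mx 0 0); have := q0 (delta_mx 0 1); rewrite !pairingE !mxE /=.
by rewrite !mulr0 !mulr1 add0r addr0 => h1 h0; apply: rV2_eq; rewrite mxE.
Qed.

(** Among the generators on one side of the line through [u], the one closest
    to [u] spans a supporting line of the cone, and [u] lies beyond it. *)
Lemma separation e u : e * e = 1 -> ~ S u -> (exists j, 0 < e * cross u (g j)) ->
  exists j, (forall i, 0 <= pairing (normal_vector e (g j)) (g i)) /\
    pairing (normal_vector e (g j)) u < 0.
Proof.
move=> ee nSu [j0 hj0].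
pose P j := 0 < e * cross u (g j).
have [|a Pa ha] := @extreme J P g e (- (e * u 0 1)) (e * u 0 0) j0 hj0.
  move=> j; rewrite (_ : _ + _ = e * cross u (g j)) //.
  by rewrite /cross; ring.
exists a; split=> [i|]; last first.
  rewrite pairing_normal -oppr_gt0 (_ : - _ = e * cross u (g a)) //.
  by rewrite /cross; ring.
rewrite pairing_normal; have [Pi|nPi] := boolP (P i); first exact: ha.
rewrite /P -leNgt in nPi.
have [lt|eq0] : e * cross u (g i) < 0 \/ cross u (g i) = 0.
  move: nPi; rewrite le_eqVlt => /orP[/eqP h|]; [right|by left].
  by have := congr1 ( *%R e) h; rewrite mulrA ee mul1r mulr0.
  rewrite leNgt; apply/negP => neg; apply: nSu.
  apply: (@monoid_unscale _ (- (e * cross (g a) (g i)))); first by rewrite oppr_gt0.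
  have -> : - (e * cross (g a) (g i)) *: u =
      (e * cross u (g a)) *: g i + (- (e * cross u (g i))) *: g a.
    by apply: rV2_eq; rewrite !mxE /cross; ring.
  by apply: SD; apply: monoid_scale => //; rewrite ?oppr_ge0 ltW.
(* The generator [g i] is parallel to [u], hence opposite to it. *)
pose dot := u 0 0 * g i 0 0 + u 0 1 * g i 0 1; pose nu := u 0 0 * u 0 0 + u 0 1 * u 0 1.
have nu0 : 0 < nu.
  rewrite lt_neqAle /nu -!expr2 addr_ge0 ?sqr_ge0 // andbT; apply/eqP => /esym/eqP.
  rewrite paddr_eq0 ?sqr_ge0 // !sqrf_eq0 => /andP[/eqP e0 /eqP e1]; apply: nSu.
  by rewrite (_ : u = 0) //; apply: rV2_eq; rewrite mxE.
have dE : nu *: g i = dot *: u.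
  move: eq0; rewrite /cross => eq0; apply: rV2_eq; rewrite !mxE /nu /dot.
    have -> : (u 0 0 * u 0 0 + u 0 1 * u 0 1) * g i 0 0 = (u 0 0 * g i 0 0 + u 0 1 * g i 0 1) * u 0 0
      - u 0 1 * (u 0 0 * g i 0 1 - u 0 1 * g i 0 0) by ring.
    by rewrite eq0 mulr0 subr0.
  have -> : (u 0 0 * u 0 0 + u 0 1 * u 0 1) * g i 0 1 = (u 0 0 * g i 0 0 + u 0 1 * g i 0 1) * u 0 1
      + u 0 0 * (u 0 0 * g i 0 1 - u 0 1 * g i 0 0) by ring.
  by rewrite eq0 mulr0 addr0.
have dot0 : dot <= 0.
  rewrite leNgt; apply/negP => dp; apply: nSu; apply: (monoid_unscale dp).
  by rewrite -dE; apply: monoid_scale; rewrite ?ltW.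
have E : nu * (e * cross (g a) (g i)) = (- dot) * (e * cross u (g a)).
  have -> : nu * (e * cross (g a) (g i)) = e * cross (g a) (nu *: g i) by rewrite /cross !mxE; ring.
  by rewrite dE /cross !mxE; ring.
by rewrite -(pmulr_rge0 _ nu0) E mulr_ge0 // ?oppr_ge0 // ltW.
Qed.

Lemma normal_neq0 e u q : pairing (normal_vector e u) q != 0 -> normal_vector e u != 0.
Proof. by apply: contra => /eqP->; rewrite pairingE !mxE !mul0r. Qed.

Lemma crossC u v : cross v u = - cross u v.
Proof. by rewrite /cross; ring. Qed.

(** The facets are the extreme ones among the supporting lines spanned by the
    generators: every other supporting functional is a nonnegative combination
    of these two. *)
Lemma facets_exist : exists m (q : 'I_2 -> 'rV[int]_2), facets S m q.
Proof.
pose sg (b : bool) : int := if b then 1 else -1.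
have sgsg b : sg b * sg b = 1 by case: b.
pose nv (jb : J * bool) := normal_vector (sg jb.2) (g jb.1).
pose P jb := (nv jb != 0) && [forall i, 0 <= pairing (nv jb) (g i)].
have SP u : S u <-> forall jb, P jb -> 0 <= pairing (nv jb) u.
  split=> [Su jb /andP[_ /forallP h]|hu]; first exact: functional_nonneg.
  apply: NNPP => nSu.
  have [b [j hj]] : exists b j, 0 < sg b * cross u (g j).
    apply: NNPP => none; apply: nSu; suff -> : u = 0 by [].
    have n0 : normal_vector 1 u = 0.
      apply: functional_eq0 => j; rewrite pairing_normal mul1r; apply: NNPP => /eqP h.
      apply: none; case: (ltrgtP 0 (cross u (g j))) h => // h _.
        by exists true, j; rewrite mul1r.
      by exists false, j; rewrite mulN1r oppr_gt0.
    apply: rV2_eq; rewrite mxE.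
      by have := congr1 (fun w : 'rV[int]_2 => w 0 1) n0; rewrite !mxE /= mul1r.
    by have := congr1 (fun w : 'rV[int]_2 => w 0 0) n0; rewrite !mxE /= mul1r => /eqP; rewrite oppr_eq0 => /eqP.
  have [i [hi hu']] := separation (sgsg b) nSu (ex_intro _ j hj).
  have := hu (i, b); rewrite leNgt hu' => /(_ _)/negP; apply=> //.
  by apply/andP; split; [apply: (normal_neq0 (q := u)); rewrite ltr0_neq0 | apply/forallP].
have [[j0 Pj0]|none] := classic (exists jb, P jb); last first.
  exists 0%N, (fun j => delta_mx 0 j); split=> //; try by rewrite /cross !mxE.
  by move=> u; split=> // _; apply/SP => jb Pjb; case: none; exists jb.
pose ws := \sum_j g j.
have pos jb : P jb -> 0 < ws 0 0 * nv jb 0 0 + ws 0 1 * nv jb 0 1.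
  move=> /andP[nz /forallP h]; rewrite (_ : _ + _ = pairing (nv jb) ws); last first.
    by rewrite pairingE; ring.
  rewrite pairing_sum lt_neqAle sumr_ge0 // andbT eq_sym; apply: contra nz => s0.
  apply/eqP/functional_eq0 => i; apply/eqP; move: s0; rewrite psumr_eq0 // => /allP.
  by apply; rewrite mem_index_enum.
have [a Pa ha] := extreme 1 Pj0 pos; have [b Pb hb] := extreme (-1) Pj0 pos.
have {}ha jb : P jb -> 0 <= cross (nv a) (nv jb) by move=> /ha; rewrite mul1r.
have {}hb jb : P jb -> 0 <= cross (nv jb) (nv b).
  by move=> /hb; rewrite mulN1r -crossC.
have [d [a' [d0 ca' Ea]]] : exists (d : int) v, [/\ 0 < d, coprimez (v 0 0) (v 0 1) & nv a = d *: v].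
  by apply: primitive_vector; case/andP: Pa.
have [f [b' [f0 cb' Eb]]] : exists (d : int) v, [/\ 0 < d, coprimez (v 0 0) (v 0 1) & nv b = d *: v].
  by apply: primitive_vector; case/andP: Pb.
have scaleP (k : int) q u : 0 < k -> (0 <= pairing (k *: q) u) = (0 <= pairing q u).
  by move=> k0; rewrite !pairingE !mxE -!mulrA -mulrDr pmulr_rge0.
have Sa u (Su : S u) : 0 <= pairing a' u by rewrite -(scaleP d) // -Ea; apply: (SP u).1.
have Sb u (Su : S u) : 0 <= pairing b' u by rewrite -(scaleP f) // -Eb; apply: (SP u).1.
have [D0|Dn] := eqVneq (cross (nv a) (nv b)) 0.
  have [x [y xy]] : exists x y, x * a' 0 0 + y * a' 0 1 = 1.
    by have [x [y E]] := Bezoutz (a' 0 0) (a' 0 1); exists x, y; rewrite E; apply/eqP.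
  pose c : 'rV[int]_2 := \row_i (if i == 0 then - y else x).
  have ac : cross a' c = 1 by rewrite /cross !mxE /= -xy; ring.
  exists 1%N, (fun j => if j == 0 then a' else c); split=> //=; rewrite ?ac //.
    by apply: I2_ind.
  move=> u; split=> [Su|h]; first by apply: I2_ind => // _; apply: Sa.
  have {}h := h 0 isT; apply/SP => jb Pjb.
  have pa := pos a Pa; have pb := pos b Pb; have pj := pos jb Pjb.
  have c0 : cross (nv a) (nv jb) = 0.
    have E : (ws 0 0 * nv jb 0 0 + ws 0 1 * nv jb 0 1) * cross (nv a) (nv b) =
      (ws 0 0 * nv a 0 0 + ws 0 1 * nv a 0 1) * cross (nv jb) (nv b) +
      (ws 0 0 * nv b 0 0 + ws 0 1 * nv b 0 1) * cross (nv a) (nv jb) by rewrite /cross; ring.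
    have := ha _ Pjb; have := hb _ Pjb; move: E; rewrite D0 mulr0 => /esym/eqP + h1 h2.
    by rewrite paddr_eq0 ?mulr_ge0 ?(ltW pa) ?(ltW pb) // => /andP[_]; rewrite mulf_eq0 gt_eqF //= => /eqP.
  have E : (ws 0 0 * nv a 0 0 + ws 0 1 * nv a 0 1) * pairing (nv jb) u =
      (ws 0 0 * nv jb 0 0 + ws 0 1 * nv jb 0 1) * pairing (nv a) u +
      cross (nv a) (nv jb) * (u 0 1 * ws 0 0 - u 0 0 * ws 0 1) by rewrite /cross !pairingE; ring.
  rewrite -(pmulr_rge0 _ pa) E c0 mul0r addr0 mulr_ge0 ?(ltW pj) //.
  by rewrite Ea scaleP.
have D : 0 < cross (nv a) (nv b) by rewrite lt_neqAle eq_sym Dn ha.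
exists 2%N, (fun j => if j == 0 then a' else b'); split=> //=.
- by apply: I2_ind.
- apply: contra Dn => /eqP c0; rewrite Ea Eb.
  have -> : cross (d *: a') (f *: b') = d * f * cross a' b' by rewrite /cross !mxE; ring.
  by rewrite c0 mulr0.
move=> u; split=> [Su|h]; first by apply: I2_ind => _; [apply: Sa | apply: Sb].
have h0 := h 0 isT; have h1 := h 1 isT; apply/SP => jb Pjb.
have E : cross (nv a) (nv b) * pairing (nv jb) u =
    cross (nv jb) (nv b) * pairing (nv a) u + cross (nv a) (nv jb) * pairing (nv b) u.
  by rewrite /cross !pairingE; ring.
rewrite -(pmulr_rge0 _ D) E addr_ge0 // mulr_ge0 ?ha ?hb //.
  by rewrite Ea scaleP.
by rewrite Eb scaleP.
Qed.

End PlaneCones.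

(** * Cones and Cox vectors *)

Section CoxVectors.
Implicit Types (u p : 'rV[int]_2) (v w : 'rV[rat]_2).

Lemma to_ratE u i : to_rat u 0 i = (u 0 i)%:~R.
Proof. by rewrite mxE. Qed.

Lemma rV2_eq_rat v w : v 0 0 = w 0 0 -> v 0 1 = w 0 1 -> v = w.
Proof. by move=> e0 e1; apply/rowP; apply: I2_ind. Qed.

Lemma pairing_to_rat p u : pairing (to_rat p) (to_rat u) = (pairing p u)%:~R.
Proof. by rewrite !pairingE !to_ratE intrD !intrM. Qed.

Lemma pairingDl v v' w : pairing (v + v') w = pairing v w + pairing v' w.
Proof. by rewrite !pairingE !mxE; ring. Qed.

Lemma pairingZl (a : rat) v w : pairing (a *: v) w = a * pairing v w.
Proof. by rewrite !pairingE !mxE; ring. Qed.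

Lemma pairingZr (a : rat) v w : pairing v (a *: w) = a * pairing v w.
Proof. by rewrite !pairingE !mxE; ring. Qed.

Lemma pairing_sumr I (r : seq I) v (f : I -> 'rV[rat]_2) :
  pairing v (\sum_(i <- r) f i) = \sum_(i <- r) pairing v (f i).
Proof.
apply: (big_morph (pairing v)) => [w w'|]; last by rewrite pairingE !mxE !mulr0 addr0.
by rewrite !pairingE !mxE; ring.
Qed.

(** The cone [sigma], for [S] the monoid of the lattice points of [omega]. *)
Definition lattice_cone (S : 'rV[int]_2 -> Prop) : 'rV[rat]_2 -> Prop :=
  dual_cone (cone_hull (fun w => exists2 u, S u & w = to_rat u)).

Lemma lattice_coneE S v : lattice_cone S v <-> forall u, S u -> 0 <= pairing v (to_rat u).
Proof.
split=> [h u Su|h w [k [a [s [a0 Ss ->]]]]].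
  apply: h; exists 1%N, (fun=> 1), (fun=> to_rat u); split=> // [_|].
    by exists u.
  by rewrite big_ord1 scale1r.
rewrite pairing_sumr sumr_ge0 // => i _; rewrite pairingZr mulr_ge0 //.
by have [u Su ->] := Ss i; apply: h.
Qed.

(** The multiple is found with the coefficients of a Bezout relation between the
    coordinates of [p]. *)
Lemma primitive_line p u : coprimez (p 0 0) (p 0 1) -> cross p u = 0 ->
  exists k : int, u = k *: p.
Proof.
move=> cp c0; have [x [y E]] := Bezoutz (p 0 0) (p 0 1).
have xy : x * p 0 0 + y * p 0 1 = 1 by rewrite E; apply/eqP.
exists (x * u 0 0 + y * u 0 1); move: c0; rewrite /cross => c0; apply: rV2_eq; rewrite !mxE.
  have -> : (x * u 0 0 + y * u 0 1) * p 0 0 = u 0 0 * (x * p 0 0 + y * p 0 1)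
    + y * (p 0 0 * u 0 1 - p 0 1 * u 0 0) by ring.
  by rewrite xy c0 mulr1 mulr0 addr0.
have -> : (x * u 0 0 + y * u 0 1) * p 0 1 = u 0 1 * (x * p 0 0 + y * p 0 1)
  - x * (p 0 0 * u 0 1 - p 0 1 * u 0 0) by ring.
by rewrite xy c0 mulr1 mulr0 subr0.
Qed.

Lemma coprime_neq0 p : coprimez (p 0 0) (p 0 1) -> exists i, p 0 i != 0.
Proof.
move=> cp; apply: NNPP => none; have p0 i : p 0 i = 0.
  by apply/eqP; apply: contraT => h; case: none; exists i.
by move: cp; rewrite !p0.
Qed.

Lemma primitive_ray p (q : 'rV[int]_2) (a : rat) : coprimez (p 0 0) (p 0 1) -> coprimez (q 0 0) (q 0 1) ->
  0 <= a -> to_rat q = a *: to_rat p -> q = p.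
Proof.
move=> cp cq a0 E.
have Ei i : (q 0 i)%:~R = a * (p 0 i)%:~R :> rat.
  by rewrite -to_ratE E mxE to_ratE.
have [|k Ek] := @primitive_line p q cp.
  apply: (@intr_inj rat); rewrite /cross intrB !intrM !Ei; ring.
have [i pi] := coprime_neq0 cp.
have ka : k%:~R = a.
  apply: (@mulIf _ (p 0 i)%:~R); first by rewrite intr_eq0.
  by rewrite -Ei Ek mxE intrM.
have k0 : 0 <= k by rewrite -(ler0z rat) ka.
have : coprimez (k * p 0 0) (k * p 0 1) by move: cq; rewrite Ek !mxE.
rewrite /coprimez -mulz_gcdr (eqP cp) mulr1 => /eqP k1.
by rewrite Ek; move: k1; rewrite gez0_abs // => ->; rewrite scale1r.
Qed.

Section Facets.
Variables (S : 'rV[int]_2 -> Prop) (m : nat) (q : 'I_2 -> 'rV[int]_2).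
Hypothesis fS : facets S m q.

Let D := cross (q 0) (q 1).

(** The basis dual to [q 0], [q 1], up to the factor [|D|]. *)
Definition dual_vector (j : 'I_2) : 'rV[int]_2 :=
  if j == 0 then normal_vector (- sgz D) (q 1) else normal_vector (sgz D) (q 0).

Lemma dual_vectorE i j : pairing (q i) (dual_vector j) = if i == j then `|D| else 0.
Proof.
rewrite /dual_vector; move: i j; apply: I2_ind; apply: I2_ind;
  rewrite pairingE /= !mxE /= ?[`|D|]normrEsg /D /cross; ring.
Qed.

Lemma D_gt0 : 0 < `|D|.
Proof. by have [_ _ D0 _ _] := fS; rewrite normr_gt0. Qed.

Lemma dual_vector_weight j : S (dual_vector j).
Proof.
have [_ _ _ _ SE] := fS; apply/SE => i _; rewrite dual_vectorE.
by case: ifP => // _; rewrite ltW ?D_gt0.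
Qed.

Lemma dual_vector_unit (j : 'I_2) : (m <= j)%N -> S (- dual_vector j).
Proof.
move=> mj; have [_ _ _ _ SE] := fS; apply/SE => i im.
have -> : pairing (q i) (- dual_vector j) = - pairing (q i) (dual_vector j).
  by rewrite !pairingE !mxE; ring.
rewrite dual_vectorE; case: eqP => [E|_]; last by rewrite oppr0.
by move: im; rewrite E ltnNge mj.
Qed.

Definition coordinate v j : rat := pairing v (to_rat (dual_vector j)) / `|D|%:~R.

Lemma coordinateE v : v = \sum_j coordinate v j *: to_rat (q j).
Proof.
have D0 : (`|D|%:~R : rat) != 0 by rewrite intr_eq0 gt_eqF ?D_gt0.
have sD : `|D|%:~R = (sgz D)%:~R * (cross (q 0) (q 1))%:~R :> rat.
  by rewrite -intrM; congr _%:~R; rewrite -/D; case: (sgzP D) => h;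
    rewrite ?mul1r ?mulN1r ?mul0r ?h ?normr0 ?gtr0_norm ?ltr0_norm.
have key : `|D|%:~R *: v = \sum_j pairing v (to_rat (dual_vector j)) *: to_rat (q j).
  rewrite sD big2 /dual_vector /cross; move: (sgz D) => s.
  by apply: rV2_eq_rat; rewrite !mxE !pairingE !mxE /=; ring.
apply: (scalerI D0); rewrite key scaler_sumr; apply: eq_bigr => j _.
by rewrite scalerA /coordinate mulrC divfK.
Qed.

Lemma pairing_sum_coordinates (c : 'I_2 -> rat) j :
  pairing (\sum_i c i *: to_rat (q i)) (to_rat (dual_vector j)) = c j * `|D|%:~R.
Proof.
by rewrite big2 pairingDl !pairingZl !pairing_to_rat !dual_vectorE; move: j; apply: I2_ind;
  rewrite /= mulr0 ?addr0 ?add0r.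
Qed.

Lemma coordinates_unique (c : 'I_2 -> rat) j :
  coordinate (\sum_i c i *: to_rat (q i)) j = c j.
Proof.
by rewrite /coordinate pairing_sum_coordinates mulfK // intr_eq0 gt_eqF ?D_gt0.
Qed.

Lemma facets_coneE v : lattice_cone S v <->
  (forall j, 0 <= coordinate v j) /\ (forall j : 'I_2, (m <= j)%N -> coordinate v j = 0).
Proof.
have [_ _ _ _ SE] := fS; have D0 : (0 : rat) < `|D|%:~R by rewrite ltr0z D_gt0.
rewrite lattice_coneE; split=> [h|[c0 cm] u Su]; last first.
  rewrite (coordinateE v) big2 pairingDl !pairingZl !pairing_to_rat.
  have nn (j : 'I_2) : 0 <= coordinate v j * (pairing (q j) u)%:~R.
    have [jm|mj] := ltnP j m; last by rewrite cm // mul0r.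
    by rewrite mulr_ge0 // ler0z; apply: (SE u).1.
  by rewrite addr_ge0.
have c0 j : 0 <= coordinate v j.
  by rewrite /coordinate divr_ge0 ?(ltW D0) //; apply: h; apply: dual_vector_weight.
split=> // j mj; apply/eqP; rewrite eq_le c0 andbT.
have := h _ (dual_vector_unit mj); rewrite /coordinate.
have -> : pairing v (to_rat (- dual_vector j)) = - pairing v (to_rat (dual_vector j)).
  by rewrite !pairingE !mxE; ring.
by rewrite oppr_ge0 => h'; rewrite pmulr_lle0 ?invr_gt0.
Qed.

Lemma facet_in_cone (j : 'I_2) : (j < m)%N -> lattice_cone S (to_rat (q j)).
Proof.
have [_ _ _ _ SE] := fS.
by move=> jm; apply/lattice_coneE => u Su; rewrite pairing_to_rat ler0z; apply: (SE u).1.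
Qed.

Lemma I2_other (j : 'I_2) : exists i : 'I_2, i != j /\ forall k, k != j -> k = i.
Proof.
by move: j; apply: I2_ind; [exists 1 | exists 0]; split=> //; apply: I2_ind.
Qed.

(** A face is cut out by a vector [u] of the dual cone; if it is a ray, some [q j] of
    the cone is orthogonal to [u], and spans the ray.  The vector of the dual basis that
    is orthogonal to [q j] cuts out the ray of [q j]. *)
Lemma ray_generator_facets p : ray_generator (lattice_cone S) p <-> exists2 j : 'I_2, (j < m)%N & p = q j.
Proof.
have [_ cop _ _ _] := fS; split=> [[cp [u [du hu]]]|[j jm ->]].
  have [[pc pu] _] : (lattice_cone S (to_rat p) /\ pairing (to_rat p) u = 0) /\ True.
    by split=> //; apply/hu; exists 1; rewrite ?scale1r.
  have /facets_coneE[c0 cm] := pc.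
  have qu (j : 'I_2) : (j < m)%N -> 0 <= pairing u (to_rat (q j)).
    by move=> jm; apply: du; apply: facet_in_cone.
  have pairC (v w : 'rV[rat]_2) : pairing v w = pairing w v by rewrite !pairingE; ring.
  have nn j : 0 <= coordinate (to_rat p) j * pairing (to_rat (q j)) u.
    have [jm|mj] := ltnP j m; last by rewrite cm // mul0r.
    by rewrite mulr_ge0 // pairC; apply: qu.
  have z j : coordinate (to_rat p) j * pairing (to_rat (q j)) u = 0.
    have := pu; rewrite {1}(coordinateE (to_rat p)) big2 pairingDl !pairingZl => /eqP.
    by rewrite paddr_eq0 // => /andP[/eqP h0 /eqP h1]; move: j; apply: I2_ind.
  have [j cj] : exists j, coordinate (to_rat p) j != 0.
    apply: NNPP => none; have [i] := coprime_neq0 cp.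
    rewrite -(intr_eq0 rat) -to_ratE (coordinateE (to_rat p)) big1 ?mxE ?eqxx // => j _.
    have [->|h] := eqVneq (coordinate (to_rat p) j) 0; first by rewrite scale0r.
    by case: none; exists j.
  have jm : (j < m)%N by rewrite ltnNge; apply: contra cj => mj; rewrite cm.
  exists j => //; have qj0 : pairing (to_rat (q j)) u = 0.
    by apply/eqP; have /eqP := z j; rewrite mulf_eq0 (negbTE cj).
  have [a a0 E] : exists2 a, 0 <= a & to_rat (q j) = a *: to_rat p.
    by apply/hu; split=> //; apply: facet_in_cone.
  by rewrite (primitive_ray cp (cop j jm) a0 E).
split; first exact: cop.
have [i [ij other]] := I2_other j.
exists (to_rat (dual_vector i)); split=> [w cw|v].
  have pairC (x y : 'rV[rat]_2) : pairing x y = pairing y x by rewrite !pairingE; ring.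
  by rewrite pairC; move/lattice_coneE: cw; apply; apply: dual_vector_weight.
have D0 : (`|D|%:~R : rat) != 0 by rewrite intr_eq0 gt_eqF ?D_gt0.
split=> [[a a0 ->]|[cv vi]].
  rewrite pairingZl pairing_to_rat dual_vectorE eq_sym (negbTE ij) mulr0; split=> //.
  apply/lattice_coneE => u Su; rewrite pairingZl mulr_ge0 //.
  by move/lattice_coneE: (facet_in_cone jm); apply.
have /facets_coneE[c0 cm] := cv; exists (coordinate v j) => //.
rewrite {1}(coordinateE v) (bigD1 j) //= big1 ?addr0 // => k kj.
by rewrite (other k kj) /coordinate vi mul0r scale0r.
Qed.

Lemma span_facets v : linear_span (lattice_cone S) v <-> forall j : 'I_2, (m <= j)%N -> coordinate v j = 0.
Proof.
split=> [[k [a [s [cs ->]]]] j mj|h].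
  have pl : pairing (\sum_i a i *: s i) (to_rat (dual_vector j)) = \sum_i a i * pairing (s i) (to_rat (dual_vector j)).
    elim/big_rec2: _ => [|i x w _ <-]; first by rewrite pairingE !mxE !mul0r.
    by rewrite pairingDl pairingZl.
  rewrite /coordinate pl mulr_suml big1 // => i _; have /facets_coneE[_ cm] := cs i.
  by rewrite -mulrA -/(coordinate (s i) j) cm // mulr0.
exists 2%N, (coordinate v), (fun j : 'I_2 => if (j < m)%N then to_rat (q j) else 0); split.
  move=> j; case: ifP => [jm|_]; first exact: facet_in_cone.
  by apply/lattice_coneE => u Su; rewrite pairingE !mxE !mul0r.
rewrite {1}(coordinateE v); apply: eq_bigr => j _; case: ltnP => // mj.
by rewrite h // !scale0r.
Qed.

(** The denominator [|D|] is 1 as [q 0], [q 1] is then a lattice basis. *)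
Lemma coordinate_int u j : (m < 2)%N -> exists k : int, coordinate (to_rat u) j = k%:~R.
Proof.
move=> m2; have [_ _ _ D1 _] := fS.
by exists (pairing u (dual_vector j)); rewrite /coordinate pairing_to_rat /D D1 // divr1.
Qed.

Lemma integral_coordinates u : (m < 2)%N -> exists k : 'I_2 -> int, u = \sum_j k j *: q j.
Proof.
move=> lt2; have /fin_all_exists[k hk] j := coordinate_int u j lt2; exists k.
apply/rowP => i; apply: (@intr_inj rat); rewrite -to_ratE (coordinateE (to_rat u)).
rewrite !summxE raddf_sum; apply: eq_bigr => j _.
by rewrite !mxE hk /= intrM.
Qed.

Lemma integral_coordinatesE (k : 'I_2 -> int) j : coordinate (to_rat (\sum_i k i *: q i)) j = (k j)%:~R.
Proof.
rewrite -(coordinates_unique (fun i => (k i)%:~R)); congr coordinate; apply/rowP => i.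
by rewrite to_ratE !summxE raddf_sum; apply: eq_bigr => l _; rewrite !mxE /= intrM.
Qed.

Lemma cox_vectors_of_facets : cox_vectors (lattice_cone S) m q.
Proof.
have [m2 cop D0 D1 SE] := fS; split=> //.
- move=> i j; rewrite !inE => im jm E; apply/eqP; apply: contraT => ij.
  move: D0 E ij; rewrite /cross; move: i j im jm.
  by apply: I2_ind; apply: I2_ind => // _ _; [|move=> + /esym]; move=> + E; rewrite E mulrC subrr eqxx.
- exact: ray_generator_facets.
- move=> v; have [lt2|ge2] := ltnP m 2; last first.
    have mE : m = 2%N by apply/eqP; rewrite eqn_leq m2.
    exists v, (fun=> 0); split; last by rewrite big1 ?addr0 // => j _; rewrite scale0r.
    by apply/span_facets => j; rewrite mE leqNgt ltn_ord.
  have [c vE] := integral_coordinates v lt2.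
  exists (\sum_(j < 2 | (j < m)%N) c j *: q j), c; split.
    apply/span_facets => j mj.
    have -> : to_rat (\sum_(j < 2 | (j < m)%N) c j *: q j) =
        \sum_(j < 2) (if (j < m)%N then (c j)%:~R else 0) *: to_rat (q j).
      apply/rowP => i; rewrite to_ratE !summxE raddf_sum big_mkcond; apply: eq_bigr => l _ /=.
      by case: ifP => _; rewrite !mxE ?mul0r ?intrM.
    by rewrite coordinates_unique ltnNge mj.
  rewrite {1}vE (bigID (fun j : 'I_2 => (j < m)%N)) /=; congr (_ + _).
  by apply: eq_bigl => j; rewrite -leqNgt.
move=> v0 c N0 E.
have cE (j : 'I_2) : (m <= j)%N -> c j = 0.
  move=> mj; have /span_facets/(_ j mj) := N0.
  have -> : to_rat v0 = \sum_(l < 2) (if (m <= l)%N then - (c l)%:~R else 0) *: to_rat (q l).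
    have -> : v0 = - \sum_(j < 2 | (m <= j)%N) c j *: q j by apply/eqP; rewrite -addr_eq0 E.
    apply/rowP => i; rewrite to_ratE mxE !summxE raddfN raddf_sum big_mkcond /= -sumrN.
    apply: eq_bigr => l _; case: ifP => _; rewrite !mxE ?mul0r ?oppr0 //=.
    by rewrite intrM mulNr.
  rewrite coordinates_unique mj => /eqP; rewrite oppr_eq0 intr_eq0 => /eqP //.
split=> //; move: E; rewrite big1 ?addr0 // => j mj.
by rewrite cE // scale0r.
Qed.

End Facets.

Lemma mem_take2 m (q : 'I_2 -> 'rV[int]_2) p : (m <= 2)%N ->
  p \in take m [:: q 0; q 1] <-> exists2 j : 'I_2, (j < m)%N & p = q j.
Proof.
case: m => [|[|[|//]]] _ /=; rewrite ?inE; split=> //.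
- by case.
- by move/eqP->; exists 0.
- by case; apply: I2_ind => // _ ->; rewrite eqxx.
- by case/orP => /eqP->; [exists 0 | exists 1].
- by case; apply: I2_ind => _ ->; rewrite eqxx ?orbT.
Qed.

(** Conversely, the Cox vectors of a cone are the normals [q j] in some order,
    completed by a basis of a complement: together these generate the lattice, so
    that their determinant is a unit if [m < 2]. *)
Lemma facets_of_cox_vectors S m q m' q' : facets S m q ->
  cox_vectors (lattice_cone S) m' q' -> facets S m' q'.
Proof.
move=> fS [m'2 inj rays dec uniq_]; have [m2 cop D0 D1 SE] := fS.
have same p : (exists2 j : 'I_2, (j < m')%N & p = q' j) <-> (exists2 j : 'I_2, (j < m)%N & p = q j).
  by split=> h; [apply/(ray_generator_facets fS)/rays | apply/rays/(ray_generator_facets fS)].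
have cop' (j : 'I_2) : (j < m')%N -> coprimez (q' j 0 0) (q' j 0 1).
  by move=> jm; have [|i im ->] := (same (q' j)).1; [exists j | apply: cop].
have SE' u : S u <-> forall j : 'I_2, (j < m')%N -> 0 <= pairing (q' j) u.
  split=> [/SE h j jm|h]; last apply/SE => j jm.
    by have [|i im ->] := (same (q' j)).1; [exists j | apply: h].
  by have [|i im ->] := (same (q j)).2; [exists j | apply: h].
have uq : uniq (take m [:: q 0; q 1]).
  have nq : q 0 != q 1 by apply: contra D0 => /eqP ->; rewrite crossvv.
  by case: m m2 {fS D1 SE same cop} => [|[|[|//]]] _ //=; rewrite inE nq.
have uq' : uniq (take m' [:: q' 0; q' 1]).
  move: inj; case: m' m'2 {rays dec uniq_ same cop' SE'} => [|[|[|//]]] _ //= inj.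
  by rewrite inE andbT; apply/negP => /eqP/(inj 0 1 isT isT).
have sz k (s : 'I_2 -> 'rV[int]_2) : (k <= 2)%N -> size (take k [:: s 0; s 1]) = k.
  by case: k => [|[|[|]]].
have mm : m' = m.
  apply/eqP; rewrite eqn_leq -{1}(sz m' q') // -{1}(sz m q) // -{2}(sz m q) // -{2}(sz m' q') //.
  by apply/andP; split; apply: uniq_leq_size => // p /(mem_take2 _ _) hp;
    apply/mem_take2 => //; apply/same; apply: hp.
subst m'.
have D1' : (m < 2)%N -> `|cross (q' 0) (q' 1)| = 1.
  move=> lt2; have span (v : 'rV[int]_2) : exists c : 'I_2 -> int, v = \sum_j c j *: q' j.
    have [v0 [c [N0 ->]]] := dec v; have /(span_facets fS) z := N0.
    have [k hk] := integral_coordinates fS v0 lt2.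
    have [k0 v0E] : exists k0 : 'I_2 -> int, v0 = \sum_(j < 2 | (j < m)%N) k0 j *: q' j.
      have kz (j : 'I_2) : (m <= j)%N -> k j = 0.
        move=> mj; apply/eqP; rewrite -(intr_eq0 rat); have := z j mj.
        by rewrite hk (integral_coordinatesE fS) => ->.
      exists k; rewrite hk [RHS]big_mkcond; apply: eq_bigr => j _.
      case: ltnP => [jm|mj]; last by rewrite kz // scale0r.
      have j0 (i : 'I_2) : (i < m)%N -> i = 0.
        by move=> im; apply: val_inj => /=; move: im lt2; case: (i : nat) => // i'; lia.
      have [|i im ->] := (same (q' j)).1; first by exists j.
      by rewrite (j0 i im) (j0 j jm).
    exists (fun j : 'I_2 => if (j < m)%N then k0 j else c j).
    rewrite v0E [in RHS](bigID (fun j : 'I_2 => (j < m)%N)) /=; congr (_ + _).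
      by apply: eq_bigr => j ->.
    rewrite [in RHS](eq_bigl (fun j : 'I_2 => (m <= j)%N)) => [|j]; last by rewrite -leqNgt.
    by apply: eq_bigr => j; rewrite leqNgt => /negbTE->.
  have [c Ec] := span (delta_mx 0 0); have [d Ed] := span (delta_mx 0 1).
  have : cross (delta_mx 0 0) (delta_mx 0 1) = 1 by rewrite /cross !mxE.
  rewrite Ec Ed !big2 /= => E.
  have : (cross (q' 0%R) (q' 1%R) %| 1)%Z.
    apply/dvdzP; exists (c 0 * d 1 - c 1 * d 0)%R; apply: etrans (esym E) _.
    by rewrite /cross !mxE; ring.
  by rewrite dvdz1 => /eqP h; rewrite -abszE h.
split=> //; have [lt2|ge2] := ltnP m 2.
  by apply/eqP => c0; have := D1' lt2; rewrite c0 normr0.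
have mE : m = 2%N by apply/eqP; rewrite eqn_leq m2.
have ltm (j : 'I_2) : (j < m)%N by rewrite mE.
have [|i _ Ei] := (same (q' 0)).1; first by exists 0.
have [|k _ Ek] := (same (q' 1)).1; first by exists 1.
have : i != k.
  by apply/eqP => ik; have := inj 0 1; rewrite !inE !ltm Ei Ek ik => /(_ isT isT erefl).
rewrite Ei Ek; move: i k {Ei Ek}; apply: I2_ind; apply: I2_ind => // _.
by rewrite crossC oppr_eq0.
Qed.

End CoxVectors.

Section WeightFacets.
Variable K : closedFieldType.
Variable n : nat.

Lemma chart_facets (X : 'rV[K]_n -> Prop) F : normal_affine X -> toric_chart X F ->
  exists m (q : 'I_2 -> 'rV[int]_2), facets (weights F) m q.
Proof.
move=> nX chX; have [J [g [Sg gens]]] := weights_finitely_generated chX.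
have [_ _ _ gen] := chX.
apply: (facets_exist (weights0 F) _ _ gen Sg gens).
  by move=> u v; apply: weightsD.
by move=> u k; apply: weights_saturated nX chX.
Qed.

Lemma fan_coneE (X : 'rV[K]_n -> Prop) act x0 : zariski_closed X -> X x0 ->
  (forall t, torus t -> X (act t x0)) ->
  forall v, fan_cone X act x0 v <-> lattice_cone (weights (fun t => act t x0)) v.
Proof.
move=> cX X0 Xact v.
have wE u : weight_monoid X act x0 u <-> weights (fun t => act t x0) u.
  split=> [[f [rf hf]]|[p hp]].
    have [p hp] := regular_closed cX rf; exists p => t Tt.
    by rewrite -hp ?hf //; apply: Xact.
  by exists (fun x => p.@[x 0]); split; [apply/regular_pfun/pfun_poly | apply: hp].
by split=> h w [k [a [s [a0 Ss ->]]]]; apply: h; exists k, a, s; split=> // i;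
  have [u Su ->] := Ss i; exists u => //; apply/wE.
Qed.

End WeightFacets.

(** * Cox presentations *)

Section CoxSpace.
Variable K : closedFieldType.
Implicit Types (x y : 'rV[K]_2).

Lemma torus_cox (m : nat) x : torus x -> cox_space m x.
Proof. by move=> Tx j _; apply: Tx. Qed.

Lemma cox_space_principal m x : cox_space m x <->
  True /\ (\prod_(j < 2 | (m <= j)%N) 'X_j : {mpoly K[2]}).@[x 0] != 0.
Proof.
rewrite rmorph_prod /=; split=> [h|[_ h] i im].
  by split=> //; apply/prodf_neq0 => i im; rewrite mevalXU h.
by move/prodf_neq0: h => /(_ i im); rewrite mevalXU.
Qed.

Lemma cox_space_locally_closed m : locally_closed (@cox_space K m).
Proof.
exists (fun=> True); split; first exact: full_closed.
exists (fun f => f = \prod_(j < 2 | (m <= j)%N) 'X_j) => x; rewrite cox_space_principal.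
split=> [[_ h]|[_ h]]; split=> //; first by move=> z; move: h; rewrite z ?eqxx.
by apply/eqP => z; apply: h => f ->.
Qed.

(** A regular function on the Cox space is a polynomial divided by a monomial, and
    the polynomial is zero as soon as its product with [kappa] vanishes on the
    torus. *)
Lemma cox_dense m (f g : 'rV[K]_2 -> K) (kappa : {mpoly K[2]}) : kappa != 0 ->
  regular (cox_space m) f -> regular (cox_space m) g ->
  (forall x, torus x -> kappa.@[x 0] != 0 -> f x = g x) ->
  forall x, cox_space m x -> f x = g x.
Proof.
move=> k0 rf rg fg.
have rd : regular (cox_space m) (fun x => f x + -1 * g x).
  by move=> x Cx; apply: reg_atD; [apply: rf | apply: reg_atM; [apply: reg_at_const | apply: rg]].
have [a [k ha]] := regular_principal (@full_closed K 2) (@cox_space_principal m) rd.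
have a0 : a = 0.
  have : a * kappa = 0.
    apply: torus_nonzero => z Tz; rewrite mevalM; have [->|kz] := eqVneq kappa.@[z 0] 0; first by rewrite mulr0.
    have := ha z (torus_cox (m := m) Tz); rewrite fg // mulN1r subrr => /esym/eqP.
    rewrite mulf_eq0 invr_eq0 expf_eq0; have /cox_space_principal[_ /negbTE->] := torus_cox (m := m) Tz.
    by rewrite andbF orbF => /eqP ->; rewrite mul0r.
  by move/eqP; rewrite mulf_eq0 (negbTE k0) orbF => /eqP.
move=> x Cx; apply/eqP; rewrite -subr_eq0 -mulN1r; apply/eqP.
by rewrite (ha x Cx) a0 meval0 mul0r.
Qed.

Lemma cox_dense_torus m (f g : 'rV[K]_2 -> K) :
  regular (cox_space m) f -> regular (cox_space m) g ->
  (forall x, torus x -> f x = g x) -> forall x, cox_space m x -> f x = g x.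
Proof. by move=> rf rg fg; apply: (cox_dense (oner_neq0 _) rf rg) => x Tx _; apply: fg. Qed.

Lemma cox_dense_row m n (f g : 'rV[K]_2 -> 'rV[K]_n) (kappa : {mpoly K[2]}) V W : kappa != 0 ->
  morphism (cox_space m) V f -> morphism (cox_space m) W g ->
  (forall x, torus x -> kappa.@[x 0] != 0 -> f x = g x) ->
  forall x, cox_space m x -> f x = g x.
Proof.
move=> k0 [_ rf] [_ rg] fg x Cx; apply/rowP => j.
by apply: (cox_dense k0 (rf j) (rg j)) Cx => y Ty ky; rewrite fg.
Qed.

Lemma cox_space_irreducible m : irreducible (@cox_space K m).
Proof.
split; first by exists (const_mx 1); apply: torus_cox => i; rewrite mxE oner_neq0.
move=> C1 C2 [S1 E1] [S2 E2] cov; apply: NNPP => nor; have [n1 n2] := not_or_and _ _ nor.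
have [x1 i1] := not_all_ex_not _ _ n1; have [Cx1 nx1] := imply_to_and _ _ i1.
have [x2 i2] := not_all_ex_not _ _ n2; have [Cx2 nx2] := imply_to_and _ _ i2.
have [f1 S1f f1x] : exists2 f, S1 f & f.@[x1 0] != 0.
  apply: NNPP => none; apply/nx1/E1 => f Sf; apply: NNPP => /eqP h; apply: none; by exists f.
have [f2 S2f f2x] : exists2 f, S2 f & f.@[x2 0] != 0.
  apply: NNPP => none; apply/nx2/E2 => f Sf; apply: NNPP => /eqP h; apply: none; by exists f.
have f0 : f1 * f2 != 0.
  by rewrite mulf_neq0 //; apply/eqP => h; [move: f1x | move: f2x]; rewrite h meval0 eqxx.
case/eqP: f0; apply: torus_nonzero => z Tz; rewrite mevalM.
by have [/E1/(_ _ S1f)|/E2/(_ _ S2f)] := cov z (torus_cox (m := m) Tz) => ->; rewrite ?mul0r ?mulr0.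
Qed.

Definition monomial (q : 'I_2 -> 'rV[int]_2) u x : K := \prod_(j < 2) x 0 j ^ pairing (q j) u.

Lemma monomialE q u x : monomial q u x = x 0 0 ^ pairing (q 0) u * x 0 1 ^ pairing (q 1) u.
Proof. by rewrite /monomial big2. Qed.

Definition nonneg_on (m : nat) (q : 'I_2 -> 'rV[int]_2) (u : 'rV[int]_2) : Prop :=
  forall j : 'I_2, (j < m)%N -> 0 <= pairing (q j) u.

Lemma monomial_regular m q u : nonneg_on m q u -> regular (cox_space m) (monomial q u).
Proof.
move=> Su x Cx; apply: reg_at_prod => j; apply: reg_atXz => //.
  by have [jm|mj] := ltnP j m; [left; apply: Su | right; apply: Cx].
exact/reg_at_pfun/pfun_coord.
Qed.

(** The homomorphism of tori dual to the map of lattices given by [q 0], [q 1]. *)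
Definition torus_map (q : 'I_2 -> 'rV[int]_2) x : 'rV[K]_2 :=
  \row_k \prod_(j < 2) x 0 j ^ q j 0 k.

Lemma torus_mapP q x : torus x -> torus (torus_map q x).
Proof. by move=> Tx k; rewrite mxE; apply/prodf_neq0 => j _; rewrite expfz_neq0. Qed.

Lemma torus_mapE q u x : torus x -> character u (torus_map q x) = monomial q u x.
Proof.
move=> Tx; rewrite characterE monomialE !mxE !big2 !pairingE !expfzMl !exprz_exp !expfzDr ?Tx //.
by rewrite mulrACA.
Qed.

(** In an algebraically closed field every element has roots, hence a
    homomorphism of tori with finite kernel is surjective. *)
Lemma torus_map_surjective q t : cross (q 0) (q 1) != 0 -> torus t ->
  exists2 x, torus x & torus_map q x = t.
Proof.
move=> D0 Tt; set D := cross (q 0) (q 1).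
have root (a : K) : a != 0 -> exists2 b, b != 0 & b ^ D = a.
  move=> a0; pose N := `|D|%N; have N0 : (0 < N)%N by rewrite absz_gt0.
  have [c] : exists c : K, root ('X^N - a%:P) c.
    by apply/closed_rootP; rewrite size_XnsubC // eqSS -lt0n.
  rewrite rootE !hornerE subr_eq0 => /eqP cN.
  have c0 : c != 0 by apply/eqP => z; move: a0; rewrite -cN z expr0n gtn_eqF ?eqxx.
  have [h|h] := lerP 0 D; first by exists c => //; rewrite -(gez0_abs h) -exprnP.
  exists c^-1; first by rewrite invr_eq0.
  by rewrite -[D]opprK -(ltz0_abs h) -exprnN -exprVn invrK.
have [s0 s00 E0] := root _ (Tt 0); have [s1 s10 E1] := root _ (Tt 1).
exists (\row_j (if j == 0 then s0 ^ q 1 0 1 * s1 ^ (- q 1 0 0) else s0 ^ (- q 0 0 1) * s1 ^ q 0 0 0)).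
  by move=> j; rewrite mxE; case: ifP => _; rewrite mulf_neq0 ?expfz_neq0.
apply/rowP; apply: I2_ind; rewrite mxE big2 !mxE /= !expfzMl !exprz_exp mulrACA -!expfzDr //.
  rewrite -[RHS]mulr1 -E0 -(expr0z s1); congr (_ ^ _ * _ ^ _); rewrite /D /cross; ring.
by rewrite -[RHS]mul1r -E1 -(expr0z s0); congr (_ ^ _ * _ ^ _); rewrite /D /cross; ring.
Qed.

End CoxSpace.

Section Presentations.
Variable K : closedFieldType.
Variable n : nat.
Implicit Types (X : 'rV[K]_n -> Prop) (F : 'rV[K]_2 -> 'rV[K]_n) (q : 'I_2 -> 'rV[int]_2).

(** What a Cox construction provides: the pullback identifies the regular
    functions on [X] with the span of the monomials of weight in the cone. *)
Definition cox_presentation X m q (pi : 'rV[K]_2 -> 'rV[K]_n) : Prop :=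
  [/\ facets (nonneg_on m q) m q, morphism (cox_space m) X pi,
      forall p : {mpoly K[n]}, exists (I : finType) (c : I -> K) (u : I -> 'rV[int]_2),
        (forall i, c i != 0 -> nonneg_on m q (u i)) /\
        forall x, cox_space m x -> p.@[pi x 0] = \sum_i c i * monomial q (u i) x,
      forall u, nonneg_on m q u -> exists p : {mpoly K[n]},
        forall x, cox_space m x -> p.@[pi x 0] = monomial q u x
    & forall p : {mpoly K[n]}, (forall x, torus x -> p.@[pi x 0] = 0) -> forall x, X x -> p.@[x 0] = 0].

(** The comorphism of [pi] sends the function of weight [u] to the monomial of
    weight [u]. *)
Definition compatible F m q (pi : 'rV[K]_2 -> 'rV[K]_n) : Prop :=
  forall u (g : {mpoly K[n]}), (forall t, torus t -> g.@[F t 0] = character u t) ->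
  forall x, cox_space m x -> g.@[pi x 0] = monomial q u x.

Lemma facets_nonneg S m q : facets S m q -> facets (nonneg_on m q) m q.
Proof. by case=> m2 cop D0 D1 _. Qed.

(** The expansions into characters and the density of the torus orbit pass to the
    Cox space because [torus_map q] is surjective on tori. *)
Lemma presentation_of_chart X F m q pi : toric_chart X F -> facets (weights F) m q ->
  morphism (cox_space m) X pi -> compatible F m q pi -> cox_presentation X m q pi.
Proof.
move=> chX fS mpi comp; have [XF _ dense _] := chX; have [m2 _ D0 _ SE] := fS.
have expand (p : {mpoly K[n]}) : exists (I : finType) (c : I -> K) (u : I -> 'rV[int]_2),
    [/\ forall i, c i != 0 -> nonneg_on m q (u i),
        forall t, torus t -> p.@[F t 0] = \sum_i c i * character (u i) t &
        forall x, cox_space m x -> p.@[pi x 0] = \sum_i c i * monomial q (u i) x].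
  have [I [c [u [g [hg pF pX]]]]] := chart_polynomials chX p.
  exists I, c, u; split=> // [i ci|x Cx]; first by apply/SE; exists (g i); apply: hg.
  rewrite pX; last exact: mpi.1.
  apply: eq_bigr => i _; have [->|ci] := eqVneq (c i) 0; first by rewrite !mul0r.
  by rewrite (comp (u i)) //; apply: hg.
split=> //; first exact: facets_nonneg fS.
- by move=> p; have [I [c [u [cu _ E]]]] := expand p; exists I, c, u.
- by move=> u /SE[g hg]; exists g; apply: comp hg.
move=> p hp; apply: dense => t Tt.
have [x Tx <-] := torus_map_surjective D0 Tt; have [I [c [u [_ pF pX]]]] := expand p.
rewrite pF; last exact: torus_mapP.
rewrite -[RHS](hp x Tx) pX; last exact: torus_cox.
by apply: eq_bigr => i _; rewrite torus_mapE.
Qed.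

(** The coordinates of [pi] are the expansions of the coordinate functions of [X]
    into characters, with characters replaced by monomials; these are regular on
    the Cox space as the weights are nonnegative on the facets. *)
Lemma cox_map_exists X F m q : zariski_closed X -> toric_chart X F -> facets (weights F) m q ->
  exists pi, [/\ morphism (cox_space m) X pi, compatible F m q pi
    & forall x, torus x -> pi x = F (torus_map q x)].
Proof.
move=> cX chX fS; have [XF _ dense _] := chX; have [_ _ _ _ SE] := fS.
have /fin_all_exists[I /fin_all_exists[c /fin_all_exists[u /fin_all_exists[g hg]]]] (j : 'I_n) :=
  chart_polynomials chX 'X_j.
pose pi x := \row_j \sum_i c j i * monomial q (u j i) x : 'rV[K]_n.
have piT x : torus x -> pi x = F (torus_map q x).
  move=> Tx; apply/rowP => j; have [_ E _] := hg j.
  rewrite mxE -(mevalXU (F (torus_map q x) 0) j) E; last exact: torus_mapP.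
  by apply: eq_bigr => i _; rewrite torus_mapE.
have rpi j : regular (cox_space m) (fun x => pi x 0 j).
  apply: (@regular_eq _ _ _ _ (fun x => \sum_i c j i * monomial q (u j i) x)).
    by move=> x _; rewrite mxE.
  move=> x Cx; apply: reg_at_sum => i; have [h _ _] := hg j.
  have [->|ci] := eqVneq (c j i) 0.
    by apply: (reg_at_eq _ (reg_at_const _ 0 x)) => y _; rewrite mul0r.
  apply: reg_atM; first exact: reg_at_const.
  by apply: (monomial_regular _ Cx); apply/SE; exists (g j i); apply: h.
have rp (p : {mpoly K[n]}) : regular (cox_space m) (fun x => p.@[pi x 0]).
  by move=> x Cx; apply: reg_at_meval => j; apply: rpi.
exists pi; split=> //.
- split=> // x Cx; have [S XS] := cX; apply/XS => p Sp.
  apply: (cox_dense_torus (rp p) (regular_pfun (pfun_const _ 0))) Cx => y Ty.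
  by rewrite piT //; have /XS := XF _ (torus_mapP q Ty); apply.
move=> v p hp; apply: (cox_dense_torus (rp p)).
  by apply: monomial_regular; apply/SE; exists p.
by move=> x Tx; rewrite piT // hp ?torus_mapE //; apply: torus_mapP.
Qed.

End Presentations.

Section CoxConstruction.
Variable K : closedFieldType.
Hypothesis char0 : [pchar K] =i pred0.
Variable n : nat.
Variables (X : 'rV[K]_n -> Prop) (act : 'rV[K]_2 -> 'rV[K]_n -> 'rV[K]_n) (x0 : 'rV[K]_n).
Hypotheses (surfX : normal_affine_surface X) (torX : toric_structure X act x0).

Lemma fan_cone_weights : zariski_closed X -> X x0 -> (forall t, torus t -> X (act t x0)) ->
  fan_cone X act x0 = lattice_cone (weights (fun t => act t x0)).
Proof.
move=> cX X0 XF; apply: FunctionalExtensionality.functional_extensionality => v.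
exact/PropExtensionality.propositional_extensionality/fan_coneE.
Qed.

Lemma cox_construction_exists : exists m q pi, cox_construction X act x0 m q pi.
Proof.
have [cX iX _ nX] := surfX; have chX := toric_structure_chart char0 cX iX torX.
have [_ _ X0 _] := torX; have [XF _ _ _] := chX.
have coneE := fan_cone_weights cX X0 XF.
have [m [q fS]] := chart_facets nX chX; have [pi [mpi comp _]] := cox_map_exists cX chX fS.
exists m, q, pi; split=> [||u f [rf fu] x Cx].
- by rewrite coneE; apply: cox_vectors_of_facets.
- exact: mpi.
have [g fg] := regular_closed cX rf.
rewrite fg; last exact: mpi.1.
by apply: comp Cx => t Tt; rewrite -fg ?fu //; apply: XF.
Qed.

Lemma presentation_of_cox_construction m q pi :
  cox_construction X act x0 m q pi -> cox_presentation X m q pi.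
Proof.
move=> [cq mpi cpi]; have [cX iX _ nX] := surfX; have chX := toric_structure_chart char0 cX iX torX.
have [_ _ X0 _] := torX; have [XF _ _ _] := chX.
have coneE := fan_cone_weights cX X0 XF.
have [m' [q' fS']] := chart_facets nX chX.
have fS : facets (weights (fun t => act t x0)) m q.
  by apply: (facets_of_cox_vectors fS'); rewrite -coneE.
apply: (presentation_of_chart chX fS mpi) => u g gu x Cx.
rewrite (cpi u (fun y => g.@[y 0])) //; split=> //.
exact/regular_pfun/pfun_poly.
Qed.

End CoxConstruction.

Section UnimodularPresentation.
Variable K : closedFieldType.
Variable n : nat.
Variables (X : 'rV[K]_n -> Prop) (m : nat) (q : 'I_2 -> 'rV[int]_2) (pi : 'rV[K]_2 -> 'rV[K]_n).
Hypotheses (cX : zariski_closed X) (pres : cox_presentation X m q pi).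

(** The image of the torus of the Cox space is dense in [X]. *)
Lemma presentation_eq (f g : 'rV[K]_n -> K) : regular X f -> regular X g ->
  (forall x, torus x -> f (pi x) = g (pi x)) -> forall x, X x -> f x = g x.
Proof.
move=> rf rg fg x Xx; have [_ mpi _ _ dense] := pres.
have [a fa] := regular_closed cX rf; have [b gb] := regular_closed cX rg.
rewrite fa // gb //; apply/eqP; rewrite -subr_eq0 -mevalB; apply/eqP; apply: dense Xx => y Ty.
have Xy : X (pi y) by apply: mpi.1; apply: torus_cox.
by rewrite mevalB -fa // -gb // fg // subrr.
Qed.

(** For a basis [q 0], [q 1] of the lattice the coordinates are themselves
    monomials, with weights the vectors of the dual basis. *)
Lemma unimodular_isomorphism : `|cross (q 0) (q 1)| = 1 -> isomorphism (cox_space m) X pi.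
Proof.
move=> D1; have [fS mpi _ real dense] := pres.
have monE j (x : 'rV[K]_2) : monomial q (dual_vector q j) x = x 0 j.
  rewrite monomialE !dual_vectorE D1; move: j; apply: I2_ind; rewrite /= expr1z ?mulr1 //.
  by rewrite mul1r.
have /fin_all_exists[p hp] (j : 'I_2) := real _ (dual_vector_weight fS j).
pose G (y : 'rV[K]_n) : 'rV[K]_2 := \row_j (p j).@[y 0].
have mG : morphism X (cox_space m) G.
  split=> [y Xy j mj|j].
    have [p' hp'] := real _ (dual_vector_unit fS mj).
    suff E : (p j).@[y 0] * p'.@[y 0] = 1.
      by rewrite mxE; apply/eqP => z; move/eqP: E; rewrite z mul0r eq_sym oner_eq0.
    rewrite -mevalM; apply: (presentation_eq (f := fun y => (p j * p').@[y 0]) (g := fun=> 1)) Xy.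
    - exact/regular_pfun/pfun_poly.
    - exact/regular_pfun/pfun_const.
    move=> x Tx; have Cx := torus_cox (m := m) Tx; rewrite mevalM hp // hp' //.
    rewrite -!torus_mapE // -characterD; last exact: torus_mapP.
    by rewrite subrr character0.
  by apply: (@regular_eq _ _ _ _ (fun y => (p j).@[y 0])) => [x _|]; rewrite ?mxE //; apply/regular_pfun/pfun_poly.
have GK x : cox_space m x -> G (pi x) = x.
  by move=> Cx; apply/rowP => j; rewrite mxE hp // monE.
have piK y : X y -> pi (G y) = y.
  move=> Xy; apply/rowP => l.
  apply: (presentation_eq (f := fun y => pi (G y) 0 l) (g := fun y => y 0 l)) Xy.
  - exact: (morphism_comp mG mpi).2.
  - exact/regular_pfun/pfun_coord.
  by move=> x Tx; rewrite GK //; apply: torus_cox.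
exact: isomorphism_of mpi mG GK piK.
Qed.

End UnimodularPresentation.

(** * The product in Cox coordinates *)

Section Products.
Variable K : closedFieldType.
Implicit Types (m : nat) (x y : 'rV[K]_2) (nu : 'rV[K]_2 -> 'rV[K]_2 -> 'rV[K]_2).

Lemma vec2E0 (a b : K) : vec2 a b 0 0 = a. Proof. by rewrite mxE. Qed.
Lemma vec2E1 (a b : K) : vec2 a b 0 1 = b. Proof. by rewrite mxE. Qed.
Definition vec2E := (vec2E0, vec2E1).

Lemma row2_eq x y : x 0 0 = y 0 0 -> x 0 1 = y 0 1 -> x = y.
Proof. by move=> e0 e1; apply/rowP; apply: I2_ind. Qed.

(** A commutative product only needs a left unit; regularity is asked pointwise to
    match the closure properties of [reg_at]. *)
Lemma cox_algebraic_monoid m nu e : (forall x y, cox_space m x -> cox_space m y -> cox_space m (nu x y)) ->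
  (forall j z, product (cox_space m) (cox_space m) z ->
     reg_at (product (cox_space m) (cox_space m)) (fun z => nu (lsubmx z) (rsubmx z) 0 j) z) ->
  (forall x y z, cox_space m x -> cox_space m y -> cox_space m z -> nu (nu x y) z = nu x (nu y z)) ->
  (forall x y, nu x y = nu y x) ->
  cox_space m e -> (forall x, cox_space m x -> nu e x = x) ->
  algebraic_monoid (cox_space m) nu.
Proof.
move=> stab reg assoc comm Ce unit; split.
- by split; [apply: cox_space_locally_closed | apply: cox_space_irreducible].
- by split=> [z [Cl Cr]|j z Cz]; [apply: stab | apply: reg].
- exact: assoc.
by exists e; split=> // x Cx; rewrite [nu x e]comm unit.
Qed.

Lemma reg_at_lsub V (j : 'I_2) (z : 'rV[K]_(2 + 2)) : reg_at V (fun z : 'rV[K]_(2 + 2) => lsubmx z 0 j) z.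
Proof. exact/reg_at_pfun/pfun_lsubmx. Qed.

Lemma reg_at_rsub V (j : 'I_2) (z : 'rV[K]_(2 + 2)) : reg_at V (fun z : 'rV[K]_(2 + 2) => rsubmx z 0 j) z.
Proof. exact/reg_at_pfun/pfun_rsubmx. Qed.

Lemma vec2_stab m a b : ((m <= 0)%N -> a != 0) -> ((m <= 1)%N -> b != 0) -> cox_space (K:=K) m (vec2 a b).
Proof. by move=> ha hb; apply: I2_ind => h; rewrite vec2E; [apply: ha | apply: hb]. Qed.

Lemma mulGmGm_monoid m : algebraic_monoid (cox_space (K:=K) m) (@mulGmGm K).
Proof.
apply: (@cox_algebraic_monoid _ _ (const_mx 1)).
- by move=> x y Cx Cy; apply: vec2_stab => h; rewrite mulf_neq0 ?Cx ?Cy.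
- move=> + z Cz; apply: I2_ind.
    apply: (@reg_at_eq _ _ _ _ (fun z : 'rV[K]_(2 + 2) => lsubmx z 0 0 * rsubmx z 0 0)) => [w _|].
      by rewrite vec2E.
    by apply: reg_atM; [apply: reg_at_lsub | apply: reg_at_rsub].
  apply: (@reg_at_eq _ _ _ _ (fun z : 'rV[K]_(2 + 2) => lsubmx z 0 1 * rsubmx z 0 1)) => [w _|].
    by rewrite vec2E.
  by apply: reg_atM; [apply: reg_at_lsub | apply: reg_at_rsub].
- by move=> x y z _ _ _; apply: row2_eq; rewrite !vec2E mulrA.
- by move=> x y; apply: row2_eq; rewrite !vec2E mulrC.
- by move=> j _; rewrite mxE oner_neq0.
by move=> x _; apply: row2_eq; rewrite !vec2E mxE mul1r.
Qed.

Lemma mulGaGa_monoid : algebraic_monoid (cox_space (K:=K) 2) (@mulGaGa K).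
Proof.
have C2 x : cox_space 2 x by apply: I2_ind.
apply: (@cox_algebraic_monoid _ _ 0) => //.
- move=> + z Cz; apply: I2_ind.
    apply: (@reg_at_eq _ _ _ _ (fun z : 'rV[K]_(2 + 2) => lsubmx z 0 0 + rsubmx z 0 0)) => [w _|].
      by rewrite vec2E.
    by apply: reg_atD; [apply: reg_at_lsub | apply: reg_at_rsub].
  apply: (@reg_at_eq _ _ _ _ (fun z : 'rV[K]_(2 + 2) => lsubmx z 0 1 + rsubmx z 0 1)) => [w _|].
    by rewrite vec2E.
  by apply: reg_atD; [apply: reg_at_lsub | apply: reg_at_rsub].
- by move=> x y z _ _ _; apply: row2_eq; rewrite !vec2E addrA.
- by move=> x y; apply: row2_eq; rewrite !vec2E addrC.
by move=> x _; apply: row2_eq; rewrite !vec2E mxE add0r.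
Qed.

Lemma mulGaGm_monoid m (d : int) : (0 < m)%N -> ((1 < m)%N -> 0 <= d) ->
  algebraic_monoid (cox_space (K:=K) m) (mulGaGm d).
Proof.
move=> m0 d0; have nm : (m <= 0)%N -> False by rewrite leqNgt m0.
have side (x : 'rV[K]_2) : cox_space m x -> 0 <= d \/ x 0 1 != 0.
  by move=> Cx; have [/d0|h] := ltnP 1 m; [left | right; apply: Cx].
apply: (@cox_algebraic_monoid _ _ (vec2 0 1)).
- by move=> x y Cx Cy; apply: vec2_stab => h; [case: (nm h) | rewrite mulf_neq0 ?Cx ?Cy].
- move=> + z [Cl Cr]; apply: I2_ind.
    apply: (@reg_at_eq _ _ _ _ (fun z : 'rV[K]_(2 + 2) =>
      lsubmx z 0 0 * rsubmx z 0 1 ^ d + lsubmx z 0 1 ^ d * rsubmx z 0 0)) => [w _|].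
      by rewrite vec2E.
    apply: reg_atD; apply: reg_atM; do ?[exact: reg_at_lsub | exact: reg_at_rsub];
      apply: reg_atXz; do ?[exact: side | exact: reg_at_lsub | exact: reg_at_rsub]; by split.
  apply: (@reg_at_eq _ _ _ _ (fun z : 'rV[K]_(2 + 2) => lsubmx z 0 1 * rsubmx z 0 1)) => [w _|].
    by rewrite vec2E.
  by apply: reg_atM; [apply: reg_at_lsub | apply: reg_at_rsub].
- by move=> x y z _ _ _; apply: row2_eq; rewrite !vec2E ?expfzMl; ring.
- by move=> x y; apply: row2_eq; rewrite !vec2E; ring.
- by apply: vec2_stab => [/nm //|_]; rewrite oner_neq0.
by move=> x _; apply: row2_eq; rewrite !vec2E ?exp1rz ?mul0r ?mul1r ?add0r.
Qed.

Variable n : nat.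

(** The torus is dense in the Cox space, so a product that is compatible with
    the multiplication there is compatible everywhere. *)
Lemma coherent_of_torus m (X : 'rV[K]_n -> Prop) mu pi nu :
  morphism (cox_space m) X pi -> morphism2 X X X mu ->
  morphism2 (cox_space m) (cox_space m) (cox_space m) nu ->
  (forall x y, torus x -> torus y -> pi (nu x y) = mu (pi x) (pi y)) ->
  coherent m pi mu nu.
Proof.
move=> mpi mmu mnu h.
have half x y : cox_space m x -> torus y -> pi (nu x y) = mu (pi x) (pi y).
  move=> Cx Ty; have Cy := torus_cox (m := m) Ty; move: x Cx.
  apply: (cox_dense_row (kappa := 1) (V := X) (W := X)); first exact: oner_neq0.
  - exact: (morphism_comp (morphism2_comp (morphism_id _) (morphism_const _ Cy) mnu) mpi).
  - exact: (morphism2_comp mpi (morphism_const _ (mpi.1 _ Cy)) mmu).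
  by move=> x Tx _; apply: h.
move=> x y Cx; move: y.
apply: (cox_dense_row (kappa := 1) (V := X) (W := X)); first exact: oner_neq0.
- exact: (morphism_comp (morphism2_comp (morphism_const _ Cx) (morphism_id _) mnu) mpi).
- exact: (morphism2_comp (morphism_const _ (mpi.1 _ Cx)) mpi mmu).
by move=> y Ty _; apply: half.
Qed.

End Products.

Section RankOneFacets.
Variables (S : 'rV[int]_2 -> Prop) (m : nat) (q : 'I_2 -> 'rV[int]_2).
Hypothesis fS : facets S m q.

(** The second coordinate of a weight is the exponent of the additive coordinate of
    the group: it is nonnegative, and translations lower it. *)
Hypothesis height : forall u, S u -> 0 <= u 0 1.
Hypothesis lower : forall u, S u -> 0 < u 0 1 -> S (u - delta_mx 0 1).

Lemma facets_swap : m = 2%N -> facets S m (fun j => q (if j == 0 then 1 else 0)).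
Proof.
have [m2 cop D0 D1 SE] := fS => mE; rewrite mE; split=> //=.
- by move=> j _; apply: cop; rewrite mE.
- by rewrite crossC oppr_eq0.
move=> u; split=> [/SE h j _|h]; first by apply: h; rewrite mE.
apply/SE => j _; have := h (if j == 0 then 1 else 0); move: j; apply: I2_ind; exact.
Qed.

(** Up to the factor [|D|] the vector [(0, 1)] is [c 0 *: q 0 + c 1 *: q 1], where
    [c j >= 0] is the height of the dual vector of [q j].  If [c i > 0], lowering the
    dual vector of [q i] shows that the other [q j] has a second coordinate that is at
    most 0.  Both [c j] cannot be positive, as then both second coordinates would be
    at most 0; so [(0, 1)] is one of the [q j]. *)
Lemma rank_one_facets : (0 < m)%N /\ exists q', [/\ facets S m q',
  q' 0 = delta_mx 0 1 & (1 < m)%N -> q' 1 0 1 <= 0].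
Proof.
have [m2 cop D0 _ SE] := fS; set D := cross (q 0) (q 1) in D0.
pose c j := dual_vector q j 0 1.
have c0 j : 0 <= c j by apply: height; apply: dual_vector_weight fS j.
have cm (j : 'I_2) : (m <= j)%N -> c j = 0.
  move=> /(dual_vector_unit fS) /height; rewrite mxE oppr_ge0 => h.
  by apply/eqP; rewrite eq_le h c0.
have low (i j : 'I_2) : (j < m)%N -> j != i -> 0 < c i -> q j 0 1 <= 0.
  move=> jm ji ci; have /SE/(_ _ jm) := lower (dual_vector_weight fS i) ci.
  rewrite pairingD dual_vectorE (negbTE ji) add0r pairingE !mxE /= oppr0 mulr0 add0r.
  by rewrite mulrN mulr1 oppr_ge0.
have E0 : c 0 * q 0 0 0 + c 1 * q 1 0 0 = 0.
  by rewrite /c /dual_vector /= !mxE /= /D /cross; ring.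
have E1 : c 0 * q 0 0 1 + c 1 * q 1 0 1 = `|D|.
  have -> : `|D| = sgz D * D by rewrite normrEsg.
  rewrite /c /dual_vector /= !mxE /= -/D; move: (sgz D) => s; rewrite /D /cross; ring.
have Dp : 0 < `|D| by rewrite normr_gt0.
have vertical (i j : 'I_2) : c j = 0 -> c i * q i 0 0 = 0 -> c i * q i 0 1 = `|D| ->
    (i < m)%N /\ q i = delta_mx 0 1.
  move=> cj e0 e1; have im : (i < m)%N.
    by rewrite ltnNge; apply/negP => /cm z; move: Dp; rewrite -e1 z mul0r ltxx.
  have ci : 0 < c i by rewrite lt_neqAle c0 andbT eq_sym; apply/eqP => z; move: Dp; rewrite -e1 z mul0r ltxx.
  split=> //; have q0 : q i 0 0 = 0 by move/eqP: e0; rewrite mulf_eq0 gt_eqF //= => /eqP.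
  have qp : 0 < q i 0 1 by move: Dp; rewrite -e1 pmulr_rgt0.
  have := cop i im; rewrite q0 /coprimez gcd0z => /eqP h.
  apply: rV2_eq; rewrite !mxE /= ?q0 //.
  by move: h; rewrite -[RHS]/(1%:Z); lia.
have [c1z|c1p] := eqVneq (c 1) 0.
  move: E0 E1; rewrite c1z !mul0r !addr0 => e0 e1.
  have [m0 qE] := vertical 0 1 c1z e0 e1.
  split=> //; exists q; split=> // m1; apply: (low 0) => //.
  by rewrite lt_neqAle c0 andbT eq_sym; apply/eqP => z; move: Dp; rewrite -e1 z mul0r ltxx.
have c1g : 0 < c 1 by rewrite lt_neqAle c0 eq_sym c1p.
have m1 : (1 < m)%N by rewrite ltnNge; apply/negP => /(cm 1) z; rewrite z ltxx in c1g.
have mE : m = 2%N by apply/eqP; rewrite eqn_leq m2.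
have [c0z|c0p] := eqVneq (c 0) 0.
  move: E0 E1; rewrite c0z !mul0r !add0r => e0 e1.
  have [_ qE] := vertical 1 0 c0z e0 e1.
  split; first by rewrite mE.
  exists (fun j => q (if j == 0 then 1 else 0)); split=> //=; first exact: facets_swap.
  by move=> _; apply: (low 1) => //; rewrite mE.
have c0g : 0 < c 0 by rewrite lt_neqAle c0 eq_sym c0p.
have q0 : q 0 0 1 <= 0 by apply: (low 1) => //; rewrite mE.
have q1 : q 1 0 1 <= 0 by apply: (low 0).
exfalso; move: Dp; rewrite -E1; nia.
Qed.

End RankOneFacets.

Section MonoidPresentation.
Variable K : closedFieldType.
Hypothesis char0 : [pchar K] =i pred0.
Variable n : nat.
Variables (X : 'rV[K]_n -> Prop) (mu : 'rV[K]_n -> 'rV[K]_n -> 'rV[K]_n).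

Lemma weight_expansion r F (W : 'rV[K]_n -> Prop) u : morphism (group_space r) W F -> weights F u ->
  exists (p : {mpoly K[n]}) P N i j,
    [/\ forall z, group_space r z -> p.@[F z 0] = eval2 P (z 0 0) (z 0 1) / den r z ^+ N,
        P`_j`_i != 0 & u = expo r i j N].
Proof.
move=> mF [p hp]; have [P [N hP]] := laurent_form (regular_pullback p mF).
have [[j i] /= Pji <-] := @character_occurs K _ _ _ u (fun t Tt =>
  etrans (esym (hp t Tt)) (etrans (hP t (torus_group Tt)) (laurent_characters r P N Tt))).
by exists p, P, N, i, j.
Qed.

Lemma rank_one_lower F (W : 'rV[K]_n -> Prop) u : morphism (group_space 1) W F -> stable 1 F ->
  weights F u -> 0 <= u 0 1 /\ (0 < u 0 1 -> weights F (u - delta_mx 0 1)).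
Proof.
move=> mF st Su; have [p [P [N [i [j [hP Pji ->]]]]]] := weight_expansion mF Su.
rewrite !mxE /= subr0; split=> // j0.
have := monomial_closed1_full char0 st hP Pji.
case: j j0 {Pji} => [|j] // _ pulled_u.
have [|p' hp'] := translation_derivation (i := i) (N := N) char0 st (q := 'X^(j.+1)).
  by have [g hg] := pulled_u; exists g => z Gz; rewrite hg // hornerXn.
exists ((j.+1)%:R^-1 *: p') => t Tt; rewrite mevalZ hp'; last exact: torus_group.
have -> : expo 1 i j.+1 N - delta_mx 0 1 = expo 1 i j N.
  apply: rV2_eq; rewrite !mxE /= ?subr0 //; lia.
rewrite character_expo // derivXn hornerMn hornerXn /= -[t 0 1 ^+ j *+ _]mulr_natl.
have j0 : (j.+1)%:R != 0 :> K by rewrite natr_eq0.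
move: (j.+1%:R : K) (den 1 t ^+ N)^-1 j0 => a D a0; by field.
Qed.

(** In rank one [e] is a Demazure root of the facet [q 0]; the exponent of the
    product is its value on the other facet. *)
Definition standard_product (r m : nat) (q : 'I_2 -> 'rV[int]_2) (nu : 'rV[K]_2 -> 'rV[K]_2 -> 'rV[K]_2) : Prop :=
  [\/ r = 2%N /\ nu = @mulGmGm K,
      [/\ r = 1%N, (0 < m)%N & exists e, [/\ pairing (q 0) e = -1,
        (1 < m)%N -> 0 <= pairing (q 1) e & nu = mulGaGm (pairing (q 1) e)]]
    | [/\ r = 0%N, m = 2%N, `|cross (q 0) (q 1)| = 1 & nu = @mulGaGa K]].
(** In the coordinates of the group of units the map [pi] is the homomorphism
    [torus_map q], and the product becomes the standard one because the group law is
    known there.  In rank one [q 0 = (0, 1)], so that the homomorphism is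
    [(x_0, x_1) |-> (x_1 ^ b, x_0 x_1 ^ c)] with [q 1 = (b, c)]; it is defined for
    [x_0 = 0], and it maps the product with exponent [- c] to the law of
    [G_m x G_a].  In rank zero the group of units is all of [X]. *)
Lemma monoid_presentation r : normal_affine_surface X -> commutative_monoid_of_rank X mu r ->
  exists m q pi nu, [/\ cox_presentation X m q pi, algebraic_monoid (cox_space m) nu,
    coherent m pi mu nu & standard_product r m q nu].
Proof.
move=> [cX iX dX nX] comm_mu; have [r2 [F [G up]]] := rank_data cX iX dX comm_mu.
have [[[_ mmu assoc [e ue]] comm] _] := comm_mu.
have [chX st inv0] := unit_parametrization_chart char0 cX iX mmu assoc comm ue r2 up.
have [mF mG GF FG mulF] := up.
have mFX : morphism (group_space r) X F by split=> [z /mF.1[]|]; last exact: mF.2.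
case: r r2 {comm_mu up} st inv0 mF mG GF FG mulF mFX => [_|[_|[_|//]]] st inv0 mF mG GF FG mulF mFX.
- have G0 z : group_space (K := K) 0 z by [].
  have C2 z : cox_space (K := K) 2 z by apply: I2_ind.
  have mGX : morphism X (group_space (K := K) 0) G by apply: (morphism_sub _ mG) => x; apply: inv0.
  have /fin_all_exists[g hg] (j : 'I_2) := regular_closed cX (mGX.2 j).
  pose q (j : 'I_2) : 'rV[int]_2 := delta_mx 0 j.
  have qE j u : pairing (q j) u = u 0 j.
    by rewrite pairingE /q; move: j; apply: I2_ind; rewrite !mxE /= ?mul0r ?mul1r ?addr0 ?add0r.
  have fS : facets (weights F) 2 q.
    have D1 : cross (q 0) (q 1) = 1 by rewrite /cross /q !mxE /= mulr1 mulr0 subr0.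
    split=> //; first by move=> j _; rewrite /q; move: j; apply: I2_ind; rewrite !mxE.
      by rewrite D1.
    move=> u; split=> [Su j _|h].
      have [p [P [N [i [k [_ _ ->]]]]]] := weight_expansion mFX Su.
      by rewrite qE mxE subr0; case: ifP.
    exists (g 0 ^+ absz (u 0 0) * g 1 ^+ absz (u 0 1)) => t Tt.
    have Xt : X (F t) by apply: mFX.1.
    rewrite mevalM !rmorphXn /= -!hg // GF // characterE.
    have := h 0 isT; have := h 1 isT; rewrite !qE => h1 h0.
    by rewrite -{2}(gez0_abs h0) -{2}(gez0_abs h1).
  have mF2 : morphism (cox_space 2) X F by apply: (morphism_sub _ mFX).
  exists 2%N, q, F, (@mulGaGa K); split.
  + apply: (presentation_of_chart chX fS mF2) => u p hp.
    have Su : weights F u by exists p.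
    apply: (cox_dense_torus (regular_comp mF2 (regular_pfun (pfun_poly p)))).
      by apply: monomial_regular; case: fS => _ _ _ _ SE; apply/SE.
    move=> x Tx; rewrite hp // characterE monomialE.
    by rewrite !qE.
  + exact: mulGaGa_monoid.
  + by move=> x y _ _; rewrite -mulF //; congr F; apply: row2_eq; rewrite !vec2E !mxE.
  by apply: Or33; split=> //; rewrite /cross /q !mxE /= mulr1 mulr0 subr0.
- have [m' [q' fS']] := chart_facets nX chX.
  have [m0 [q [fS q0 q1]]] := rank_one_facets fS' (fun u Su => (rank_one_lower mFX st Su).1)
    (fun u Su => (rank_one_lower mFX st Su).2).
  have [pi [mpi comp piT]] := cox_map_exists cX chX fS.
  pose e1 : 'rV[int]_2 := - delta_mx 0 1; pose d := pairing (q 1) e1.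
  have dE : d = - q 1 0 1 by rewrite /d /e1 pairingE !mxE /=; ring.
  have d0 : (1 < m')%N -> 0 <= d by move=> /q1; rewrite dE oppr_ge0.
  have mnu := mulGaGm_monoid K m0 d0.
  have TE (x : 'rV[K]_2) : torus_map q x = vec2 (x 0 1 ^ q 1 0 0) (x 0 0 * x 0 1 ^ q 1 0 1).
    by apply: row2_eq; rewrite vec2E mxE big2 q0 !mxE /= ?expr0z ?mul1r ?expr1z.
  have TP (x : 'rV[K]_2) : cox_space 1 x -> group_space 1 (torus_map q x).
    by move=> Cx; rewrite TE; apply: I2_ind => // _; rewrite vec2E expfz_neq0 ?Cx.
  have sub1 (x : 'rV[K]_2) : cox_space 1 x -> cox_space m' x.
    by move=> Cx j mj; apply: Cx; apply: leq_trans mj.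
  have piU : forall x : 'rV[K]_2, cox_space 1 x -> pi x = F (torus_map q x).
    apply: (cox_dense_row (kappa := 1) (g := fun x => F (torus_map q x)) (V := X) (W := X)); first exact: oner_neq0.
    + exact: morphism_sub sub1 mpi.
    + apply: (morphism_comp (W := group_space 1)) mFX; split; first exact: TP.
      move=> j y Cy; move: j; apply: I2_ind.
        apply: (@reg_at_eq _ _ _ _ (fun y : 'rV[K]_2 => y 0 1 ^ q 1 0 0)) => [w _|].
          by rewrite TE vec2E.
        by apply: reg_atXz; [exact: Cy | right; apply: Cy | exact/reg_at_pfun/pfun_coord].
      apply: (@reg_at_eq _ _ _ _ (fun y : 'rV[K]_2 => y 0 0 * y 0 1 ^ q 1 0 1)) => [w _|].
        by rewrite TE vec2E.
      apply: reg_atM; first exact/reg_at_pfun/pfun_coord.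
      by apply: reg_atXz; [exact: Cy | right; apply: Cy | exact/reg_at_pfun/pfun_coord].
    by move=> y Ty _; apply: piT.
  exists m', q, pi, (mulGaGm d); split.
  + exact: presentation_of_chart chX fS mpi comp.
  + exact: mnu.
  + have [_ mor _ _] := mnu; apply: (coherent_of_torus mpi mmu mor) => x y Tx Ty.
    have Cx := torus_cox (m := 1) Tx; have Cy := torus_cox (m := 1) Ty.
    rewrite !piU //; last by apply: vec2_stab => // _; rewrite mulf_neq0.
    rewrite -mulF; do ?exact: TP; congr F; rewrite !TE.
    have E (a : K) : a != 0 -> a ^ d * a ^ q 1 0 1 = 1.
      by move=> a0; rewrite -expfzDr // dE addNr expr0z.
    apply: row2_eq; rewrite !vec2E !mxE /= ?expfzMl //.
    move: (E _ (Tx 1)) (E _ (Ty 1)); move: (x 0 1 ^ d) (x 0 1 ^ q 1 0 1) (y 0 1 ^ d) (y 0 1 ^ q 1 0 1) => a b a' b' Ex Ey.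
    by rewrite mulrDl -[x 0 0 * b]mulr1 -[y 0 0 * b']mulr1 -{1}Ey -Ex; congr (_ + _); ring.
  apply: Or32; split=> //; exists e1; split=> //.
  by rewrite q0 /e1 pairingE !mxE.
have [m [q fS]] := chart_facets nX chX.
have [pi [mpi comp piT]] := cox_map_exists cX chX fS.
have mnu := mulGmGm_monoid K m.
exists m, q, pi, (@mulGmGm K); split.
- exact: presentation_of_chart chX fS mpi comp.
- exact: mnu.
- have [_ mor _ _] := mnu; apply: (coherent_of_torus mpi mmu mor) => x y Tx Ty.
  have Txy : torus (mulGmGm x y) by apply: I2_ind; rewrite vec2E mulf_neq0.
  have gT z : torus z -> group_space 2 (torus_map q z) by move=> Tz; apply/group_space2/torus_mapP.
  rewrite !piT // -mulF; do ?exact: gT; congr F.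
  by apply/rowP => k; rewrite !mxE ltn_ord !big2 !vec2E !expfzMl mulrACA.
by apply: Or31.
Qed.

End MonoidPresentation.

(** * Powers in the ring of bivariate polynomials *)

Section GcdPower.
Variable R : idomainType.
Implicit Types a b g : {poly R}.

(** Two coprime factors of an [N]-th power are [N]-th powers, up to constants of
    the fraction field: the root of a factor is its gcd with the given root. *)
Lemma gcdp_power N a b g : (0 < N)%N -> a != 0 -> coprimep a b -> a * b %= g ^+ N ->
  gcdp a g ^+ N %= a.
Proof.
case: N => // N _ a0 cab; set d := gcdp a g => abg.
have d0 : d != 0 by rewrite gcdp_eq0 negb_and a0.
have quot x : d %| x -> x %/ d * d %= x.
  rewrite Pdiv.Idomain.dvdp_eq => /eqP <-; apply: eqp_scale.
  by rewrite expf_neq0 // lead_coef_eq0.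
have da := quot _ (dvdp_gcdl a g); have dg := quot _ (dvdp_gcdr a g).
have co : coprimep (a %/ d) (g %/ d) by rewrite coprimep_div_gcd // a0.
set a1 := a %/ d in da co *; set g1 := g %/ d in dg co *.
have H : a1 * b %= d ^+ N * g1 ^+ N.+1.
  rewrite -(eqp_mul2r _ _ d0) mulrAC; apply: eqp_trans (eqp_mulr _ da) _.
  apply: eqp_trans abg _; rewrite eqp_sym mulrAC -exprSr -exprMn mulrC mulrC.
  by apply: eqp_exp; rewrite mulrC.
have d1 : a1 %| d ^+ N.
  by rewrite -(Gauss_dvdpl _ (coprimep_expr N.+1 co)) -(eqp_dvdr _ H) dvdp_mulr.
have d2 : d ^+ N %| a1.
  have cdb : coprimep (d ^+ N) b by apply/coprimep_expl/(coprimep_dvdr (dvdp_gcdl a g)).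
  by rewrite -(Gauss_dvdpl _ cdb) (eqp_dvdr _ H) dvdp_mulr.
have E : d ^+ N %= a1 by apply/andP.
by rewrite exprSr; apply: eqp_trans (eqp_mulr _ E) da.
Qed.

End GcdPower.

Section BivariatePowers.
Variable K : closedFieldType.
Implicit Types (P Q a b g h : {poly {poly K}}) (c : {poly K}) (x y : K).

Local Notation spec x := (map_poly (horner_eval x)).

(** In two variables: no common factor [x - x_0] of the coefficients. *)
Definition primitive P : Prop := forall x, spec x P != 0.

Lemma primitiveM P Q : primitive P -> primitive Q -> primitive (P * Q).
Proof. by move=> pP pQ x; rewrite rmorphM mulf_neq0 ?pP ?pQ. Qed.

Lemma primitiveX P k : primitive P -> primitive (P ^+ k).
Proof. by move=> pP x; rewrite rmorphXn expf_neq0 ?pP. Qed.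

Lemma primitive_neq0 P : primitive P -> P != 0.
Proof. by move=> pP; apply/eqP => z; move: (pP 0); rewrite z rmorph0 eqxx. Qed.

Lemma spec_polyC x c : spec x c%:P = (c.[x])%:P.
Proof. by rewrite map_polyC. Qed.

Lemma eval2C c x y : eval2 c%:P x y = c.[x].
Proof. by rewrite /eval2 hornerC. Qed.

(** Factors [x - x_0] are split off until none is left; each of them lowers the
    degree of the leading coefficient. *)
Lemma content P : P != 0 -> exists c Q, [/\ c != 0, P = c%:P * Q & primitive Q].
Proof.
have [s] := ubnP (size (lead_coef P)); elim: s P => // s IH P.
rewrite ltnS => hs P0; have [pP|] := classic (primitive P).
  by exists 1, P; rewrite oner_neq0 mul1r.
move=> /not_all_ex_not[x /negP]; rewrite negbK => /eqP Px.
have rP i : root P`_i x.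
  by rewrite rootE; have := congr1 (fun p : {poly K} => p`_i) Px; rewrite coef_map coef0 => /eqP.
pose P1 := map_poly (fun c => c %/ ('X - x%:P)) P.
have PE : P = ('X - x%:P)%:P * P1.
  apply/polyP => i; rewrite coefCM coef_map_id0 ?div0p // mulrC divpK //.
  by rewrite dvdp_XsubCl.
have P10 : P1 != 0 by apply/eqP => z; move: P0; rewrite PE z mulr0 eqxx.
have hs1 : (size (lead_coef P1) < s)%N.
  move: hs; rewrite {1}PE lead_coefM lead_coefC mulrC size_Mmonic ?monicXsubC ?lead_coef_eq0 //.
  by rewrite size_XsubC addn2.
have [c [Q [c0 E pQ]]] := IH P1 hs1 P10.
exists (('X - x%:P) * c), Q; rewrite mulf_neq0 ?polyXsubC_eq0 //; split=> //.
by rewrite PE E polyCM mulrA.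
Qed.

(** Gauss's lemma: a root of one of the contents, divided by their gcd, would be a
    root of all coefficients of the opposite primitive part, or of the other content. *)
Lemma primitive_unique c P c' P' : c != 0 -> c' != 0 -> primitive P -> primitive P' ->
  c%:P * P = c'%:P * P' -> exists k : K, [/\ k != 0, c' = k *: c & P = (k%:P)%:P * P'].
Proof.
move=> c0 c'0 pP pP' E; set d := gcdp c c'.
have d0 : d != 0 by rewrite gcdp_eq0 negb_and c0.
have ec : c = c %/ d * d by rewrite divpK ?dvdp_gcdl.
have ec' : c' = c' %/ d * d by rewrite divpK ?dvdp_gcdr.
have co : coprimep (c %/ d) (c' %/ d) by rewrite coprimep_div_gcd // c0.
move: co ec ec'; set e := c %/ d; set e' := c' %/ d => co ec ec'.
have {}E : e%:P * P = e'%:P * P'.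
  apply: (@mulfI _ d%:P); first by rewrite polyC_eq0.
  by rewrite !mulrA -!polyCM -![d * _]mulrC -ec -ec'.
have const u u' Q Q' : coprimep u u' -> primitive Q' -> u%:P * Q = u'%:P * Q' -> size u = 1%N.
  move=> cuu pQ' EQ; apply/eqP; apply: contraT => /closed_rootP[x ux].
  have := congr1 (spec x) EQ; rewrite !rmorphM /= !spec_polyC (rootP ux) mul0r => /esym/eqP.
  rewrite mulf_eq0 (negbTE (pQ' x)) orbF polyC_eq0.
  by rewrite (negbTE (coprimep_root cuu ux)).
have /eqP/size_poly1P[k k0 ek] := const _ _ _ _ co pP' E.
have /eqP/size_poly1P[k' k'0 ek'] : size e' = 1%N.
  by apply: const pP (esym E); rewrite coprimep_sym.
exists (k' / k); rewrite mulf_neq0 ?invr_eq0 //; split=> //.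
  by rewrite ec ec' ek ek' !mul_polyC scalerA divfK.
move: E; rewrite ek ek' => E; apply: (@mulfI _ (k%:P)%:P); first by rewrite !polyC_eq0.
by rewrite E mulrA -!polyCM mulrCA divff // mulr1.
Qed.

Lemma power_not_constant N (c : K) : (0 < N)%N -> ~ (forall x : K, x ^+ N = c).
Proof.
move=> N0 h; have : 'X^N - c%:P = 0 by apply: poly_eq0 => x; rewrite !hornerE h subrr.
by move/eqP; rewrite -size_poly_eq0 size_XnsubC.
Qed.

(** This replaces unique factorization in two variables.  The contents, polynomials
    in [x] alone, and the primitive parts, over the field of fractions in [x], are
    treated separately by [gcdp_power]: a common factor of the contents, or of the
    primitive parts, would have infinitely many zeros, in contradiction to the
    assumption on the common zeros of [a] and [b].  The constant of the field that
    remains is an [N]-th power as [K] is algebraically closed. *)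
Lemma power_of_factor a b g N M C0 C1 : (0 < N)%N -> (0 < M)%N -> a != 0 -> b != 0 ->
  a * b = g ^+ N ->
  (forall x y, eval2 a x y = 0 -> eval2 b x y = 0 -> x ^+ M = C0 /\ y ^+ M = C1) ->
  exists h, a = h ^+ N.
Proof.
move=> N0 M0 a0 b0 abg zeros.
have g0 : g != 0.
  by apply/eqP => z; move/eqP: abg; rewrite z expr0n gtn_eqF //= mulf_eq0 (negbTE a0) (negbTE b0).
have [ca [a' [ca0 aE pa]]] := content a0; have [cb [b' [cb0 bE pb]]] := content b0.
have [cg [g' [cg0 gE pg]]] := content g0.
have E : (ca * cb)%:P * (a' * b') = (cg ^+ N)%:P * g' ^+ N.
  by rewrite polyCM polyC_exp -exprMn -gE -abg aE bE mulrACA.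
have [k [k0 cE gpE]] :=
  primitive_unique (mulf_neq0 ca0 cb0) (expf_neq0 N cg0) (primitiveM pa pb) (primitiveX N pg) E.
have eaE x y : eval2 a x y = ca.[x] * eval2 a' x y by rewrite aE eval2M eval2C.
have ebE x y : eval2 b x y = cb.[x] * eval2 b' x y by rewrite bE eval2M eval2C.
have co1 : coprimep ca cb.
  apply: Pdiv.ClosedField.root_coprimep => x rx; apply/eqP => bx.
  apply: (@power_not_constant M C1) => // y.
  by have [] := zeros x y; rewrite ?eaE ?ebE ?(rootP rx) ?bx ?mul0r.
have co2 : coprimep a' b'.
  rewrite /coprimep; apply: contraT => sd; exfalso; set d := gcdp a' b' in sd.
  have d0 : d != 0 by rewrite gcdp_eq0 negb_and (primitive_neq0 pa).
  have /Pdiv.Idomain.dvdpP[[c1 u1] /= c10 E1] : d %| a' by apply: dvdp_gcdl.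
  have /Pdiv.Idomain.dvdpP[[c2 u2] /= c20 E2] : d %| b' by apply: dvdp_gcdr.
  have : c1 * c2 * lead_coef d * ('X^M - C0%:P) = 0.
    apply: poly_eq0 => x; rewrite !hornerE.
    have [->|lx] := eqVneq (lead_coef d).[x] 0; first by rewrite mulr0 mul0r.
    have [->|x1] := eqVneq c1.[x] 0; first by rewrite !mul0r.
    have [->|x2] := eqVneq c2.[x] 0; first by rewrite mulr0 !mul0r.
    have [y dy] : exists y, root (spec x d) y.
      by apply/closed_rootP; rewrite size_map_poly_id0.
    have ed : eval2 d x y = 0 by rewrite eval2_horner; apply/eqP.
    have [||-> _] := zeros x y; last by rewrite subrr mulr0.
      have /eqP := congr1 (fun P => eval2 P x y) E1; rewrite -mul_polyC !eval2M ed mulr0 mulf_eq0.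
      by rewrite eval2C (negbTE x1) /= eaE => /eqP ->; rewrite mulr0.
    have /eqP := congr1 (fun P => eval2 P x y) E2; rewrite -mul_polyC !eval2M ed mulr0 mulf_eq0.
    by rewrite eval2C (negbTE x2) /= ebE => /eqP ->; rewrite mulr0.
  move/eqP; rewrite !mulf_eq0 (negbTE c10) (negbTE c20) lead_coef_eq0 (negbTE d0) /=.
  by rewrite -size_poly_eq0 size_XnsubC.
have /eqpf_eq[k1 k10 h1E] : gcdp ca cg ^+ N %= ca.
  by apply: (gcdp_power N0 ca0 co1); rewrite cE eqp_sym eqp_scale.
have /eqpP[[c1 c2] /= /andP[c10 c20] h2E] : gcdp a' g' ^+ N %= a'.
  apply: (gcdp_power N0 (primitive_neq0 pa) co2).
  by rewrite gpE mul_polyC eqp_scale ?polyC_eq0.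
have [c3 [h2 [c30 hE ph]]] : exists c Q, [/\ c != 0, gcdp a' g' = c%:P * Q & primitive Q].
  by apply: content; rewrite gcdp_eq0 negb_and (primitive_neq0 pa).
have E2 : c2%:P * a' = (c1 * c3 ^+ N)%:P * h2 ^+ N.
  by rewrite mul_polyC -h2E hE exprMn -mul_polyC polyCM polyC_exp mulrA.
have [k2 [k20 _ a'E]] :=
  primitive_unique c20 (mulf_neq0 c10 (expf_neq0 N c30)) pa (primitiveX N ph) E2.
have [z zN] : exists z : K, root ('X^N - (k1^-1 * k2)%:P) z.
  by apply/closed_rootP; rewrite size_XnsubC // eqSS -lt0n.
move: zN; rewrite rootE !hornerE subr_eq0 => /eqP zN.
exists ((z *: gcdp ca cg)%:P * h2).
rewrite exprMn -polyC_exp exprZn h1E zN scalerA mulrAC mulVf // mul1r aE a'E -mul_polyC.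
by rewrite polyCM -mulrA mulrCA mulrA [_ * (k2%:P)%:P]mulrC.
Qed.

End BivariatePowers.

Section PolynomialRoots.
Variable K : closedFieldType.

Lemma pfun_mulI n (f f' g : 'rV[K]_n -> K) : pfun f -> pfun f' -> pfun g ->
  (exists x, g x != 0) -> (forall x, f x * g x = f' x * g x) -> forall x, f x = f' x.
Proof.
move=> [p fp] [p' fp'] [r gr] [x0 g0] E.
suff pE : p = p' by move=> x; rewrite fp fp' pE.
have r0 : r != 0 by apply/eqP => z; move: g0; rewrite gr z meval0 eqxx.
by apply: (mulIf r0); apply: meval_inj => x; rewrite !mevalM -fp -fp' -gr E.
Qed.

(** The product of the differences [f - z g] over all roots of unity [z] is
    [f^N - g^N], which vanishes. *)
Lemma pfun_power_eq n N (f g : 'rV[K]_n -> K) : (0 < N)%N -> pfun f -> pfun g ->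
  (forall x, f x ^+ N = g x ^+ N) -> exists2 z : K, z ^+ N = 1 & forall x, f x = z * g x.
Proof.
move=> N0 [p fp] [r gr] E; have [s sE] := closed_field_poly_normal ('X^N - 1 : {poly K}).
rewrite (monicP (monicXnsubC 1 N0)) scale1r in sE.
have ss : size s = N by have := congr1 (size \o val) sE; rewrite /= size_XnsubC // size_prod_XsubC => -[].
have : \prod_(z <- s) (p - z *: r) = 0.
  apply: meval_inj => x; rewrite rmorph_prod meval0 /=.
  have [gx|gx] := eqVneq (g x) 0.
    have fx : f x = 0 by apply/eqP; have := E x; rewrite gx expr0n gtn_eqF // => /eqP; rewrite expf_eq0 N0.
    case: s ss {sE} => [|z s] ss; first by move: N0; rewrite -ss.
    by rewrite big_cons mevalB mevalZ -fp -gr fx gx mulr0 subrr mul0r.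
  have := congr1 (fun P => P.[f x / g x]) sE; rewrite horner_prod !hornerE expr_div_n E divff ?expf_neq0 //.
  rewrite subrr => /esym/eqP; rewrite prodf_seq_eq0 => /hasP[z zs /=]; rewrite !hornerE subr_eq0 => /eqP zE.
  apply/eqP; rewrite prodf_seq_eq0; apply/hasP; exists z => //=.
  by rewrite mevalB mevalZ -fp -gr -zE divfK // subrr.
move/eqP; rewrite prodf_seq_eq0 => /hasP[z zs /=]; rewrite subr_eq0 => /eqP pE.
exists z; last by move=> x; rewrite fp pE mevalZ -gr.
have := congr1 (fun P => P.[z]) sE; rewrite horner_prod !hornerE.
by rewrite (big_rem z zs) /= !hornerE subrr mul0r => /eqP; rewrite subr_eq0 => /eqP.
Qed.

Lemma pfun_factor_power (f g e : 'rV[K]_2 -> K) N M C0 C1 : (0 < N)%N -> (0 < M)%N ->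
  pfun f -> pfun g -> pfun e -> (exists x, f x != 0) -> (exists x, g x != 0) ->
  (forall x, f x * g x = e x ^+ N) ->
  (forall x, f x = 0 -> g x = 0 -> x 0 0 ^+ M = C0 /\ x 0 1 ^+ M = C1) ->
  exists2 h, pfun h & forall x, f x = h x ^+ N.
Proof.
have biv (f' : 'rV[K]_2 -> K) : pfun f' -> exists P, forall x, f' x = eval2 P (x 0 0) (x 0 1).
  by move=> [p fp]; have [P pE] := bivariate p; exists P => x; rewrite fp pE.
move=> N0 M0 /biv[a fa] /biv[b gb] /biv[c ec] [x fx] [y gy] E zeros.
have neq0 P (f' : 'rV[K]_2 -> K) w : (forall x, f' x = eval2 P (x 0 0) (x 0 1)) -> f' w != 0 -> P != 0.
  by move=> fE fw; apply/eqP => z; move: fw; rewrite fE z /eval2 !horner0 eqxx.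
have eX P k u v : eval2 (P ^+ k) u v = eval2 P u v ^+ k.
  by elim: k => [|k IH]; [rewrite /eval2 !expr0 !hornerE | rewrite !exprS eval2M IH].
have vE u v (P : {poly {poly K}}) (f' : 'rV[K]_2 -> K) :
    (forall x, f' x = eval2 P (x 0 0) (x 0 1)) -> eval2 P u v = f' (vec2 u v).
  by move=> ->; rewrite !mxE.
have [||h hE] := @power_of_factor K a b c N M C0 C1 N0 M0 (neq0 _ _ _ fa fx) (neq0 _ _ _ gb gy).
- apply/eqP; rewrite -subr_eq0; apply/eqP; apply: eval2_eq0 => u v.
  rewrite eval2D -[- c ^+ N]mulN1r !eval2M eX (vE _ _ _ _ fa) (vE _ _ _ _ gb) (vE _ _ _ _ ec) E.
  by rewrite /eval2 !hornerE mulN1r subrr.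
- move=> u v; rewrite (vE _ _ _ _ fa) (vE _ _ _ _ gb) => f0 g0.
  by have := zeros _ f0 g0; rewrite !mxE.
exists (fun x => eval2 h (x 0 0) (x 0 1)); first exact: pfun_eval2.
by move=> z; rewrite fa hE eX.
Qed.

End PolynomialRoots.

Section WeightLattice.
Implicit Types (q : 'I_2 -> 'rV[int]_2) (i j : int).

(** The image of the character lattice in the lattice of Cox exponents; it
    describes the action of the class group on the Cox space. *)
Definition weight_lattice q i j : Prop := exists u, pairing (q 0) u = i /\ pairing (q 1) u = j.

Definition swap_vectors q (j : 'I_2) := q (if j == 0 then 1 else 0).

Lemma weight_lattice_swap q i j : weight_lattice (swap_vectors q) i j <-> weight_lattice q j i.
Proof. by split=> -[u [E0 E1]]; exists u. Qed.

Definition lattice_index q : nat := absz (cross (q 0) (q 1)).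

Lemma lattice_index_gt0 S m q : facets S m q -> (0 < lattice_index q)%N.
Proof. by case=> _ _ D0 _ _; rewrite absz_gt0. Qed.

(** The exponents [(1, b)], with [b >= 0], and [(0, N)], where [N] is the index,
    generate the lattice: [q 0] is primitive, and the lattice vectors orthogonal to
    it are the multiples of one vector. *)
Lemma weight_latticeE S q : facets S 2 q ->
  exists b : nat, forall i j, weight_lattice q i j <-> (lattice_index q %| j - b%:Z * i)%Z.
Proof.
move=> fS; have [_ cop D0 _ _] := fS; set D := cross _ _ in D0.
have NE : (lattice_index q)%:Z = `|D| by rewrite abszE.
rewrite NE.
have /coprimezP[[s t] /= st] := cop 0 isT.
pose w : 'rV[int]_2 := \row_k (if k == 0 then s else t).
have w0 : pairing (q 0) w = 1 by rewrite pairingE !mxE /= -st; ring.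
have dE := dual_vectorE q; rewrite -/D in dE.
have Dp : 0 < `|D| by rewrite normr_gt0.
pose b0 := pairing (q 1) w.
have [b bE] : exists b : nat, b%:Z = b0 + `|b0| * `|D|.
  exists (absz (b0 + `|b0| * `|D|)); rewrite gez0_abs //; nia.
have scale (k : int) p u : pairing p (k *: u) = k * pairing p u by rewrite !pairingE !mxE; ring.
have kernel u j : pairing (q 0) u = 0 -> pairing (q 1) u = j -> (`|D| %| j)%Z.
  rewrite pairingE => h <-; apply/dvdzP; exists (sgz D * (s * u 0 1 - t * u 0 0)).
  have -> : `|D| = sgz D * D by rewrite normrEsg.
  rewrite mulrACA; have -> : sgz D * sgz D = 1 by case: (sgzP D) D0.
  rewrite mul1r pairingE /D /cross.
  have h0 : q 0 0 0 * u 0 0 = - (q 0 0 1 * u 0 1) by apply/eqP; rewrite -addr_eq0 h.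
  have -> : q 1 0 0 * u 0 0 + q 1 0 1 * u 0 1 =
    (s * q 0 0 0 + t * q 0 0 1) * (q 1 0 0 * u 0 0 + q 1 0 1 * u 0 1) by rewrite st mul1r.
  transitivity (s * q 1 0 0 * (q 0 0 0 * u 0 0) + t * q 0 0 1 * q 1 0 0 * u 0 0 +
    (s * q 0 0 0 + t * q 0 0 1) * (q 1 0 1 * u 0 1)); first by ring.
  rewrite h0; transitivity (- (s * q 1 0 0 * q 0 0 1 * u 0 1) + t * q 0 0 1 * q 1 0 0 * u 0 0 +
    s * q 0 0 0 * q 1 0 1 * u 0 1 - t * q 1 0 1 * (q 0 0 0 * u 0 0)); first by rewrite h0; ring.
  ring.
exists b => i j; split=> [[u [E0 E1]]|/dvdzP[k E]].
  apply: (kernel (u + (- i) *: (w + `|b0| *: dual_vector q 1))).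
    by rewrite !(pairingD, scale) dE w0 E0 /=; ring.
  by rewrite !(pairingD, scale) dE /= E1 -/b0 -bE mulNr mulrC.
exists (i *: (w + `|b0| *: dual_vector q 1) + k *: dual_vector q 1).
rewrite !(pairingD, scale) !dE /= w0 -/b0 -bE -E; split; ring.
Qed.

End WeightLattice.

(** * Comparison of two Cox presentations *)

Section Lifting.
Variable K : closedFieldType.
Variable n : nat.
Variable X : 'rV[K]_n -> Prop.
Hypothesis cX : zariski_closed X.
Implicit Types (q : 'I_2 -> 'rV[int]_2) (pi : 'rV[K]_2 -> 'rV[K]_n) (p : {mpoly K[n]}).

Lemma cox_space2 (x : 'rV[K]_2) : cox_space 2 x.
Proof. by move: x => x; apply: I2_ind. Qed.

Lemma presentation_meval m q pi p p' : cox_presentation X m q pi ->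
  (forall x, torus x -> p.@[pi x 0] = p'.@[pi x 0]) -> forall y, X y -> p.@[y 0] = p'.@[y 0].
Proof.
by move=> pres; apply: (presentation_eq cX pres); apply/regular_pfun/pfun_poly.
Qed.

Lemma plane_regular (f : 'rV[K]_2 -> K) : regular (cox_space 2) f -> pfun f.
Proof.
move=> rf; have rf' : regular (fun=> True) f.
  move=> x _; have [a [b [bx h]]] := rf x (cox_space2 x).
  by exists a, b; split=> // y _; apply: h; apply: cox_space2.
by have [p hp] := regular_closed (@full_closed K 2) rf'; exists p => x; apply: hp.
Qed.

Lemma plane_pullback pi p : morphism (cox_space 2) X pi -> pfun (fun x => p.@[pi x 0]).
Proof. by move=> mpi; exact: plane_regular (regular_comp mpi (regular_pfun (pfun_poly p))). Qed.

Lemma realize_monomial q pi (i j : nat) : cox_presentation X 2 q pi -> weight_lattice q i j ->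
  exists p, forall x, p.@[pi x 0] = x 0 0 ^+ i * x 0 1 ^+ j.
Proof.
move=> [_ _ _ real _] [u [E0 E1]]; have [|p hp] := real u.
  by apply: I2_ind => _; rewrite ?E0 ?E1.
by exists p => x; rewrite hp ?monomialE ?E0 ?E1 //; apply: cox_space2.
Qed.

(** The exponents are natural numbers here, since for two rays no coordinate of the
    Cox space is invertible. *)
Lemma expand_monomials q pi p : cox_presentation X 2 q pi ->
  exists (I : finType) (c : I -> K) (e : I -> nat * nat) (g : I -> {mpoly K[n]}),
  [/\ forall i, weight_lattice q (e i).1 (e i).2,
      forall i x, (g i).@[pi x 0] = x 0 0 ^+ (e i).1 * x 0 1 ^+ (e i).2
    & forall y, X y -> p.@[y 0] = \sum_i c i * (g i).@[y 0]].
Proof.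
move=> pres; have [_ _ expand _ _] := pres; have [I [c [u [cu E]]]] := expand p.
have /fin_all_exists2[e Le ue] (i : I) : exists2 e : nat * nat, weight_lattice q e.1 e.2 &
    c i != 0 -> pairing (q 0) (u i) = e.1 /\ pairing (q 1) (u i) = e.2.
  have [ci0|ci] := eqVneq (c i) 0.
    exists (0%N, 0%N); last by move=> /eqP[].
    by exists 0; rewrite !pairingE !mxE !mulr0 addr0.
  have := cu i ci 0 isT; have := cu i ci 1 isT.
  move E1 : (pairing (q 1) _) => [l|//] _; move E0 : (pairing (q 0) _) => [k|//] _.
  by exists (k, l) => //; exists (u i).
have /fin_all_exists[g hg] (i : I) := realize_monomial pres (Le i).
exists I, c, e, g; split=> // y.
have -> : \sum_i c i * (g i).@[y 0] = (\sum_i c i *: g i).@[y 0].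
  by rewrite rmorph_sum; apply: eq_bigr => i _ /=; rewrite mevalZ.
move: y; apply: (presentation_meval pres) => x Tx.
rewrite E ?rmorph_sum /=; last exact: cox_space2.
apply: eq_bigr => i _; rewrite mevalZ hg; have [->|ci] := eqVneq (c i) 0; first by rewrite !mul0r.
by have [E0 E1] := ue i ci; rewrite monomialE E0 E1.
Qed.

(** All nonconstant monomials vanish where the pure powers do, so the pure powers
    have at most one common zero on the variety. *)
Lemma pure_powers_common_zero q pi p p0 p1 N : (0 < N)%N -> cox_presentation X 2 q pi ->
  (forall x, p0.@[pi x 0] = x 0 0 ^+ N) -> (forall x, p1.@[pi x 0] = x 0 1 ^+ N) ->
  exists c, forall y, X y -> p0.@[y 0] = 0 -> p1.@[y 0] = 0 -> p.@[y 0] = c.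
Proof.
move=> N0 pres h0 h1; have [I [c [e [g [_ hg E]]]]] := expand_monomials p pres.
exists (\sum_i c i * (e i == (0%N, 0%N))%:R) => y Xy y0 y1; rewrite E //; apply: eq_bigr => i _.
congr (_ * _).
have P : (g i).@[y 0] ^+ N = p0.@[y 0] ^+ (e i).1 * p1.@[y 0] ^+ (e i).2.
  rewrite -!rmorphXn -rmorphM; move: y Xy {y0 y1}; apply: (presentation_meval pres) => x _.
  by rewrite mevalM !rmorphXn /= hg h0 h1 exprMn !(exprAC _ N).
case: (e i) P (hg i) => [k l] /=; rewrite y0 y1 !expr0n => P gE.
case: k P gE => [|k] P gE; last by apply/eqP; move/eqP: P; rewrite mul0r expf_eq0 => /andP[].
case: l P gE => [|l] P gE; last by apply/eqP; move/eqP: P; rewrite mulr0 expf_eq0 => /andP[].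
rewrite eqxx -(meval1 (y 0)); move: y Xy {y0 y1 P}; apply: (presentation_meval pres) => x _.
by rewrite meval1 gE !expr0 mulr1.
Qed.

(** The lift has as coordinates [N]-th roots of the functions on [X] that are the
    pure powers [x_0 ^ N] and [x_1 ^ N] in the first presentation.  These roots exist
    by [pfun_factor_power]: the monomial of exponent [(1, b)] is a regular function
    whose [N]-th power is the product of the first pure power and the [b]-th power
    of the second, and the two pure powers vanish together at one point of [X] at
    most, so at finitely many points of the plane; for the other root the monomial of
    exponent [(c, 1)] is used.  The root of the first pure power is determined up to
    a root of unity, which is chosen to match the monomial of exponent [(1, b)]; all
    other monomials then match, as [(1, b)] and [(0, N)] generate the lattice. *)
Lemma lift_presentation q pi q' pi' : cox_presentation X 2 q pi -> cox_presentation X 2 q' pi' ->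
  exists h k : 'rV[K]_2 -> K, [/\ pfun h, pfun k & forall x, pi (vec2 (h x) (k x)) = pi' x].
Proof.
move=> pres pres'; have [fS mpi _ _ _] := pres; have [fS' mpi' _ _ dense'] := pres'.
have [b LE] := weight_latticeE fS; have [c LE'] := weight_latticeE (facets_swap fS erefl).
set N := lattice_index q in LE.
have NE : lattice_index (swap_vectors q) = N by rewrite /N /lattice_index crossC abszN.
have N0 : (0 < N)%N := lattice_index_gt0 fS.
have LN0 : weight_lattice q N 0%N.
  by apply/weight_lattice_swap/LE'; rewrite -/(swap_vectors q) NE mulr0 subr0.
have L0N : weight_lattice q 0%N N by apply/LE; rewrite mulr0 subr0.
have L1b : weight_lattice q 1%N b by apply/LE; rewrite mulr1 subrr.
have Lc1 : weight_lattice q c 1%N.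
  by apply/weight_lattice_swap/LE'; rewrite -/(swap_vectors q) NE mulr1 subrr.
have [p0 h0] := realize_monomial pres LN0; have [p1 h1] := realize_monomial pres L0N.
have [pb hb] := realize_monomial pres L1b; have [pc hc] := realize_monomial pres Lc1.
have {}h0 x : p0.@[pi x 0] = x 0 0 ^+ N by rewrite h0 mulr1.
have {}h1 x : p1.@[pi x 0] = x 0 1 ^+ N by rewrite h1 mul1r.
have pull p := plane_pullback p mpi'.
have Xpi' x : X (pi' x) by apply: mpi'.1; apply: cox_space2.
have Xpi x : X (pi x) by apply: mpi.1; apply: cox_space2.
have nonzero p : (forall x, p.@[pi x 0] = x 0 0 ^+ N \/ p.@[pi x 0] = x 0 1 ^+ N) ->
    exists x, p.@[pi' x 0] != 0.
  move=> hp; apply: NNPP => none.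
  have z y : X y -> p.@[y 0] = 0.
    apply: dense' => x _; apply/eqP; apply: contraT => px; case: none; by exists x.
  have := z _ (Xpi (const_mx 1)); case: (hp (const_mx 1)) => ->; rewrite mxE expr1n => /eqP;
    by rewrite oner_eq0.
have nz0 := nonzero p0 (fun x => or_introl (h0 x)); have nz1 := nonzero p1 (fun x => or_intror (h1 x)).
have nzX p k : (exists x, p.@[pi' x 0] != 0) -> exists x, p.@[pi' x 0] ^+ k != 0.
  by move=> [x px]; exists x; rewrite expf_neq0.
have R0 y : X y -> p0.@[y 0] * p1.@[y 0] ^+ b = pb.@[y 0] ^+ N.
  rewrite -!rmorphXn -rmorphM; move: y; apply: (presentation_meval pres) => x _.
  by rewrite mevalM !rmorphXn /= h0 h1 hb expr1 exprMn (exprAC _ b).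
have R1 y : X y -> p1.@[y 0] * p0.@[y 0] ^+ c = pc.@[y 0] ^+ N.
  rewrite -!rmorphXn -rmorphM; move: y; apply: (presentation_meval pres) => x _.
  by rewrite mevalM !rmorphXn /= h0 h1 hc expr1 exprMn (exprAC _ c) mulrC.
have [fS1' _ _ _ _] := pres'; pose M := lattice_index q'; have M0 : (0 < M)%N := lattice_index_gt0 fS'.
have [r0 hr0] : exists p, forall x, p.@[pi' x 0] = x 0 0 ^+ M.
  have [c' LEs'] := weight_latticeE (facets_swap fS' erefl).
  have [|p hp] := realize_monomial (i := M) (j := 0) pres'.
    apply/weight_lattice_swap/LEs'; rewrite -/(swap_vectors q') mulr0 subr0.
    by rewrite /lattice_index crossC abszN.
  by exists p => x; rewrite hp mulr1.
have [r1 hr1] : exists p, forall x, p.@[pi' x 0] = x 0 1 ^+ M.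
  have [b' LEs'] := weight_latticeE fS'.
  have [|p hp] := realize_monomial (i := 0) (j := M) pres'.
    by apply/LEs'; rewrite mulr0 subr0.
  by exists p => x; rewrite hp mul1r.
have [C0 z0] := pure_powers_common_zero r0 N0 pres h0 h1.
have [C1 z1] := pure_powers_common_zero r1 N0 pres h0 h1.
have zeros x : p0.@[pi' x 0] = 0 -> p1.@[pi' x 0] = 0 -> x 0 0 ^+ M = C0 /\ x 0 1 ^+ M = C1.
  by move=> e0 e1; rewrite -hr0 -hr1 z0 ?z1.
have [h ph hN] : exists2 h, pfun h & forall x, p0.@[pi' x 0] = h x ^+ N.
  apply: (pfun_factor_power (C0 := C0) (C1 := C1) N0 M0 (pull p0) (pfunXn b (pull p1)) (pull pb) nz0 (nzX _ b nz1)).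
    by move=> x; apply: R0.
  by move=> x e0 /eqP; rewrite expf_eq0 => /andP[_ /eqP]; apply: zeros.
have [k pk kN] : exists2 k, pfun k & forall x, p1.@[pi' x 0] = k x ^+ N.
  apply: (pfun_factor_power (C0 := C0) (C1 := C1) N0 M0 (pull p1) (pfunXn c (pull p0)) (pull pc) nz1 (nzX _ c nz0)).
    by move=> x; apply: R1.
  by move=> x e1 /eqP; rewrite expf_eq0 => /andP[_ /eqP e0]; apply: zeros.
have [z zN bE] : exists2 z : K, z ^+ N = 1 & forall x, pb.@[pi' x 0] = z * (h x * k x ^+ b).
  apply: (pfun_power_eq N0 (pull pb)) => [|x]; first exact/(pfunM ph)/pfunXn.
  by rewrite -R0 // exprMn (exprAC _ b) hN kN.
exists (fun x => z * h x), k; split=> [||x]; first exact/pfunM/ph/pfun_const; first exact: pk.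
have mons (i j : nat) p : weight_lattice q i j ->
    (forall y, p.@[pi y 0] = y 0 0 ^+ i * y 0 1 ^+ j) ->
    forall x, p.@[pi' x 0] = (z * h x) ^+ i * k x ^+ j.
  move=> /LE/dvdzP[t tE] hp.
  (* [j] is [b i] plus a multiple of [N]; both sides of the relation are kept
     polynomial by moving the multiple to the side where it is nonnegative. *)
  have [s [t' st]] : exists s t' : nat, (j + N * s = b * i + N * t')%N.
    by exists (absz t), (absz t + absz t - absz (t - absz t))%N; nia.
  have R y : X y -> p.@[y 0] * p1.@[y 0] ^+ s = pb.@[y 0] ^+ i * p1.@[y 0] ^+ t'.
    rewrite -!rmorphXn -!rmorphM; move: y; apply: (presentation_meval pres) => y _.
    rewrite !mevalM !rmorphXn /= hp h1 hb expr1 exprMn -!exprM -!mulrA -!exprD; by rewrite st.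
  apply: (@pfun_mulI _ _ _ _ (fun x => p1.@[pi' x 0] ^+ s)).
  - exact: pull.
  - by apply: pfunM; apply: pfunXn => //; apply/pfunM/ph/pfun_const.
  - exact/pfunXn/pull.
  - exact: nzX.
  move=> y; rewrite R // bE kN mulrA [in LHS]exprMn -!mulrA; congr (_ * _).
  by rewrite -!exprM -!exprD st mulnC.
apply/rowP => l; have [I [c' [e [g [Le hg E]]]]] := expand_monomials 'X_l pres.
rewrite -(mevalXU (pi _ 0)) -(mevalXU (pi' _ 0)) !E //; apply: eq_bigr => i _; congr (_ * _).
by rewrite (mons _ _ _ (Le i) (hg i)) hg !vec2E.
Qed.

End Lifting.

Section LinearParts.
Variable K : closedFieldType.
Implicit Types (p : {mpoly K[2]}).

Definition along p (a : 'I_2 -> {poly K}) : {poly K} := mmap polyC a p.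

Lemma along_horner p a t : (along p a).[t] = p.@[fun i => (a i).[t]].
Proof.
rewrite /along mevalE /mmap horner_sum; apply: eq_bigr => m _.
rewrite hornerM hornerC /mmap1 horner_prod; congr (_ * _).
by apply: eq_bigr => i _; rewrite horner_exp.
Qed.

(** The chain rule at the point [c], for all curves through it at once. *)
Lemma gradient p (c : 'I_2 -> K) : exists g : 'I_2 -> K, forall a : 'I_2 -> {poly K}, (forall i, (a i).[0] = c i) ->
  (along p a)^`().[0] = \sum_i g i * (a i)^`().[0].
Proof.
pose good p := exists g : 'I_2 -> K, forall a : 'I_2 -> {poly K}, (forall i, (a i).[0] = c i) ->
  (along p a)^`().[0] = \sum_i g i * (a i)^`().[0].
have good1 : good 1.
  by exists (fun=> 0) => a _; rewrite /along rmorph1 derivC hornerC big1 // => i _; rewrite mul0r.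
have goodX i : good 'X_i.
  exists (fun j => (j == i)%:R) => a _; rewrite /along mmapX mmap1U.
  by rewrite (bigD1 i) //= eqxx mul1r big1 ?addr0 // => j /negbTE ->; rewrite mul0r.
have goodD p1 p2 : good p1 -> good p2 -> good (p1 + p2).
  move=> [g1 h1] [g2 h2]; exists (fun i => g1 i + g2 i) => a ac.
  rewrite /along rmorphD derivD hornerD; have := h1 a ac; have := h2 a ac; rewrite /along => -> ->.
  by rewrite -big_split; apply: eq_bigr => i _; rewrite mulrDl.
have goodM p1 p2 : good p1 -> good p2 -> good (p1 * p2).
  move=> [g1 h1] [g2 h2]; exists (fun i => g1 i * p2.@[c] + p1.@[c] * g2 i) => a ac.
  have E p' : (along p' a).[0] = p'.@[c] by rewrite along_horner; apply: meval_eq.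
  rewrite /along rmorphM derivM hornerD !hornerM; have := h1 a ac; have := h2 a ac.
  have := E p1; have := E p2; rewrite /along => -> -> -> ->.
  rewrite mulr_suml mulr_sumr -big_split; apply: eq_bigr => i _ /=; ring.
have goodZ k p1 : good p1 -> good (k *: p1).
  move=> [g h]; exists (fun i => k * g i) => a ac.
  rewrite /along mmapZ deriv_mulC hornerM hornerC; have := h a ac; rewrite /along => ->.
  by rewrite mulr_sumr; apply: eq_bigr => i _; rewrite mulrA.
suff : good p by [].
rewrite (mpolyE p); apply: (big_ind good) => //.
  by rewrite -(scale0r 1); apply: goodZ.
move=> m _; apply: goodZ; rewrite mpolyXE_id; apply: (big_ind good) => // i _.
by elim: (m i) => [|k IH]; rewrite ?expr0 ?exprS //; apply: goodM.
Qed.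

(** A diagonal scaling that an automorphism of the plane turns into another
    diagonal scaling has the same factors, up to order: compare linear parts at
    the origin. *)
Lemma diagonal_conjugates (h k g0 g1 : 'rV[K]_2 -> K) (s t e e' : K) :
  pfun h -> pfun k -> pfun g0 -> pfun g1 ->
  (forall x : 'rV[K]_2, g0 (vec2 (h x) (k x)) = x 0 0) ->
  (forall x : 'rV[K]_2, g1 (vec2 (h x) (k x)) = x 0 1) ->
  (forall x : 'rV[K]_2, h (vec2 (s * x 0 0) (t * x 0 1)) = e * h x) ->
  (forall x : 'rV[K]_2, k (vec2 (s * x 0 0) (t * x 0 1)) = e' * k x) ->
  (e = s /\ e' = t) \/ (e = t /\ e' = s).
Proof.
move=> [ph hE] [pk kE] [p0 g0E] [p1 g1E] G0 G1 hs ks.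
pose line (a b : K) (i : 'I_2) : {poly K} := if i == 0 then a *: 'X else b *: 'X.
pose image a b (i : 'I_2) : {poly K} := if i == 0 then along ph (line a b) else along pk (line a b).
have at_line p a b x : (along p (line a b)).[x] = p.@[vec2 (a * x) (b * x) 0].
  by rewrite along_horner; apply: meval_eq => i; rewrite mxE /line; case: ifP; rewrite !hornerE.
have at_image p a b x : (along p (image a b)).[x] =
    p.@[vec2 (h (vec2 (a * x) (b * x))) (k (vec2 (a * x) (b * x))) 0].
  rewrite along_horner; apply: meval_eq => i; rewrite mxE /image.
  by case: ifP => _; rewrite at_line -?hE -?kE.
have same (p q : {poly K}) : (forall x, p.[x] = q.[x]) -> p = q.
  by move=> E; apply/eqP; rewrite -subr_eq0; apply/eqP/poly_eq0 => x; rewrite hornerD hornerN E subrr.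
have tangent p : exists g : 'I_2 -> K, forall a b, (along p (line a b))^`().[0] = g 0 * a + g 1 * b.
  have [g hg] := gradient p (fun=> 0); exists g => a b.
  rewrite hg => [|i]; last by rewrite /line; case: ifP; rewrite !hornerE.
  by rewrite big2 /line /= !derivZ derivX !hornerE /= !mulr1.
have [H dH] := tangent ph; have [T dT] := tangent pk.
have chain p : exists g : 'I_2 -> K, forall a b, (along p (image a b))^`().[0] =
    g 0 * (H 0 * a + H 1 * b) + g 1 * (T 0 * a + T 1 * b).
  have [g hg] := gradient p (fun i => if i == 0 then h 0 else k 0); exists g => a b.
  rewrite hg => [|i].
    by rewrite big2 /image /= dH dT.
  have z : vec2 (a * 0) (b * 0) = 0 :> 'rV[K]_2 by apply: row2_eq; rewrite !mxE /= mulr0.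
  by rewrite /image; case: ifP => _; rewrite at_line z -?hE -?kE.
have [A dA] := chain p0; have [B dB] := chain p1.
have EA a b : A 0 * (H 0 * a + H 1 * b) + A 1 * (T 0 * a + T 1 * b) = a.
  rewrite -dA; have -> : along p0 (image a b) = a *: 'X.
    by apply: same => x; rewrite at_image -g0E G0 mxE /= !hornerE.
  by rewrite derivZ derivX hornerZ hornerC mulr1.
have EB a b : B 0 * (H 0 * a + H 1 * b) + B 1 * (T 0 * a + T 1 * b) = b.
  rewrite -dB; have -> : along p1 (image a b) = b *: 'X.
    by apply: same => x; rewrite at_image -g1E G1 mxE /= !hornerE.
  by rewrite derivZ derivX hornerZ hornerC mulr1.
have eigen p (f : 'rV[K]_2 -> K) (g : 'I_2 -> K) c : (forall x, f x = p.@[x 0]) ->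
    (forall x : 'rV[K]_2, f (vec2 (s * x 0 0) (t * x 0 1)) = c * f x) ->
    (forall a b, (along p (line a b))^`().[0] = g 0 * a + g 1 * b) ->
    forall a b, g 0 * (s * a) + g 1 * (t * b) = c * (g 0 * a + g 1 * b).
  move=> fE fs dg a b; rewrite -!dg.
  have -> : along p (line (s * a) (t * b)) = c *: along p (line a b).
    by apply: same => x; rewrite hornerZ !at_line -!fE -fs !mxE /= !mulrA.
  by rewrite derivZ hornerZ.
have EH := eigen _ _ _ _ hE hs dH; have ET := eigen _ _ _ _ kE ks dT.
have A10 := EA 1 0; have A01 := EA 0 1; have B10 := EB 1 0; have B01 := EB 0 1.
have H10 := EH 1 0; have H01 := EH 0 1; have T10 := ET 1 0; have T01 := ET 0 1.
rewrite !(mulr0, mulr1, addr0, add0r) in A10 A01 B10 B01 H10 H01 T10 T01.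
have factor (g c d : K) : g * c = d * g -> g != 0 -> d = c.
  by rewrite mulrC => E g0'; apply: (mulIf g0').
(* The linear part of the automorphism has a nonzero determinant, so one of the two
   products of its entries is nonzero; eigenvectors then match the factors. *)
have [z0|n0] := eqVneq (H 0 * T 1) 0; last first.
  left; move: n0; rewrite mulf_eq0 negb_or => /andP[H0 T1].
  by split; [apply: factor H10 H0 | apply: factor T01 T1].
right; have [z1|] := eqVneq (H 1 * T 0) 0; last first.
  rewrite mulf_eq0 negb_or => /andP[H1 T0].
  by split; [apply: factor H01 H1 | apply: factor T10 T0].
have : (1 : K) = 0.
  transitivity ((A 0 * B 1 - A 1 * B 0) * (H 0 * T 1 - H 1 * T 0)); last by rewrite z0 z1 subrr mulr0.
  transitivity ((A 0 * H 0 + A 1 * T 0) * (B 0 * H 1 + B 1 * T 1) -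
    (A 0 * H 1 + A 1 * T 1) * (B 0 * H 0 + B 1 * T 0)); last by ring.
  by rewrite A10 A01 B10 B01 mul0r subr0 mulr1.
by move/eqP; rewrite oner_eq0.
Qed.

End LinearParts.

Section PlaneComparison.
Variable K : closedFieldType.
Hypothesis char0 : [pchar K] =i pred0.
Variable n : nat.
Variable X : 'rV[K]_n -> Prop.
Hypothesis cX : zariski_closed X.
Implicit Types (q : 'I_2 -> 'rV[int]_2) (pi : 'rV[K]_2 -> 'rV[K]_n) (p : {mpoly K[n]}).

Lemma vec2_eta (x : 'rV[K]_2) : vec2 (x 0 0) (x 0 1) = x.
Proof. by apply: row2_eq; rewrite vec2E. Qed.

Lemma pfun_vec2 (h a b : 'rV[K]_2 -> K) : pfun h -> pfun a -> pfun b ->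
  pfun (fun x => h (vec2 (a x) (b x))).
Proof.
move=> [p hp] pa pb; apply: (pfun_eq (g := fun x => p.@[vec2 (a x) (b x) 0])) => [x|]; first exact: hp.
apply: pfun_comp_row; apply: I2_ind.
  by apply: pfun_eq pa => x; rewrite vec2E.
by apply: pfun_eq pb => x; rewrite vec2E.
Qed.

Lemma pure_powers q pi : cox_presentation X 2 q pi -> exists N p0 p1, [/\ (0 < N)%N,
  forall x, p0.@[pi x 0] = x 0 0 ^+ N & forall x, p1.@[pi x 0] = x 0 1 ^+ N].
Proof.
move=> pres; have [fS _ _ _ _] := pres; exists (lattice_index q).
have [b LE] := weight_latticeE fS; have [c LE'] := weight_latticeE (facets_swap fS erefl).
have [|p0 h0] := realize_monomial (i := lattice_index q) (j := 0) pres.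
  by apply/weight_lattice_swap/LE'; rewrite -/(swap_vectors q) mulr0 subr0 /lattice_index crossC abszN.
have [|p1 h1] := realize_monomial (i := 0) (j := lattice_index q) pres.
  by apply/LE; rewrite mulr0 subr0.
exists p0, p1; split=> [|x|x]; first exact: lattice_index_gt0 fS.
  by rewrite h0 mulr1.
by rewrite h1 mul1r.
Qed.

(** The pure powers [x_0 ^ N] and [x_1 ^ N] are functions on [X], so a lift of the
    identity multiplies the coordinates by roots of unity. *)
Lemma lift_endomorphism q pi (a b : 'rV[K]_2 -> K) : cox_presentation X 2 q pi -> pfun a -> pfun b ->
  (forall x, pi (vec2 (a x) (b x)) = pi x) ->
  exists z w : K, [/\ z != 0, w != 0 & forall x, vec2 (a x) (b x) = vec2 (z * x 0 0) (w * x 0 1)].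
Proof.
move=> pres pa pb E; have [N [p0 [p1 [N0 h0 h1]]]] := pure_powers pres.
have [z zN az] : exists2 z : K, z ^+ N = 1 & forall x, a x = z * x 0 0.
  apply: (pfun_power_eq N0 pa (pfun_coord K 0)) => x.
  by rewrite -h0 -E h0 vec2E.
have [w wN bw] : exists2 w : K, w ^+ N = 1 & forall x, b x = w * x 0 1.
  apply: (pfun_power_eq N0 pb (pfun_coord K 1)) => x.
  by rewrite -h1 -E h1 vec2E.
have unit (u : K) : u ^+ N = 1 -> u != 0.
  by move=> uN; apply/eqP => u0; move/eqP: uN; rewrite u0 expr0n gtn_eqF // eq_sym oner_eq0.
by exists z, w; split; [exact: unit | exact: unit | move=> x; rewrite az bw].
Qed.

(** The two lifts compose to diagonal maps in both orders, so both are bijective. *)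
Lemma plane_lift q pi q' pi' : cox_presentation X 2 q pi -> cox_presentation X 2 q' pi' ->
  exists Phi Psi : 'rV[K]_2 -> 'rV[K]_2,
  [/\ forall j, pfun (fun x => Phi x 0 j), forall j, pfun (fun x => Psi x 0 j),
      forall x, Psi (Phi x) = x, forall x, Phi (Psi x) = x & forall x, pi (Phi x) = pi' x].
Proof.
move=> pres pres'; have [h [k [ph pk E]]] := lift_presentation cX pres pres'.
have [h' [k' [ph' pk' E']]] := lift_presentation cX pres' pres.
pose Phi x := vec2 (h x) (k x); pose Lam x := vec2 (h' x) (k' x).
have [|||z [w [z0 w0 D]]] := @lift_endomorphism q pi (fun x => h (Lam x)) (fun x => k (Lam x)) pres.
- exact: pfun_vec2.
- exact: pfun_vec2.
- by move=> x; rewrite E E'.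
have [|||z' [w' [z'0 w'0 D']]] := @lift_endomorphism q' pi' (fun x => h' (Phi x)) (fun x => k' (Phi x)) pres'.
- exact: pfun_vec2.
- exact: pfun_vec2.
- by move=> x; rewrite E' E.
have inj x y : Phi x = Phi y -> x = y.
  move=> e; have := D' x; rewrite e D' => e'.
  have e0 := congr1 (fun v : 'rV[K]_2 => v 0 0) e'; have e1 := congr1 (fun v : 'rV[K]_2 => v 0 1) e'.
  by rewrite !vec2E in e0 e1; apply/esym/row2_eq; [apply: mulfI z'0 _ _ e0 | apply: mulfI w'0 _ _ e1].
pose Psi (x : 'rV[K]_2) := Lam (vec2 (z^-1 * x 0 0) (w^-1 * x 0 1)).
have PhiK x : Phi (Psi x) = x.
  by rewrite /Phi /Psi D !vec2E !mulrA !divff // !mul1r vec2_eta.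
have pscale (j : 'I_2) (u : K) : pfun (fun x : 'rV[K]_2 => u * x 0 j).
  by apply: pfunM; [apply: pfun_const | apply: pfun_coord].
exists Phi, Psi; split=> [||x|x|x]; last by rewrite E.
- by apply: I2_ind; [apply: pfun_eq ph | apply: pfun_eq pk] => x; rewrite vec2E.
- apply: I2_ind.
    by apply: (pfun_eq (g := fun x => h' (vec2 (z^-1 * x 0 0) (w^-1 * x 0 1)))) => [x|];
      [rewrite vec2E | apply: pfun_vec2].
  by apply: (pfun_eq (g := fun x => k' (vec2 (z^-1 * x 0 0) (w^-1 * x 0 1)))) => [x|];
    [rewrite vec2E | apply: pfun_vec2].
- by apply: inj; rewrite PhiK.
exact: PhiK.
Qed.

Lemma primitive_root_congruence N (z : K) i j : N.-primitive_root z -> z ^+ i = z ^+ j ->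
  (N %| i%:Z - j%:Z)%Z.
Proof.
move=> zN /eqP; rewrite (eq_prim_root_expr zN) => /eqP E.
by rewrite -eqz_mod_dvd !modz_nat E.
Qed.

(** Let [z] be a primitive root of unity of order the index of the second lattice.  The
    diagonal map [(z^-b', z)], where [(1, b')] is in that lattice, is an automorphism
    over [X] of the second presentation.  The lift conjugates it to a diagonal map
    over [X] of the first presentation, on which the characters of the first lattice
    are trivial; by [diagonal_conjugates] the factors are the same up to order. *)
Lemma weight_lattice_sub q pi q' pi' : cox_presentation X 2 q pi -> cox_presentation X 2 q' pi' ->
  (forall i j, weight_lattice q i j -> weight_lattice q' i j) \/
  (forall i j, weight_lattice q i j -> weight_lattice q' j i).
Proof.
move=> pres pres'; have [Phi [Psi [pPhi pPsi PhiK PsiK E]]] := plane_lift pres pres'.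
have [fS _ _ _ _] := pres; have [fS' mpi' _ _ _] := pres'.
have [b LE] := weight_latticeE fS; have [b' LE'] := weight_latticeE fS'.
set N := lattice_index q in LE; set N' := lattice_index q' in LE'.
have [z zN] := primitive_root_exists char0 (lattice_index_gt0 fS').
rewrite -/N' in zN; have N'0 : (0 < N')%N := lattice_index_gt0 fS'.
have z0 : z != 0 by apply/eqP => e; have := prim_expr_order zN; rewrite e expr0n gtn_eqF // => /eqP; rewrite eq_sym oner_eq0.
pose s := z^-1 ^+ b'; pose sigma (x : 'rV[K]_2) := vec2 (s * x 0 0) (z * x 0 1).
have invariant x : pi' (sigma x) = pi' x.
  have Xpi' y : X (pi' y) by apply: mpi'.1; apply: cox_space2.
  apply/rowP => l; have [I [c [e [g [Le hg El]]]]] := expand_monomials cX 'X_l pres'.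
  rewrite -(mevalXU (pi' (sigma x) 0)) -(mevalXU (pi' x 0)) !El //; apply: eq_bigr => i _; congr (_ * _).
  rewrite !hg !vec2E !exprMn mulrACA -[RHS]mul1r; congr (_ * _).
  have /LE'/dvdzP[t tE] := Le i.
  rewrite /s -exprM exprVn; apply: (mulfI (expf_neq0 (b' * (e i).1) z0)).
  rewrite mulrA divff ?expf_neq0 // mul1r mulr1.
  apply/eqP; rewrite (eq_prim_root_expr zN); apply/eqP.
  move: tE; case: t => t tE; last first.
    have -> : (b' * (e i).1 = t.+1 * N' + (e i).2)%N by nia.
    by rewrite modnMDl.
  have -> : ((e i).2 = t * N' + b' * (e i).1)%N by nia.
  by rewrite modnMDl.
have [M [p0 [p1 [M0 h0 h1]]]] := pure_powers pres.
have psigma j (f : 'rV[K]_2 -> 'rV[K]_2) : (forall j, pfun (fun x => f x 0 j)) -> pfun (fun x => f (sigma x) 0 j).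
  by move=> pf; apply: (@pfun_vec2 (fun x => f x 0 j)) => //; apply: pfunM;
    do ?[exact: pfun_const | exact: pfun_coord].
have [e0 _ E0] : exists2 e : K, e ^+ M = 1 & forall x, Phi (sigma x) 0 0 = e * Phi x 0 0.
  apply: (pfun_power_eq M0 (psigma 0 _ pPhi) (pPhi 0)) => x.
  by rewrite -!h0 !E invariant.
have [e1 _ E1] : exists2 e : K, e ^+ M = 1 & forall x, Phi (sigma x) 0 1 = e * Phi x 0 1.
  apply: (pfun_power_eq M0 (psigma 1 _ pPhi) (pPhi 1)) => x.
  by rewrite -!h1 !E invariant.
have trivial (i j : nat) : weight_lattice q i j -> e0 ^+ i * e1 ^+ j = 1.
  move=> Lij; have [p hp] := realize_monomial pres Lij.
  have := hp (Phi (sigma (Psi (const_mx 1)))); rewrite E invariant -E hp PsiK E0 E1 PsiK.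
  by rewrite !mxE !expr1n !mulr1.
have T1 : e0 * e1 ^+ b = 1 by rewrite -[e0]expr1; apply: trivial; apply/LE; rewrite mulr1 subrr.
have T2 : e1 ^+ N = 1 by rewrite -[LHS]mul1r -(expr0 e0); apply: trivial; apply/LE; rewrite mulr0 subr0.
have inv k : z^-1 ^+ k * z ^+ k = 1 by rewrite -exprMn mulVf // expr1n.
case: (@diagonal_conjugates K (fun x => Phi x 0 0) (fun x => Phi x 0 1) (fun x => Psi x 0 0)
  (fun x => Psi x 0 1) s z e0 e1 (pPhi 0) (pPhi 1) (pPsi 0) (pPsi 1)) => [x|x|x|x|[es ez]|[ez es]].
- by rewrite vec2_eta PhiK.
- by rewrite vec2_eta PhiK.
- exact: E0.
- exact: E1.
- left; rewrite {}es {}ez in T1 T2.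
  have /primitive_root_congruence-/(_ _ zN)/dvdzP[u uE] : z ^+ b = z ^+ b'.
    by rewrite -[LHS]mul1r -(inv b') mulrAC [_ * z ^+ b]T1 mul1r.
  have /primitive_root_congruence-/(_ _ zN)/dvdzP[v vE] : z ^+ N = z ^+ 0 by rewrite expr0.
  move=> i j /LE/dvdzP[w wE]; apply/LE'/dvdzP; exists (w * v + u * i).
  have -> : j - b'%:Z * i = (j - b%:Z * i) + (b%:Z - b'%:Z) * i by ring.
  by rewrite subr0 in vE; rewrite wE uE vE; ring.
right; rewrite {}es {}ez in T1 T2.
have /primitive_root_congruence-/(_ _ zN)/dvdzP[u uE] : z ^+ 1 = z ^+ (b' * b).
  rewrite -[RHS]mul1r -T1 /s -exprM expr1 -[LHS]mulr1 -mulrA inv //.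
have /primitive_root_congruence-/(_ _ zN)/dvdzP[v vE] : z ^+ 0 = z ^+ (b' * N).
  by rewrite -[RHS]mul1r -T2 /s -exprM inv.
move=> i j /LE/dvdzP[w wE]; apply/LE'/dvdzP; exists (u * i + v * w).
have -> : i - b'%:Z * j = (1%:Z - (b' * b)%N%:Z) * i + (0%:Z - (b' * N)%N%:Z) * w.
  have -> : j = b%:Z * i + w * N%:Z by rewrite -wE; ring.
  by rewrite !PoszM; ring.
by rewrite uE vE; ring.
Qed.

(** The inclusions in both directions give equal indices, hence equal lattices. *)
Lemma weight_lattice_compare q pi q' pi' : cox_presentation X 2 q pi -> cox_presentation X 2 q' pi' ->
  (forall i j, weight_lattice q i j <-> weight_lattice q' i j) \/
  (forall i j, weight_lattice q i j <-> weight_lattice q' j i).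
Proof.
move=> pres pres'; have [fS _ _ _ _] := pres; have [fS' _ _ _ _] := pres'.
have index_dvd r rho r' rho' : cox_presentation X 2 r rho -> cox_presentation X 2 r' rho' ->
    (lattice_index r' %| lattice_index r)%N.
  move=> pr pr'; have [fr _ _ _ _] := pr; have [fr' _ _ _ _] := pr'.
  have [b LE] := weight_latticeE fr; have [c LEs] := weight_latticeE (facets_swap fr erefl).
  have [b' LE'] := weight_latticeE fr'.
  have L0N : weight_lattice r 0 (lattice_index r) by apply/LE; rewrite mulr0 subr0.
  have LN0 : weight_lattice r (lattice_index r) 0.
    by apply/weight_lattice_swap/LEs; rewrite -/(swap_vectors r) mulr0 subr0 /lattice_index crossC abszN.
  by case: (weight_lattice_sub pr pr') => [/(_ _ _ L0N)|/(_ _ _ LN0)] /LE'; rewrite mulr0 subr0.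
have NN : lattice_index q = lattice_index q'.
  by apply/eqP; rewrite eqn_dvd (index_dvd _ _ _ _ pres pres') (index_dvd _ _ _ _ pres' pres).
have [b LE] := weight_latticeE fS; have [b' LE'] := weight_latticeE fS'.
have [c' LEs'] := weight_latticeE (facets_swap fS' erefl).
have NE : lattice_index (swap_vectors q') = lattice_index q' by rewrite /lattice_index crossC abszN.
have Lb i : weight_lattice q i (b%:Z * i) by apply/LE; rewrite subrr.
case: (weight_lattice_sub pres pres') => sub; [left | right] => i j; split; try exact: sub.
  move=> /LE'/dvdzP[v vE]; have /LE'/dvdzP[u uE] := sub _ _ (Lb i).
  by apply/LE/dvdzP; exists (v - u); rewrite NN mulrBl -vE -uE; ring.
move=> /(weight_lattice_swap q' i j)/LEs'; rewrite -/(swap_vectors q') NE => /dvdzP[v vE].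
have /(weight_lattice_swap q' i _)/LEs' := sub _ _ (Lb i); rewrite -/(swap_vectors q') NE => /dvdzP[u uE].
by apply/LE/dvdzP; exists (v - u); rewrite NN mulrBl -vE -uE; ring.
Qed.

End PlaneComparison.

Section Comparison.
Variable K : closedFieldType.
Hypothesis char0 : [pchar K] =i pred0.
Variable n : nat.
Variable X : 'rV[K]_n -> Prop.
Hypothesis cX : zariski_closed X.
Implicit Types (q : 'I_2 -> 'rV[int]_2) (pi : 'rV[K]_2 -> 'rV[K]_n) (p : {mpoly K[n]}).

Lemma nonvanishing_constant (f : 'rV[K]_2 -> K) : regular (cox_space 2) f -> (forall x, f x != 0) ->
  forall x y, f x = f y.
Proof.
move=> /plane_regular[p fp] nz x y; have [P pE] := bivariate p.
have E z : f z = eval2 P (z 0 0) (z 0 1) by rewrite fp pE.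
have nzP a b : eval2 P a b != 0 by rewrite -(vec2E0 a b) -{2}(vec2E1 a b) -E.
by rewrite !E (nonvanishing_constant2 nzP (x 0 0)) (nonvanishing_constant2 nzP (y 0 0)).
Qed.

Lemma presentation_isomorphism m q pi : cox_presentation X m q pi -> (m < 2)%N ->
  isomorphism (cox_space m) X pi.
Proof. by move=> pres m2; have [[_ _ _ D1 _] _ _ _ _] := pres; apply: (unimodular_isomorphism cX pres (D1 m2)). Qed.

(** The invertible functions on [X] determine the number of rays: they are constant
    for two rays and not for fewer, and they separate the points for no rays, but
    are constant on the lines of direction [x_0] for one ray. *)
Lemma presentation_rays_le m q pi m' q' pi' :
  cox_presentation X m q pi -> cox_presentation X m' q' pi' -> (m' <= m)%N.
Proof.
move=> pres pres'; rewrite leqNgt; apply/negP => mm'.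
have [[m'2 _ _ _ _] mpi' _ _ _] := pres'; have m2 : (m < 2)%N by apply: leq_trans m'2.
have [mpi [G [mG Gpi piG]]] := presentation_isomorphism pres m2.
have mP : morphism (cox_space m') (cox_space m) (fun x => G (pi' x)) := morphism_comp mpi' mG.
have [m'E|] := eqVneq m' 2%N.
  rewrite m'E in mP mpi' pres'; have mj : (m <= (1%R : 'I_2))%N by rewrite -ltnS.
  pose k := G (pi' 0) 0 1.
  have Gk y : X y -> G y 0 1 = k.
    apply: (presentation_eq cX pres' (mG.2 1)) => [|x _]; first exact/regular_pfun/pfun_const.
    apply: (nonvanishing_constant (f := fun x => G (pi' x) 0 1)) => [|w]; first exact: mP.2.
    exact: mP.1 (cox_space2 w) _ mj.
  have [z [z0 z1 _]] := nontrivial_root char0 (N := 2) isT.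
  have xk (b : K) : b != 0 -> b = k.
    move=> b0; have Cb : cox_space m (vec2 1 b) by apply: vec2_stab => // _; apply: oner_neq0.
    by rewrite -(vec2E1 1 b) -(Gpi _ Cb) Gk //; apply: mpi.1.
  by move/eqP: z1; apply; rewrite (xk z z0) [RHS]xk // oner_neq0.
move=> m'n2; have m'1 : m' = 1%N by move: m'2 m'n2 mm'; case: (m') => [|[|[|]]].
have m0 : m = 0%N by move: mm'; rewrite m'1 ltnS leqn0 => /eqP.
rewrite m'1 m0 in pres pres' mP mpi mpi' mG Gpi piG.
have [_ [G' [_ G'pi _]]] := presentation_isomorphism pres' isT.
have ml : morphism (cox_space 2) (cox_space 1) (fun x : 'rV[K]_2 => vec2 (x 0 0) 1).
  apply: morphism_pfun => [x _|]; first by apply: vec2_stab => // _; apply: oner_neq0.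
  apply: I2_ind.
    by apply: (pfun_eq (g := fun x => x 0 0)) => [x|]; [rewrite vec2E | apply: pfun_coord].
  by apply: (pfun_eq (g := fun=> 1)) => [x|]; [rewrite vec2E | apply: pfun_const].
have mPl := morphism_comp ml mP.
have E : G (pi' (vec2 0 1)) = G (pi' (vec2 1 1)).
  apply/rowP => j; have := nonvanishing_constant (mPl.2 j) (fun x => mPl.1 x (cox_space2 x) j isT) 0 (const_mx 1).
  by rewrite !mxE.
have C1 (a : K) : cox_space 1 (vec2 a 1) by apply: vec2_stab => // _; apply: oner_neq0.
have := congr1 (fun y => G' (pi y) 0 0) E.
rewrite !piG; try exact/mpi'.1/C1.
by rewrite !G'pi // !vec2E => /esym/eqP; rewrite oner_eq0.
Qed.

Lemma unimodular_lattice q i j : `|cross (q 0) (q 1)| = 1 -> weight_lattice q i j.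
Proof.
move=> D1; exists (i *: dual_vector q 0 + j *: dual_vector q 1).
have scale (k : int) r u : pairing r (k *: u) = k * pairing r u by rewrite !pairingE !mxE; ring.
by rewrite !pairingD !scale !dual_vectorE /= D1; split; ring.
Qed.

Lemma compare_presentations m q pi m' q' pi' :
  cox_presentation X m q pi -> cox_presentation X m' q' pi' ->
  [/\ m' = m, exists Phi Psi, [/\ morphism (cox_space m) (cox_space m) Phi,
        morphism (cox_space m) (cox_space m) Psi,
        forall x, cox_space m x -> Psi (Phi x) = x, forall x, cox_space m x -> Phi (Psi x) = x
      & forall x, cox_space m x -> pi (Phi x) = pi' x]
    & (forall i j, weight_lattice q i j <-> weight_lattice q' i j) \/
      (m = 2%N /\ forall i j, weight_lattice q i j <-> weight_lattice q' j i)].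
Proof.
move=> pres pres'.
have mE : m' = m by apply/eqP; rewrite eqn_leq (presentation_rays_le pres pres') (presentation_rays_le pres' pres).
rewrite {}mE in pres' *; split=> //.
  have [m2|m2] := eqVneq m 2%N.
    rewrite m2 in pres pres' *; have [Phi [Psi [pPhi pPsi PhiK PsiK E]]] := plane_lift cX pres pres'.
    exists Phi, Psi; split.
    - by apply: morphism_pfun => // x _; apply: cox_space2.
    - by apply: morphism_pfun => // x _; apply: cox_space2.
    - by move=> x _; apply: PhiK.
    - by move=> x _; apply: PsiK.
    by move=> x _; apply: E.
  have lt2 : (m < 2)%N by have [[h _ _ _ _] _ _ _ _] := pres; rewrite ltn_neqAle m2.
  have [mpi [G [mG Gpi piG]]] := presentation_isomorphism pres lt2.
  have [mpi' [G' [mG' Gpi' piG']]] := presentation_isomorphism pres' lt2.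
  exists (fun x => G (pi' x)), (fun x => G' (pi x)); split.
  - exact: morphism_comp mpi' mG.
  - exact: morphism_comp mpi mG'.
  - by move=> x Cx; rewrite piG ?Gpi' //; apply: mpi'.1.
  - by move=> x Cx; rewrite piG' ?Gpi //; apply: mpi.1.
  by move=> x Cx; rewrite piG //; apply: mpi'.1.
have [m2|m2] := eqVneq m 2%N.
  rewrite m2 in pres pres'; case: (weight_lattice_compare char0 cX pres pres'); first by left.
  by right.
have lt2 : (m < 2)%N by have [[h _ _ _ _] _ _ _ _] := pres; rewrite ltn_neqAle m2.
have [[_ _ _ /(_ lt2) D1 _] _ _ _ _] := pres; have [[_ _ _ /(_ lt2) D1' _] _ _ _ _] := pres'.
by left=> i j; split=> _; apply: unimodular_lattice.
Qed.

(** The coordinates of [pi], composed with [tau], are combinations of monomials that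
    are functions on [X] by way of [pi']. *)
Lemma descend_map m q pi q' pi' tau :
  cox_presentation X m q pi -> cox_presentation X m q' pi' ->
  morphism (cox_space m) (cox_space m) tau ->
  (forall u, nonneg_on m q u -> exists2 u', nonneg_on m q' u' &
     forall x, cox_space m x -> monomial q u (tau x) = monomial q' u' x) ->
  exists alpha, morphism X X alpha /\ forall x, cox_space m x -> alpha (pi' x) = pi (tau x).
Proof.
move=> pres pres' mtau perm; have [_ mpi expand _ _] := pres; have [_ mpi' _ real' _] := pres'.
have /fin_all_exists[I /fin_all_exists[c /fin_all_exists[u hu]]] (l : 'I_n) := expand 'X_l.
have /fin_all_exists[g hg] (l : 'I_n) : exists g : I l -> {mpoly K[n]}, forall i, c l i != 0 ->
    forall x, cox_space m x -> (g i).@[pi' x 0] = monomial q (u l i) (tau x).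
  have /fin_all_exists[g hg] (i : I l) : exists p, c l i != 0 ->
      forall x, cox_space m x -> p.@[pi' x 0] = monomial q (u l i) (tau x).
    have [ci|ci] := eqVneq (c l i) 0; first by exists 0 => /eqP[].
    have [u' Su' E] := perm _ ((hu l).1 i ci); have [p hp] := real' _ Su'.
    by exists p => _ x Cx; rewrite E ?hp.
  by exists g.
pose alpha (y : 'rV[K]_n) : 'rV[K]_n := \row_l \sum_i c l i * (g l i).@[y 0].
have aE x : cox_space m x -> alpha (pi' x) = pi (tau x).
  move=> Cx; apply/rowP => l; rewrite mxE -(mevalXU (pi (tau x) 0)) (hu l).2; last exact: mtau.1.
  apply: eq_bigr => i _; have [->|ci] := eqVneq (c l i) 0; first by rewrite !mul0r.
  by rewrite hg.
have palpha l : pfun (fun y => alpha y 0 l).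
  apply: (pfun_eq (g := fun y => \sum_i c l i * (g l i).@[y 0])) => [y|]; first by rewrite mxE.
  by apply: pfun_sum => i; apply: pfunM; [apply: pfun_const | apply: pfun_poly].
exists alpha; split=> //; apply: morphism_pfun => // y Xy.
have [S XS] := cX; apply/XS => f Sf.
apply: (presentation_eq cX pres' (f := fun y => f.@[alpha y 0]) (g := fun=> 0)) Xy.
- exact/regular_pfun/pfun_comp_row.
- exact/regular_pfun/pfun_const.
move=> x Tx; have Cx := torus_cox (m := m) Tx; rewrite aE //.
by have /XS := mpi.1 _ (mtau.1 _ Cx); apply.
Qed.

(** The product is carried to the given Cox space by the lift [Phi], and from there
    to the normal form by [tau] composed with the inverse of [Phi].  As [tau]
    descends to [alpha], coherence is preserved in both steps. *)
Lemma transport_product m q pi q' pi' mu nu' Phi Psi tau alpha beta :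
  cox_presentation X m q pi -> cox_presentation X m q' pi' ->
  algebraic_monoid X mu -> algebraic_monoid (cox_space m) nu' -> coherent m pi' mu nu' ->
  [/\ morphism (cox_space m) (cox_space m) Phi, morphism (cox_space m) (cox_space m) Psi,
      forall x, cox_space m x -> Psi (Phi x) = x, forall x, cox_space m x -> Phi (Psi x) = x
    & forall x, cox_space m x -> pi (Phi x) = pi' x] ->
  morphism (cox_space m) (cox_space m) tau -> (forall x, cox_space m x -> tau (tau x) = x) ->
  morphism X X alpha -> (forall x, cox_space m x -> alpha (pi' x) = pi (tau x)) ->
  morphism X X beta -> (forall x, cox_space m x -> beta (pi x) = pi' (tau x)) ->
  exists mubar, [/\ algebraic_monoid (cox_space m) mubar, coherent m pi mu mubar
    & exists mu' nu alpha alphabar,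
      [/\ algebraic_monoid X mu' /\ algebraic_monoid (cox_space m) nu,
          monoid_isomorphism X mu X mu' alpha,
          monoid_isomorphism (cox_space m) mubar (cox_space m) nu alphabar,
          (forall x, cox_space m x -> pi (alphabar x) = alpha (pi x)) /\ coherent m pi mu' nu
        & given_by m nu (fun x y => tau (nu' (tau x) (tau y)))]].
Proof.
move=> pres pres' amu anu cnu [mPhi mPsi PhiK PsiK E] mtau tauK malpha alphaE mbeta betaE.
have [_ mpi _ _ _] := pres; have [_ mpi' _ _ _] := pres'.
have [lcX iX] : locally_closed X /\ irreducible X by case: amu.
have lcC := @cox_space_locally_closed K m; have iC := @cox_space_irreducible K m.
have [_ mornu _ _] := anu.
have nuP x y : cox_space m x -> cox_space m y -> cox_space m (nu' x y).
  move=> Cx Cy; have := mornu.1 (row_mx x y); rewrite /product row_mxKl row_mxKr; exact.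
have [abar isobar] := monoid_transport anu lcC iC mPhi mPsi PhiK PsiK.
set mubar := (fun x y => Phi _) in abar isobar.
have cbar : coherent m pi mu mubar.
  move=> x y Cx Cy; have Px := mPsi.1 _ Cx; have Py := mPsi.1 _ Cy.
  rewrite /mubar E; last exact: nuP.
  by rewrite cnu // -!E // !PsiK.
have alphaK y : X y -> beta (alpha y) = y.
  move=> Xy; apply/rowP => l.
  apply: (presentation_eq cX pres' (f := fun y => beta (alpha y) 0 l) (g := fun y => y 0 l)) Xy.
  - exact: (morphism_comp malpha mbeta).2.
  - exact/regular_pfun/pfun_coord.
  move=> x Tx; have Cx := torus_cox (m := m) Tx; rewrite alphaE // betaE ?tauK //.
  exact: mtau.1.
have betaK y : X y -> alpha (beta y) = y.
  move=> Xy; apply/rowP => l.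
  apply: (presentation_eq cX pres (f := fun y => alpha (beta y) 0 l) (g := fun y => y 0 l)) Xy.
  - exact: (morphism_comp mbeta malpha).2.
  - exact/regular_pfun/pfun_coord.
  move=> x Tx; have Cx := torus_cox (m := m) Tx; rewrite betaE // alphaE ?tauK //.
  exact: mtau.1.
have [amu' isomu] := monoid_transport amu lcX iX malpha mbeta alphaK betaK.
set mu' := (fun x y => alpha _) in amu' isomu.
pose abr x := tau (Psi x); pose abri x := Phi (tau x).
have mabr : morphism (cox_space m) (cox_space m) abr := morphism_comp mPsi mtau.
have mabri : morphism (cox_space m) (cox_space m) abri := morphism_comp mtau mPhi.
have abrK x : cox_space m x -> abri (abr x) = x.
  by move=> Cx; rewrite /abr /abri tauK ?PsiK //; apply: mPsi.1.
have abriK x : cox_space m x -> abr (abri x) = x.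
  by move=> Cx; rewrite /abr /abri PhiK ?tauK //; apply: mtau.1.
have [anu0 isonu] := monoid_transport abar lcC iC mabr mabri abrK abriK.
set nu := (fun x y => abr _) in anu0 isonu.
have piabr x : cox_space m x -> pi (abr x) = alpha (pi x).
  by move=> Cx; have Px := mPsi.1 _ Cx; rewrite /abr -alphaE // -E // PsiK.
exists mubar; split=> //; exists mu', nu, alpha, abr; split=> //.
  split=> // x y Cx Cy; have Ax := mabri.1 _ Cx; have Ay := mabri.1 _ Cy.
  have [_ mbar _ _] := abar.
  have Cxy : cox_space m (mubar (abri x) (abri y)).
    have := mbar.1 (row_mx (abri x) (abri y)); rewrite /product row_mxKl row_mxKr; exact.
  have Tx := mtau.1 _ Cx; have Ty := mtau.1 _ Cy.
  by rewrite /nu piabr // cbar // /mu' !betaE // /abri !E.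
move=> x y Cx Cy; have Tx := mtau.1 _ Cx; have Ty := mtau.1 _ Cy.
rewrite /nu /abr /mubar /abri !(PhiK (tau _)) // PhiK //.
exact: nuP.
Qed.

End Comparison.

(** * The theorem *)

Section NormalForms.
Variable K : closedFieldType.
Variable n : nat.
Variable X : 'rV[K]_n -> Prop.
Hypothesis cX : zariski_closed X.
Implicit Types (q : 'I_2 -> 'rV[int]_2) (pi : 'rV[K]_2 -> 'rV[K]_n).

Definition swap (x : 'rV[K]_2) : 'rV[K]_2 := vec2 (x 0 1) (x 0 0).

Lemma swapK x : swap (swap x) = x.
Proof. by apply: row2_eq; rewrite !vec2E. Qed.

Lemma match_monomials m q q' : (forall i j, weight_lattice q i j -> weight_lattice q' i j) ->
  forall u, nonneg_on m q u -> exists2 u', nonneg_on m q' u' &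
    forall x, cox_space (K := K) m x -> monomial q u x = monomial q' u' x.
Proof.
move=> LL u Su; have [|u' [E0 E1]] := LL (pairing (q 0) u) (pairing (q 1) u); first by exists u.
exists u'; last by move=> x _; rewrite !monomialE E0 E1.
by apply: I2_ind => jm; rewrite ?E0 ?E1; apply: Su.
Qed.

Lemma match_swapped_monomials q q' : (forall i j, weight_lattice q i j -> weight_lattice q' j i) ->
  forall u, nonneg_on 2 q u -> exists2 u', nonneg_on 2 q' u' &
    forall x, cox_space (K := K) 2 x -> monomial q u (swap x) = monomial q' u' x.
Proof.
move=> LL u Su; have [|u' [E0 E1]] := LL (pairing (q 0) u) (pairing (q 1) u); first by exists u.
exists u'; last by move=> x _; rewrite !monomialE E0 E1 !vec2E mulrC.
by apply: I2_ind => jm; rewrite ?E0 ?E1; apply: Su.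
Qed.

(** The lattice has index one, so that [q 0], [q 1] is a lattice basis. *)
Lemma full_lattice_isomorphism q pi : cox_presentation X 2 q pi ->
  (forall i j, weight_lattice q i j) -> isomorphism (cox_space 2) X pi.
Proof.
move=> pres full; apply: (unimodular_isomorphism cX pres); have [fS _ _ _ _] := pres.
have [b LE] := weight_latticeE fS; have /LE := full 0 1; rewrite mulr0 subr0.
by rewrite dvdz1 absz_nat => /eqP E; rewrite -abszE -/(lattice_index q) E.
Qed.

(** The exponents of a Demazure root form the vector [(-1, d)] of the lattice of the
    monoid presentation; equality of lattices provides the root for [q]. *)
Lemma normal_form_direct r m q pi q' nu nu' : cox_presentation X m q pi ->
  (forall i j, weight_lattice q i j <-> weight_lattice q' i j) ->
  standard_product r m q' nu' -> given_by m nu nu' -> normal_form X r m q pi nu.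
Proof.
move=> pres LL std given; have [[m2 _ _ _ _] _ _ _ _] := pres.
have piso : (m < 2)%N -> isomorphism (cox_space m) X pi := presentation_isomorphism cX pres.
case: std => [[r2 nuE]|[r1 m0 [e [e0 e1 nuE]]]|[r0 mE D1 nuE]]; rewrite {}nuE in given.
- apply: Or41; split=> //; case: (m) m2 piso => [|[|[|]]] // _ piso.
  + by apply: Or33; split=> //; apply: piso.
  + by apply: Or32; split=> //; apply: piso.
  by apply: Or31.
- have [mE|mE] := eqVneq m 2%N; last first.
    have m1 : m = 1%N by move: m0 m2 mE; case: (m) => [|[|[|]]].
    by apply: Or43; split=> //; [apply: piso; rewrite m1 | exists (pairing (q' 1) e)].
  have [u [u0 u1]] : weight_lattice q (-1) (pairing (q' 1) e) by apply/LL; exists e.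
  apply: Or42; split=> //; left; exists u; last by rewrite u1.
  split=> //.
  by apply: I2_ind => // _ _; rewrite u1 e1 // mE.
apply: Or44; split=> //; rewrite mE in pres *; apply: (full_lattice_isomorphism pres) => i j.
by apply/LL/unimodular_lattice.
Qed.

Lemma normal_form_swapped r q pi q' nu nu' : cox_presentation X 2 q pi ->
  (forall i j, weight_lattice q i j <-> weight_lattice q' j i) ->
  standard_product r 2 q' nu' -> given_by 2 nu (fun x y => swap (nu' (swap x) (swap y))) ->
  normal_form X r 2 q pi nu.
Proof.
move=> pres LL std given.
case: std => [[r2 nuE]|[r1 m0 [e [e0 e1 nuE]]]|[r0 mE D1 nuE]]; rewrite {}nuE in given.
- apply: Or41; split=> //; first by apply: Or31.
  by move=> x y Cx Cy; rewrite given //; apply: row2_eq; rewrite !vec2E.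
- have [u [u0 u1]] : weight_lattice q (pairing (q' 1) e) (-1) by apply/LL; exists e.
  apply: Or42; split=> //; right; exists u.
    by split=> //; apply: I2_ind => // _ _; rewrite u0 e1.
  by move=> x y Cx Cy; rewrite given // u0; apply: row2_eq; rewrite !vec2E.
apply: Or44; split=> //.
  by apply: (full_lattice_isomorphism pres) => i j; apply/LL/unimodular_lattice.
by move=> x y Cx Cy; rewrite given //; apply: row2_eq; rewrite !vec2E.
Qed.

End NormalForms.

Theorem theorem4 (K : closedFieldType) (char0 : [pchar K] =i pred0)
    (n : nat) (X : 'rV[K]_n -> Prop) (r : nat)
    (surfX : normal_affine_surface X)
    (admX : exists mu, commutative_monoid_of_rank X mu r) :
  toric X /\
  forall (act : 'rV[K]_2 -> 'rV[K]_n -> 'rV[K]_n) (x0 : 'rV[K]_n),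
    toric_structure X act x0 ->
    (exists m q pi, cox_construction X act x0 m q pi) /\
    forall (m : nat) (q : 'I_2 -> 'rV[int]_2) (pi : 'rV[K]_2 -> 'rV[K]_n),
      cox_construction X act x0 m q pi ->
      forall mu, commutative_monoid_of_rank X mu r ->
      exists mubar : 'rV[K]_2 -> 'rV[K]_2 -> 'rV[K]_2,
        [/\ algebraic_monoid (cox_space m) mubar,
            coherent m pi mu mubar
          & exists (mu' : 'rV[K]_n -> 'rV[K]_n -> 'rV[K]_n)
                   (nu : 'rV[K]_2 -> 'rV[K]_2 -> 'rV[K]_2)
                   (alpha : 'rV[K]_n -> 'rV[K]_n)
                   (alphabar : 'rV[K]_2 -> 'rV[K]_2),
              [/\ algebraic_monoid X mu' /\ algebraic_monoid (cox_space m) nu,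
                  monoid_isomorphism X mu X mu' alpha,
                  monoid_isomorphism (cox_space m) mubar (cox_space m) nu alphabar,
                  (forall x, cox_space m x -> pi (alphabar x) = alpha (pi x)) /\
                  coherent m pi mu' nu
                & normal_form X r m q pi nu]].
Proof.
have [cX iX dX nX] := surfX; split.
  have [mu cmu] := admX; have [r2 [F [G up]]] := rank_data cX iX dX cmu.
  have [[[_ mmu assoc [e ue]] comm] _] := cmu.
  have [chX _ _] := unit_parametrization_chart char0 cX iX mmu assoc comm ue r2 up.
  exact: toric_of_chart cX chX.
move=> act x0 tor; split; first exact: cox_construction_exists.
move=> m q pi /(presentation_of_cox_construction char0 surfX tor) pres mu cmu.
have amu : algebraic_monoid X mu by case: cmu => [[]].
have [m' [q' [pi' [nu' [pres' anu cnu std]]]]] := monoid_presentation char0 surfX cmu.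
have [mE [Phi [Psi lift]] LL] := compare_presentations char0 cX pres pres'.
rewrite {}mE in pres' anu cnu std.
case: LL => [LL|[m2 LL]].
  have mid := morphism_id (cox_space (K := K) m).
  have [|alpha [malpha alphaE]] := descend_map cX pres pres' mid.
    by apply: match_monomials => i j /LL.
  have [|beta [mbeta betaE]] := descend_map cX pres' pres mid.
    by apply: match_monomials => i j /LL.
  have [mubar [abar cbar [mu' [nu [a [abr [h1 h2 h3 h4 given]]]]]]] :=
    transport_product cX pres pres' amu anu cnu lift mid (fun x _ => erefl)
      malpha alphaE mbeta betaE.
  exists mubar; split=> //; exists mu', nu, a, abr; split=> //.
  exact: normal_form_direct pres LL std given.
rewrite m2 in pres pres' anu cnu std lift *.
have mswap : morphism (cox_space (K := K) 2) (cox_space 2) (@swap K).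
  apply: morphism_pfun => [x _|]; first exact: cox_space2.
  by apply: I2_ind; apply: pfun_eq (pfun_coord K _) => x; rewrite vec2E.
have [|alpha [malpha alphaE]] := descend_map cX pres pres' mswap.
  by apply: match_swapped_monomials => i j /LL.
have [|beta [mbeta betaE]] := descend_map cX pres' pres mswap.
  by apply: match_swapped_monomials => i j Lij; apply/LL.
have [mubar [abar cbar [mu' [nu [a [abr [h1 h2 h3 h4 given]]]]]]] :=
  transport_product cX pres pres' amu anu cnu lift mswap (fun x _ => swapK x)
    malpha alphaE mbeta betaE.
exists mubar; split=> //; exists mu', nu, a, abr; split=> //.
exact: normal_form_swapped pres LL std given.
Qed.
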